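(* Let $m>1$, $(p,q)\in\mathbb{R}^2$, and let $\epsilon>0$ be given. For a noncompact geodesically complete Riemannian manifold $M$ with reference point $o\in M$ write $V(r)=\mu(B(o,r))$, and consider the differential inequality $$\Delta_m u+u^p|\nabla u|^q\le 0\quad\text{on } M. \qquad ( * )$$ (A) Assume $p\ge 0$ and $m-1-p<q<m$. Then there exists a noncompact geodesically complete Riemannian manifold $M$ satisfying $V(r)\lesssim r^{\frac{mp+q}{p+q-m+1}}(\ln r)^{\frac{m-1}{p+q-m+1}+\epsilon}$ for all large enough $r$, such that $( * )$ possesses a nontrivial positive solution. (B) Assume $q\ge m$. Then there exists a noncompact geodesically complete Riemannian manifold $M$ satisfying $V(r)\lesssim r^{m}(\ln r)^{m-1+\epsilon}$ for all large enough $r$, such that $( * )$ possesses a nontrivial positive solution. (C) Assume $p<0$ and $m-1<q<m$. Then there exists a noncompact geodesically complete Riemannian manifold $M$ satisfying $V(r)\lesssim r^{\frac{q}{q-m+1}}(\ln r)^{\frac{m-1}{q-m+1}+\epsilon}$ for all large enough $r$, such that $( * )$ possesses a nontrivial positive solution. (D) Assume $q=m-1$ and $p<m-1-q$ (that is, $p<0$). Given $\lambda>0$, there exists a noncompact geodesically complete Riemannian manifold $M$ satisfying $V(r)\lesssim e^{\lambda r}$ for all large enough $r$, such that $( * )$ possesses a nontrivial positive solution. (E) Assume $p=m-1-q$ and $q\le m-1$. Then there exist some positive constant $\iota$ and a noncompact geodesically complete Riemannian manifold $M$ satisfying $V(r)\lesssim e^{\iota r}$ for all large enough $r$, such that $(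 * )$ possesses a nontrivial positive solution. (F) Assume $p<m-1-q$ and $q<m-1$. Given $\lambda>0$, there exist some positive constant $\iota>2(m-1-q)+1$ and a noncompact geodesically complete Riemannian manifold $M$ satisfying $V(r)\lesssim e^{\lambda r^{\iota}\ln r}$ for all large enough $r$, such that $( * )$ possesses a nontrivial positive solution.
   Context: $d$ is the geodesic distance on $M$, $\mu$ the Riemannian measure, $B(x,r)=\{y\in M: d(x,y)<r\}$, and $o\in M$ is a reference point. $U\lesssim W$ means $U\le cW$ for some constant $c>0$ (here independent of $r$). $\Delta_m u=\operatorname{div}(|\nabla u|^{m-2}\nabla u)$. $W^{1,m}_{loc}(M)$ is the space of $f\in L^m_{loc}(M)$ whose weak gradient $\nabla f$ is in $L^m_{loc}(M)$; $W^{1,m}_c(M)$ is the subspace of functions with compact support. Solutions are understood in the weak sense: a positive solution of $\Delta_m u+u^p|\nabla u|^q\le 0$ on $M$ is a positive function $u\in W^{1,m}_{loc}(M)$ such that for every nonnegative $\psi\in W^{1,m}_c(M)$ $$-\int_M|\nabla u|^{m-2}(\nabla u,\nabla\psi)\,d\mu+\int_M u^p|\nabla u|^q\psi\,d\mu\le 0 .$$ ''Nontrivial'' means not constant. *)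

(* Defs.v *)
From HB Require Import structures.
From mathcomp Require Import all_boot all_order all_algebra.
From mathcomp Require Import all_classical all_reals all_analysis.

Set Implicit Arguments.
Unset Strict Implicit.
Unset Printing Implicit Defensive.

Import Order.TTheory GRing.Theory Num.Theory.
Import numFieldNormedType.Exports.

Local Open Scope classical_set_scope.
Local Open Scope ring_scope.

Section calculus.
Context {R : realType}.

Definition partial {n} (k : 'I_n) (f : 'rV[R]_n -> R) : 'rV[R]_n -> R :=
  fun z => 'D_(delta_mx 0 k) f z.

(* C^oo on the open set U: every iterated partial derivative, of any order and
   in any directions, is continuous and has partial derivatives on U. *)
Definition smooth_on {n} (U : set 'rV[R]_n) (f : 'rV[R]_n -> R) : Prop :=
  forall (s : seq 'I_n) (z : 'rV[R]_n), U z ->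
    {for z, continuous (foldr partial f s)} /\
    (forall k, derivable (foldr partial f s) z (delta_mx 0 k)).

(* The integral over R^n of a nonnegative Borel function, as an iterated
   integral; by Tonelli this is the integral against the n-dimensional
   Lebesgue measure. *)
Fixpoint integral_rV (n : nat) : ('rV[R]_n -> \bar R) -> \bar R :=
  match n with
  | 0 => fun f => f 0
  | n'.+1 => fun f => (\int[@lebesgue_measure R]_t
      integral_rV (fun z : 'rV[R]_n' => f (row_mx (t%:M : 'rV[R]_1) z)))%E
  end.

(* a |-> a ^ q for a >= 0 and real q, with 0 ^ q = +oo when q < 0 (whereas powR
   gives 0) and 0 ^ 0 = 1. *)
Definition epow (a q : R) : \bar R :=
  if (a == 0) && (q < 0) then +oo%E else (a `^ q)%:E.

End calculus.

(* Connected C^oo Riemannian manifolds (without boundary) of dimension n.+1.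
   The chart i maps the open set [dom i] homeomorphically onto the open set
   [coord i @` dom i], with inverse [param i]; the values of [coord i],
   [param i] and [metric i] elsewhere are irrelevant. [chart_at x] is a
   preferred chart around x. Tangent vectors are row vectors of components, and
   change from the chart i to the chart j by right multiplication by the
   Jacobian matrix of [coord j \o param i]. *)
Record riemannian_manifold (R : realType) (n : nat) := RiemannianManifold {
  carrier :> ptopologicalType ;
  carrier_hausdorff : hausdorff_space carrier ;
  carrier_second_countable : @second_countable carrier ;
  carrier_connected : connected [set: carrier] ;
  chart : Type ;
  dom : chart -> set carrier ;
  coord : chart -> carrier -> 'rV[R]_n.+1 ;
  param : chart -> 'rV[R]_n.+1 -> carrier ;
  chart_at : carrier -> chart ;
  dom_chart_at : forall x, dom (chart_at x) x ;
  dom_open : forall i, open (dom i) ;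
  range_open : forall i, open (coord i @` dom i) ;
  coordK : forall i x, dom i x -> param i (coord i x) = x ;
  coord_continuous : forall i x, dom i x -> {for x, continuous (coord i)} ;
  param_continuous : forall i z, (coord i @` dom i) z ->
    {for z, continuous (param i)} ;
  transition_smooth : forall i j k,
    smooth_on (coord i @` (dom i `&` dom j))
      (fun z => coord j (param i z) 0 k) ;
  metric : chart -> 'rV[R]_n.+1 -> 'M[R]_n.+1 ;
  metric_smooth : forall i a b,
    smooth_on (coord i @` dom i) (fun z => metric i z a b) ;
  metric_sym : forall i z, (coord i @` dom i) z ->
    (metric i z)^T = metric i z ;
  metric_gt0 : forall i z (v : 'rV[R]_n.+1), (coord i @` dom i) z ->
    v != 0 -> 0 < (v *m metric i z *m v^T) 0 0 ;
  metric_change : forall i j z, (coord i @` (dom i `&` dom j)) z ->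
    metric i z = 'J (coord j \o param i) z
                 *m metric j (coord j (param i z))
                 *m ('J (coord j \o param i) z)^T
}.

Section geometry.
Context {R : realType} {n : nat} (M : riemannian_manifold R n).

Implicit Types (x y : M) (i : chart M) (z : 'rV[R]_n.+1).

(* A tangent vector at x is given by its components in the chart [chart_at x];
   [component i x v] are its components in the chart i. *)
Local Notation tangent := 'rV[R]_n.+1.

Definition inner x (v w : tangent) : R :=
  (v *m metric (chart_at x) (coord (chart_at x) x) *m w^T) 0 0.

Definition tnorm x (v : tangent) : R := Num.sqrt (inner x v v).

Definition component i x (v : tangent) : 'rV[R]_n.+1 :=
  v *m 'J (coord i \o param (chart_at x)) (coord (chart_at x) x).

Definition velocity (c : R -> M) (t : R) : tangent :=
  derive1 (coord (chart_at (c t)) \o c) t.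

Definition C1_curve (c : R -> M) : Prop :=
  continuous c /\
  forall i t, dom i (c t) ->
    derivable (coord i \o c) t 1 /\ {for t, continuous (derive1 (coord i \o c))}.

Definition curve_length (c : R -> M) : \bar R :=
  (\int[@lebesgue_measure R]_(t in `[0%R, 1%R]) (tnorm (c t) (velocity c t))%:E)%E.

(* Curves are defined and C^1 on the whole of R; only their restriction to
   [0, 1] matters. *)
Definition geodesic_dist x y : \bar R :=
  ereal_inf [set curve_length c | c in
    [set c : R -> M | [/\ C1_curve c, c 0 = x & c 1 = y]]].

Definition geodesic_ball x (r : R) : set M :=
  [set y | (geodesic_dist x y < r%:E)%E].

Definition christoffel i z (k a b : 'I_n.+1) : R :=
  2^-1 * \sum_l invmx (metric i z) k l *
    (partial a (fun w => metric i w b l) z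
     + partial b (fun w => metric i w a l) z
     - partial l (fun w => metric i w a b) z).

Definition geodesic (c : R -> M) : Prop :=
  continuous c /\
  forall i t, dom i (c t) ->
    let f := coord i \o c in
    [/\ derivable f t 1, derivable (derive1 f) t 1 &
      forall k, derive1 (derive1 f) t 0 k
        + \sum_a \sum_b christoffel i (f t) k a b * derive1 f t 0 a * derive1 f t 0 b
        = 0].

(* Every exponential map exp_x is defined on the whole tangent space. *)
Definition geodesically_complete : Prop :=
  forall x (v : tangent),
    exists c : R -> M, [/\ geodesic c, c 0 = x & velocity c 0 = v].

Local Notation borel := (g_sigma_algebraType (@open M)).

Definition vol_density i z : R := Num.sqrt (\det (metric i z)).

(* By second countability this determines mu on the Borel sets. *)
Definition riemannian_measure (mu : {measure set borel -> \bar R}) : Prop :=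
  forall i (A : set borel), measurable A -> A `<=` dom i ->
    mu A = integral_rV
      (fun z => (\1_(coord i @` A) z * vol_density i z)%:E).

Definition compactly_supported {V : zmodType} (f : M -> V) : Prop :=
  exists2 K : set M, compact K & forall x, ~ K x -> f x = 0.

Definition smooth_field (X : M -> tangent) : Prop :=
  forall i k, smooth_on (coord i @` dom i)
    (fun z => component i (param i z) (X (param i z)) 0 k).

Definition measurable_field (X : M -> tangent) : Prop :=
  forall i k, measurable_fun (dom i : set borel)
    (fun x : borel => component i x (X x) 0 k).

Definition divergence (X : M -> tangent) x : R :=
  let i := chart_at x in
  (vol_density i (coord i x))^-1 *
  \sum_k partial k
    (fun z => vol_density i z * component i (param i z) (X (param i z)) 0 k) (coord i x).

End geometry.

Section sobolev.
Context {R : realType} {n : nat} (M : riemannian_manifold R n).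
Local Notation tangent := 'rV[R]_n.+1.
Local Notation borel := (g_sigma_algebraType (@open M)).

Variable mu : {measure set borel -> \bar R}.

Definition Lloc (m : R) (a : M -> R) : Prop :=
  forall K : set M, compact K ->
    (\int[mu]_(x in K) ((`|a x| `^ m)%:E) < +oo)%E.

Definition weak_gradient (f : M -> R) (G : M -> tangent) : Prop :=
  forall X : M -> tangent, smooth_field X -> compactly_supported X ->
    (\int[mu]_x (inner x (G x) (X x))%:E
     = - \int[mu]_x (f x * divergence X x)%:E)%E.

(* f is in W^{1,m}_loc and G is its weak gradient. *)
Definition sobolev_loc (m : R) (f : M -> R) (G : M -> tangent) : Prop :=
  [/\ measurable_fun [set: borel] (f : borel -> R),
      measurable_field G,
      Lloc m f,
      Lloc m (fun x => tnorm x (G x)) &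
      weak_gradient f G].

Definition positive_solution (m p q : R) (u : M -> R) : Prop :=
  (forall x, 0 < u x) /\
  exists2 G : M -> tangent, sobolev_loc m u G &
    forall (psi : M -> R) (H : M -> tangent),
      sobolev_loc m psi H -> compactly_supported psi ->
      (forall x, 0 <= psi x) ->
      (- (\int[mu]_x (tnorm x (G x) `^ (m - 2) * inner x (G x) (H x))%:E)
       + \int[mu]_x ((u x `^ p)%:E * epow (tnorm x (G x)) q * (psi x)%:E)
       <= 0)%E.

(* Elements of W^{1,m}_loc are functions up to null sets, hence so is
   constancy. *)
Definition nontrivial (u : M -> R) : Prop :=
  ~ exists a : R, {ae mu, forall x, u x = a}.

Definition volume_growth (o : M) (F : R -> R) : Prop :=
  exists2 c : R, 0 < c & exists r0 : R, forall r, r0 <= r ->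
    (mu (geodesic_ball o r) <= (c * F r)%:E)%E.

End sobolev.

Definition solution_with_growth (R : realType) (m p q : R) (F : R -> R) : Prop :=
  exists (n : nat) (M : riemannian_manifold R n)
         (mu : {measure set (g_sigma_algebraType (@open M)) -> \bar R})
         (o : M),
    [/\ ~ compact [set: M],
        geodesically_complete M,
        riemannian_measure mu,
        volume_growth mu o F &
        exists u : M -> R, positive_solution mu m p q u /\ nontrivial mu u].

(* Main.v *)
(* The manifold is the punctured plane with the metric
   ds^2 / k(s)^2 + k(s)^2 dtheta^2, s = |z|^2 / 2, whose Riemannian measure is
   the Lebesgue measure ds dtheta.  For a radial function u with u' = - v < 0
   the choice k = (F / v^(m-1))^(1/m) makes - F the radial flux of
   |grad u|^(m-2) grad u and gives |grad u| = (F v)^(1/m), so that the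
   differential inequality becomes u^p (F v)^(q/m) <= F' on (0, +oo).  The
   meridians have length element ds / k; the metric is complete as soon as their
   length diverges at both ends s = 0 and s = +oo, and a ball of radius r lies
   in {s <= S}, of area 2 pi S, when the length of the meridian from the base
   point to s > S exceeds r.

   Each case is then a choice of u and F: u = a + s^(-mu) and F = A s^(1/2) in
   (D) and (E); u = 1 + ln(1 + s)^(-mu) and F of order s times a power of ln(s)
   at infinity in (F); and u = a + (1 + s)^(-th) (1 + ln(1 + s))^(-et), up to a
   bounded factor, with F of order ln(s)^c at infinity in (A), (B), (C).  In
   the latter cases both are corrected by powers of ln(1/s) near s = 0, which
   push the puncture to infinite distance. *)
Require Import Defs.
From HB Require Import structures.
From mathcomp Require Import all_boot all_order all_algebra.
From mathcomp Require Import all_classical all_reals all_analysis.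
From mathcomp Require Import measurable_realfun ring lra.

Set Implicit Arguments.
Unset Strict Implicit.
Unset Printing Implicit Defensive.

Import Order.TTheory GRing.Theory Num.Theory.
Import numFieldNormedType.Exports.

Local Open Scope classical_set_scope.
Local Open Scope ring_scope.

(** * Smooth functions *)

(** The area element [ds dtheta] does not depend on [k], so the geometry is all in the arclength,
    the integral of [1 / k] with [k = (F / v^(m-1))^(1/m)]. It must grow fast at infinity to keep
    the volume small and diverge at the puncture, while [u^p (F v)^(q/m) <= F'] limits [F] and [v].

    The exponents of (A) come from a balance. For [u] of order [s^(-th)] and [F] a power of [ln s],
    both sides of that inequality decay like [1 / s], up to logarithms, when [th (m p + q) = m - q].
    The arclength is then of order [s^((1 - th (m-1)) / m)], and the inverse of this exponent is
    [(m p + q) / (p + q - m + 1)]. The positive power of the logarithm kept in [F] costs the [eps].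

    On the weak side, a test function has only a weak gradient, and the flux has no compact support.
    The flux is cut off away from the support of the test function, which is harmless once the weak
    gradient is known to pair to zero with the flux almost everywhere there; this is the purpose of
    the fundamental lemma of the calculus of variations. *)

Section directional_chain_rule.
Context {R : realType} {V : normedModType R}.

Lemma derive_line (f : V -> R) (z v : V) :
  'D_v f z = 'D_1 (fun h : R => f (h *: v + z)) 0.
Proof.
rewrite /derive; set g1 := fun h => h^-1 *: _; set g2 := fun h => h^-1 *: _.
suff -> : g1 = g2 by [].
by apply/funext => h; rewrite /g1 /g2 /= addr0 scale0r add0r [_%:A]mulr1.
Qed.

Lemma is_derive_line (f : V -> R) (z v : V) df :
  is_derive z v f df <-> is_derive (0 : R) 1 (fun h : R => f (h *: v + z)) df.
Proof.
split=> -[h1 h2]; split.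
- exact: (derivable1P f z v).1.
- by rewrite -derive_line.
- exact: (derivable1P f z v).2.
- by rewrite derive_line.
Qed.

(** Restricted to the line through [z] with direction [v], this is the chain rule in one variable;
    directional derivatives are the only ones that [smooth_on] provides. *)
Lemma is_derive_chain (g : R -> R) (f : V -> R) (z v : V) (dg df : R) :
  is_derive (f z) 1 g dg -> is_derive z v f df ->
  is_derive z v (g \o f) (dg * df).
Proof.
move=> hg /is_derive_line hf; apply/is_derive_line.
apply: (@is_derive1_comp _ g (fun h : R => f (h *: v + z))) => //.
by rewrite scale0r add0r.
Qed.

End directional_chain_rule.

Section smooth_functions.
Context {R : realType} {V : normedModType R} {I : Type} (d : I -> V).
Implicit Types (U : set V) (f g : V -> R).

Definition pd (k : I) f : V -> R := fun z => 'D_(d k) f z.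

(** [smooth_on] with an arbitrary family of directions [d], so that the same closure properties
    serve functions on the plane ([dirs]) and functions of one variable ([one_dir]). *)
Definition smooth_in U f := forall (s : seq I) z, U z ->
  {for z, continuous (foldr pd f s)} /\
  (forall k, derivable (foldr pd f s) z (d k)).

Definition C0n U f := forall z, U z ->
  {for z, continuous f} /\ (forall k, derivable f z (d k)).

Fixpoint Cn n U f : Prop :=
  C0n U f /\ if n is n'.+1 then forall k, Cn n' U (pd k f) else True.

Lemma Cn0 n U f : Cn n U f -> C0n U f. Proof. by case: n => [|n] []. Qed.

Lemma CnS n U f : Cn n.+1 U f -> Cn n U f.
Proof.
elim: n f => [|n IH] f [h0 h1]; first by split.
by split=> // k; apply: IH; exact: h1.
Qed.

(** [foldr] applies the last direction of [s] first, and [Cn] differentiates [f] itself first, so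
    lists are extended on the right. [Cn] is the form in which product and chain rules can be
    iterated by induction. *)
Lemma smooth_inP U f : smooth_in U f <-> forall n, Cn n U f.
Proof.
split=> [h n|h s].
  have {}h s : C0n U (foldr pd f s) by move=> z; exact: h.
  elim: n f h => [|n IH] f h; first by split => //; exact: (h [::]).
  split; first exact: (h [::]).
  by move=> k; apply: IH => s; have := h (rcons s k); rewrite foldr_rcons.
move=> z Uz; suff : C0n U (foldr pd f s) by move=> /(_ _ Uz).
elim/last_ind: s f h => [|s k IH] f h; first exact: Cn0 (h 0%N).
by rewrite foldr_rcons; apply: IH => n; have [_] := h n.+1; exact.
Qed.

Lemma near_open U z (P : V -> Prop) : open U -> U z -> (forall w, U w -> P w) ->
  \near z, P z.
Proof.
by move=> oU Uz UP; apply: filterS (open_nbhs_nbhs (conj oU Uz)) => w /UP.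
Qed.

Lemma near_eq_continuous f g z : (\near z, f z = g z) ->
  {for z, continuous f} -> {for z, continuous g}.
Proof.
move=> fg; change (f @ z --> f z -> g @ z --> g z) => cf.
rewrite -(nbhs_singleton fg); apply: cvg_trans cf; apply: near_eq_cvg.
by apply: filterS fg => w ->.
Qed.

Lemma C0n_congr U f g : open U -> (forall z, U z -> f z = g z) ->
  C0n U f -> C0n U g.
Proof.
move=> oU fg h z Uz; have [cf df] := h _ Uz.
have nfg : \near z, f z = g z by exact: near_open fg.
split; first exact: near_eq_continuous cf.
move=> k; have [dk0|dk0] := eqVneq (d k) 0; first by rewrite dk0; exact: derivable0.
exact: near_eq_derivable (df k).
Qed.

Lemma pd_congr U f g k z : open U -> (forall z, U z -> f z = g z) -> U z ->
  pd k f z = pd k g z.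
Proof.
move=> oU fg Uz; rewrite /pd.
have [dk0|dk0] := eqVneq (d k) 0; first by rewrite dk0 !derive0.
by apply: near_eq_derive => //; exact: near_open fg.
Qed.

Lemma Cn_congr n U f g : open U -> (forall z, U z -> f z = g z) ->
  Cn n U f -> Cn n U g.
Proof.
move=> oU; elim: n f g => [|n IH] f g fg [h0 h1].
  by split; first exact: C0n_congr fg h0.
split; first exact: C0n_congr fg h0.
move=> k; apply: IH (h1 k) => z Uz; exact: pd_congr fg Uz.
Qed.

(** The induction step of the closure properties: derivative rules give formulas [df k] valid on
    [U], and [Cn_congr] carries their regularity over to [pd k f], which may differ from them off
    [U]. *)
Lemma Cn_succ n U f (df : I -> V -> R) : open U -> (forall z, U z -> {for z, continuous f}) ->
  (forall k z, U z -> is_derive z (d k) f (df k z)) ->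
  (forall k, Cn n U (df k)) -> Cn n.+1 U f.
Proof.
move=> oU cf hf hdf; split.
  by move=> z Uz; split; [exact: cf|move=> k; have [] := hf k z Uz].
by move=> k; apply: Cn_congr (hdf k) => // z Uz; have [_ <-] := hf k z Uz.
Qed.

Lemma C0nP U f k z : C0n U f -> U z -> is_derive z (d k) f (pd k f z).
Proof. by move=> h Uz; have [_ /(_ k) /derivableP] := h z Uz. Qed.

Lemma Cn_cst n U c : open U -> Cn n U (cst c).
Proof.
move=> oU; elim: n c => [|n IH] c.
  by split=> // z _; split; [exact: cst_continuous|move=> k; exact: derivable_cst].
apply: (@Cn_succ _ _ _ (fun _ => cst 0)) => //.
by move=> z _; exact: cst_continuous.
Qed.

Lemma CnD n U f g : open U -> Cn n U f -> Cn n U g -> Cn n U (f + g).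
Proof.
move=> oU; elim: n f g => [|n IH] f g hf hg.
  split; last by []. move=> z Uz; have [cf df] := Cn0 hf Uz; have [cg dg] := Cn0 hg Uz.
  by split; [exact: continuousD|move=> k; exact: derivableD].
apply: (@Cn_succ _ _ _ (fun k => pd k f + pd k g) oU).
- move=> z Uz; have [cf df] := Cn0 hf Uz; have [cg dg] := Cn0 hg Uz.
  exact: continuousD.
- by move=> k z Uz; apply: is_deriveD; apply: C0nP Uz; [exact: Cn0 hf|exact: Cn0 hg].
- by move=> k; apply: IH; [case: hf => _ /(_ k)|case: hg => _ /(_ k)].
Qed.

Lemma CnM n U f g : open U -> Cn n U f -> Cn n U g -> Cn n U (f * g).
Proof.
move=> oU; elim: n f g => [|n IH] f g hf hg.
  split; last by []. move=> z Uz; have [cf df] := Cn0 hf Uz; have [cg dg] := Cn0 hg Uz.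
  by split; [exact: continuousM|move=> k; exact: derivableM].
apply: (@Cn_succ _ _ _ (fun k => f * pd k g + g * pd k f) oU).
- move=> z Uz; have [cf df] := Cn0 hf Uz; have [cg dg] := Cn0 hg Uz.
  exact: continuousM.
- move=> k z Uz; apply: is_derive_eq.
    apply: is_deriveM; apply: C0nP Uz; [exact: Cn0 hf|exact: Cn0 hg].
  by [].
- move=> k; apply: (CnD oU); apply: IH.
  + exact: CnS.
  + by case: hg => _ /(_ k).
  + exact: CnS.
  + by case: hf => _ /(_ k).
Qed.

Lemma smooth_cst U c : open U -> smooth_in U (cst c).
Proof. by move=> oU; apply/smooth_inP => n; exact: Cn_cst. Qed.

Lemma smoothD U f g : open U -> smooth_in U f -> smooth_in U g ->
  smooth_in U (fun z => f z + g z).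
Proof.
by move=> oU /smooth_inP hf /smooth_inP hg; apply/smooth_inP => n; exact: CnD.
Qed.

Lemma smoothM U f g : open U -> smooth_in U f -> smooth_in U g ->
  smooth_in U (fun z => f z * g z).
Proof.
by move=> oU /smooth_inP hf /smooth_inP hg; apply/smooth_inP => n; exact: CnM.
Qed.

Lemma smooth_congr U f g : open U -> (forall z, U z -> f z = g z) ->
  smooth_in U f -> smooth_in U g.
Proof.
by move=> oU fg /smooth_inP hf; apply/smooth_inP => n; exact: Cn_congr fg (hf n).
Qed.

Lemma smoothN U f : open U -> smooth_in U f -> smooth_in U (fun z => - f z).
Proof.
move=> oU hf; apply: (@smooth_congr _ (fun z => (-1) * f z) _ oU).
  by move=> z _; rewrite mulN1r.
exact: smoothM oU (smooth_cst _ oU) hf.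
Qed.

Lemma smoothB U f g : open U -> smooth_in U f -> smooth_in U g ->
  smooth_in U (fun z => f z - g z).
Proof. by move=> oU hf hg; exact/smoothD/smoothN. Qed.

Lemma smooth_sub U U' f : U' `<=` U -> smooth_in U f -> smooth_in U' f.
Proof. by move=> UU hf s z Uz; apply: hf; exact: UU. Qed.

Lemma smooth_continuous U f z : smooth_in U f -> U z -> {for z, continuous f}.
Proof. by move=> /(_ [::] z) h /h[]. Qed.

Lemma smooth_derivable U f k z : smooth_in U f -> U z -> derivable f z (d k).
Proof. by move=> /(_ [::] z) h /h[]. Qed.

Lemma smooth_pd U f k : smooth_in U f -> smooth_in U (pd k f).
Proof.
move=> /smooth_inP h; apply/smooth_inP => n.
by have [_] := h n.+1; exact.
Qed.

Lemma smooth_local U f : (forall z, U z -> exists2 W, open W /\ W z & smooth_in W f) ->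
  smooth_in U f.
Proof. by move=> h s z Uz; have [W [oW Wz] hW] := h z Uz; exact: hW. Qed.

End smooth_functions.

Section smooth_composition.
Context {R : realType} {V : normedModType R} {I : Type} (d : I -> V).

Definition one_dir : unit -> R := fun=> 1.
Definition smooth1 := @smooth_in R R unit one_dir.

Lemma Cn_comp n (U : set V) (J : set R) (g : R -> R) (f : V -> R) : open U ->
  (forall z, U z -> J (f z)) ->
  Cn one_dir n J g -> Cn d n U f -> Cn d n U (g \o f).
Proof.
move=> oU UJ; elim: n g => [|n IH] g hg hf.
  split; last by []. move=> z Uz; have [cf df] := Cn0 hf Uz; have [cg dg] := Cn0 hg (UJ _ Uz).
  split; first exact: continuous_comp.
  move=> k; have [//] := @is_derive_chain _ _ g f z (d k) _ _
     (C0nP tt (Cn0 hg) (UJ _ Uz)) (C0nP k (Cn0 hf) Uz).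
apply: (@Cn_succ _ _ _ _ _ _ _ (fun k => (pd one_dir tt g \o f) * pd d k f) oU).
- move=> z Uz; have [cf df] := Cn0 hf Uz; have [cg dg] := Cn0 hg (UJ _ Uz).
  exact: continuous_comp.
- move=> k z Uz; apply: is_derive_chain.
  + exact: (@C0nP _ _ _ one_dir _ _ tt _ (Cn0 hg) (UJ _ Uz)).
  + exact: (C0nP k (Cn0 hf) Uz).
- move=> k; apply: (CnM oU); last by case: hf => _ /(_ k).
  apply: IH; last exact: CnS.
  by case: hg => _ /(_ tt).
Qed.

Lemma smooth_comp (U : set V) (J : set R) (g : R -> R) (f : V -> R) : open U ->
  (forall z, U z -> J (f z)) ->
  smooth1 J g -> smooth_in d U f -> smooth_in d U (fun z => g (f z)).
Proof.
move=> oU UJ /smooth_inP hg /smooth_inP hf; apply/smooth_inP => n.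
exact: Cn_comp UJ (hg n) (hf n).
Qed.

End smooth_composition.

(** * Smoothness of powers, of the logarithm and of a flat function *)

Section elementary_functions.
Context {R : realType}.
Local Notation pos := [set x : R | 0 < x].

Lemma open_pos : open pos.
Proof. exact: open_gt. Qed.

Lemma smooth1_id : smooth1 setT (@id R).
Proof.
apply/smooth_inP => -[|n].
  by split=> // z _; split=> [|k]; [exact: cvg_id|exact: derivable_id].
apply: (@Cn_succ _ _ _ _ _ _ _ (fun _ => cst 1) openT).
  by move=> z _; exact: cvg_id.
by move=> k; apply: Cn_cst; exact: openT.
Qed.

Lemma smooth1_powR a : smooth1 pos (fun x : R => x `^ a).
Proof.
have h b (z : R) : 0 < z -> is_derive z 1 (fun x : R => x `^ b) (b * z `^ (b - 1)).
  by move=> z0; exact: is_derive1_powR.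
have c b (z : R) : 0 < z -> {for z, continuous (fun x : R => x `^ b)}.
  move=> z0; apply: differentiable_continuous; apply/derivable1_diffP.
  by have [] := h b z z0.
apply/smooth_inP => n; elim: n a => [|n IH] a.
  split=> // z z0; split; first exact: c.
  by move=> k; have [] := h a z z0.
apply: (@Cn_succ _ _ _ _ _ _ _ (fun _ z => a * z `^ (a - 1)) open_pos).
- by move=> z /c.
- by move=> k; apply: (CnM open_pos) (IH _); apply: Cn_cst; exact: open_pos.
Qed.

Lemma smooth1_ln : smooth1 pos (@ln R).
Proof.
apply/smooth_inP => n; apply: CnS.
apply: (@Cn_succ _ _ _ _ _ _ _ (fun _ z => z `^ (-1)) open_pos).
- by move=> z; exact: continuous_ln.
- move=> k z z0; rewrite powR_inv1 ?ltW//; exact: is_derive1_ln.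
- by move=> k; have /smooth_inP := smooth1_powR (-1); exact.
Qed.

(* [flat 0] is the smooth function x |-> exp (- 1 / x) extended by 0; the
   family is closed under differentiation. *)
Definition flat (j : nat) (x : R) : R :=
  if 0 < x then expR (- x^-1) * x^-1 ^+ j else 0.

Lemma flat_ge0 j x : 0 <= flat j x.
Proof.
by rewrite /flat; case: ifPn => // x0; rewrite mulr_ge0 ?expR_ge0// exprn_ge0// invr_ge0 ltW.
Qed.

(** With [y = 1 / x], this is [y^(j+2) / (j+2)! <= expR y]. The two spare powers of [x] make the
    difference quotient at 0 tend to 0. *)
Lemma flat_le j x : `|flat j x| <= (j.+2)`!%:R * `|x| ^+ 2.
Proof.
rewrite /flat; case: ifPn => x0; last by rewrite normr0 mulr_ge0.
have y0 : 0 < x^-1 by rewrite invr_gt0.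
rewrite (gtr0_norm x0) expRN ger0_norm; last first.
  by rewrite mulr_ge0 ?invr_ge0 ?expR_ge0// exprn_ge0// ltW.
have h := @expR_ge1Dxn _ x^-1 j.+1 (ltW y0).
have {}h : x^-1 ^+ j.+2 / (j.+2)`!%:R <= expR x^-1.
  by apply: le_trans h; rewrite lerDr.
have f0 : 0 < (j.+2)`!%:R :> R by rewrite ltr0n fact_gt0.
rewrite mulrC ler_pdivrMr ?expR_gt0//.
apply: le_trans (ler_wpM2l _ h); last by rewrite mulr_ge0// exprn_ge0// ltW.
rewrite [leRHS]mulrC -mulrA [_^-1 * _]mulrA mulVf ?gt_eqF// mul1r -addn2 exprD -mulrA.
by rewrite -exprMn mulVf ?gt_eqF// expr1n mulr1.
Qed.

Lemma is_derive_flat (j : nat) (x : R) :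
  is_derive x 1 (flat j) (flat j.+2 x - j%:R * flat j.+1 x).
Proof.
have [x0|x0|->] := ltgtP x 0.
- rewrite /flat !ltNge (ltW x0)/= mulr0 subr0.
  apply: (@near_eq_is_derive _ _ _ (cst 0)) => //.
  by near=> y; rewrite ltNge ltW//; near: y; exact: lt_nbhsl.
- apply: (@near_eq_is_derive _ _ _ (fun y : R => expR (- y^-1) * y^-1 ^+ j)) => //.
    by near=> y; rewrite /flat ifT//; near: y; exact: lt_nbhsr.
  have dV : is_derive x 1 (fun y : R => y^-1) (- x ^- 2).
    have xn : x != 0 by rewrite gt_eqF.
    by apply: is_derive_eq (is_deriveV xn (is_derive_id x 1)) _; rewrite [_ *: _]mulr1.
  have dE : is_derive x 1 (fun y : R => expR (- y^-1)) (expR (- x^-1) * x ^- 2).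
    apply: is_derive_eq (@is_derive1_comp _ expR (fun y => - y^-1) _ _ _ _ _) _.
    by rewrite opprK.
  have dX : is_derive x 1 (fun y : R => y^-1 ^+ j) (- j%:R * x^-1 ^+ j.+1).
    have -> : (fun y : R => y^-1 ^+ j) = (fun y : R => y^-1) ^+ j.
      by apply/funext => y; rewrite exprfctE.
    apply: is_derive_eq (is_deriveX j dV) _.
    rewrite /GRing.scale /=; case: j => [|j]; first by rewrite !mul0r oppr0 mul0r.
    by rewrite /= -[x ^- 2]exprVn mulrN mulNr -mulrA -exprD addn2.
  apply: is_derive_eq (is_deriveM dE dX) _.
  rewrite /flat x0 /GRing.scale /= -[x ^- 2]exprVn.
  by move: (expR (- x^-1)) => e; move: (x^-1) => y; rewrite !exprS; ring.
- rewrite /flat ltxx mulr0 subr0.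
  have h : (fun h : R => h^-1 *: (flat j (h *: 1 + 0) - flat j 0)) @ 0^' --> (0 : R).
    apply/cvgr0Pnorm_le => e e0.
    near=> h.
    have h0 : h != 0 by near: h; exact: nbhs_dnbhs_neq.
    rewrite addr0 [h *: 1]mulr1 {2}/flat ltxx subr0 /GRing.scale/= normrM normfV.
    rewrite ler_pdivrMl ?normr_gt0//; apply: le_trans (flat_le j h) _.
    rewrite expr2 mulrA mulrC ler_wpM2l//.
    rewrite -ler_pdivlMl ?ltr0n ?fact_gt0//.
    near: h; apply: dnbhs0_le; rewrite mulr_gt0// invr_gt0 ltr0n fact_gt0//.
  by constructor; [apply/cvg_ex; exists 0|exact: cvg_lim].
Unshelve. all: by end_near. Qed.

Lemma smooth1_flat j : smooth1 setT (flat j).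
Proof.
have c i x : {for x, continuous (flat i)}.
  apply: differentiable_continuous; apply/derivable1_diffP.
  by have [] := is_derive_flat i x.
apply/smooth_inP => n; elim: n j => [|n IH] j.
  split=> // x _; split; first exact: c.
  by move=> k; have [] := is_derive_flat j x.
apply: (@Cn_succ _ _ _ _ _ _ _ (fun _ => flat j.+2 + (cst (- j%:R) * flat j.+1))).
- exact: openT.
- by move=> x _; exact: c.
- by move=> k x _; apply: is_derive_eq (is_derive_flat j x) _; rewrite !fctE mulNr.
- move=> k; apply: CnD; [exact: openT|exact: IH|].
  by apply: CnM; [exact: openT|apply: Cn_cst; exact: openT|exact: IH].
Qed.

End elementary_functions.

(** * One-variable calculus and ordinary differential equations *)

Section real_functions.
Context {R : realType}.
Implicit Types (f g F : R -> R) (a b x y : R).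

Lemma is_derive_const (c x : R) : is_derive x 1 (fun _ : R => c) 0.
Proof. exact: is_derive_cst. Qed.

Lemma is_derive_self x : is_derive x 1 (fun y : R => y) 1.
Proof. exact: is_derive_id. Qed.

Lemma is_derive_add f g x a b : is_derive x 1 f a -> is_derive x 1 g b ->
  is_derive x 1 (fun y => f y + g y) (a + b).
Proof. by move=> ? ?; exact: is_deriveD. Qed.

Lemma is_derive_opp f x a : is_derive x 1 f a -> is_derive x 1 (fun y => - f y) (- a).
Proof. by move=> ?; exact: is_deriveN. Qed.

Lemma is_derive_sub f g x a b : is_derive x 1 f a -> is_derive x 1 g b ->
  is_derive x 1 (fun y => f y - g y) (a - b).
Proof. by move=> ? ?; exact: is_deriveB. Qed.

Lemma is_derive_mul f g x a b : is_derive x 1 f a -> is_derive x 1 g b ->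
  is_derive x 1 (fun y => f y * g y) (f x * b + g x * a).
Proof. by move=> ? ?; exact: is_deriveM. Qed.

Lemma is_derive_mulc c f x a : is_derive x 1 f a ->
  is_derive x 1 (fun y => c * f y) (c * a).
Proof. by move=> ?; exact: is_deriveZ. Qed.

Lemma is_derive_exp f x a : is_derive x 1 f a ->
  is_derive x 1 (fun y => expR (f y)) (expR (f x) * a).
Proof. by move=> h; exact: (@is_derive1_comp _ expR f x _ _ (is_derive_expR _) h). Qed.

Lemma is_derive_log f x a : 0 < f x -> is_derive x 1 f a ->
  is_derive x 1 (fun y => ln (f y)) (a / f x).
Proof.
move=> fx h; rewrite mulrC.
exact: (@is_derive1_comp _ (@ln R) f x _ _ (is_derive1_ln fx) h).
Qed.

Lemma is_derive_pow r f x a : 0 < f x -> is_derive x 1 f a ->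
  is_derive x 1 (fun y => f y `^ r) (r * f x `^ (r - 1) * a).
Proof.
move=> fx h.
exact: (@is_derive1_comp _ (fun y => y `^ r) f x _ _ (is_derive1_powR r fx) h).
Qed.

Lemma is_derive_inv f x a : f x != 0 -> is_derive x 1 f a ->
  is_derive x 1 (fun y => (f y)^-1) (- a / f x ^+ 2).
Proof.
move=> fx h; apply: is_derive_eq (is_deriveV fx h) _.
by rewrite /GRing.scale/= mulrC mulrN mulNr.
Qed.

Lemma mvt f df a b : a <= b ->
  (forall x, a <= x <= b -> is_derive x 1 f (df x)) ->
  exists2 c, a <= c <= b & f b - f a = df c * (b - a).
Proof.
move=> ab h.
have [] := @MVT_segment R f df a b ab.
- by move=> x; rewrite in_itv/= => /andP[? ?]; apply: h; rewrite !ltW.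
- apply: derivable_within_continuous => x; rewrite in_itv/= => xab.
  by have [] := h _ xab.
- by move=> c; rewrite in_itv/= => cab e; exists c.
Qed.

Lemma derive_ge0_le f df a b : a <= b ->
  (forall x, a <= x <= b -> is_derive x 1 f (df x)) ->
  (forall x, a <= x <= b -> 0 <= df x) -> f a <= f b.
Proof.
move=> ab /(mvt ab)[c cab e] h.
by rewrite -subr_ge0 e mulr_ge0 ?h// subr_ge0.
Qed.

Lemma derive_gt0_lt f df a b : a < b ->
  (forall x, a <= x <= b -> is_derive x 1 f (df x)) ->
  (forall x, a <= x <= b -> 0 < df x) -> f a < f b.
Proof.
move=> ab /(mvt (ltW ab))[c cab e] h.
by rewrite -subr_gt0 e mulr_gt0 ?h// subr_gt0.
Qed.

Lemma is_derive_continuous f df x : is_derive x 1 f df -> {for x, continuous f}.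
Proof.
by move=> [h _]; apply: differentiable_continuous; apply/derivable1_diffP.
Qed.

Lemma derive0_eq f a b : (forall x, Num.min a b <= x <= Num.max a b -> is_derive x 1 f 0) ->
  f a = f b.
Proof.
move=> h; wlog ab : a b h / a <= b.
  move=> H; have [/H|/ltW/H] := leP a b; first exact.
  by move=> H'; apply/esym/H' => x; rewrite minC maxC; exact: h.
have [c _] := @mvt f (fun=> 0) a b ab (fun x xab => h x ltac:(by rewrite min_l// max_r)).
by rewrite mul0r => /subr0_eq.
Qed.

Lemma mvt_abs f df a b K : (forall x, Num.min a b <= x <= Num.max a b ->
    is_derive x 1 f (df x) /\ `|df x| <= K) ->
  `|f a - f b| <= K * `|a - b|.
Proof.
wlog ab : a b / a <= b.
  move=> H h; have [/H|/ltW/H] := leP a b; first exact.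
  by rewrite distrC [`|a - b|]distrC; apply => x; rewrite minC maxC; exact: h.
rewrite (min_idPl ab) (max_idPr ab) => h.
have [c cab e] := mvt ab (fun x xab => (h x xab).1).
by rewrite distrC [`|a - b|]distrC e normrM ler_wpM2r// (h c cab).2.
Qed.

(** The fundamental theorem of calculus gives a primitive on each []-N, N[]. Normalised to vanish at
    0, any two agree where both are defined, and they are glued by choosing [N] from the point. *)
Lemma exists_primitive f : continuous f ->
  exists2 F, F 0 = 0 & forall x, is_derive x 1 F (f x).
Proof.
move=> cf.
pose mu := @lebesgue_measure R.
have hN (N : R) : 0 < N -> exists2 F, F 0 = 0 & forall x, `|x| < N -> is_derive x 1 F (f x).
  move=> N0.
  pose G x := (\int[mu]_(t in [set` `[- N, x]]) f t)%R.
  have dG x : `|x| < N -> is_derive x 1 G (f x).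
    rewrite ltr_norml => /andP[Nx xN].
    have ci : mu.-integrable `[- N, N] (EFin \o f).
      apply: continuous_compact_integrable; first exact: segment_compact.
      exact: continuous_subspaceT.
    have [d1 d2] := @continuous_FTC1_closed R f (- N) x N xN ci Nx (cf x).
    by apply: DeriveDef; [exact: d1|rewrite -derive1E; exact: d2].
  exists (fun x => G x - G 0); first by rewrite subrr.
  move=> x xN; have := dG x xN => h.
  by apply: is_derive_eq; rewrite subr0.
have {hN} [Phi hPhi] : {Phi : R -> R -> R & forall N, 0 < N -> Phi N 0 = 0 /\
    forall x, `|x| < N -> is_derive x 1 (Phi N) (f x)}.
  apply: (@choice _ _ (fun N F => 0 < N -> F 0 = 0 /\
    forall x, `|x| < N -> is_derive x 1 F (f x))) => N.
  have [/hN[F F0 hF]|N0] := ltP 0 N; first by exists F.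
  by exists (fun=> 0).
have uniq (N M x : R) : `|x| < N -> `|x| < M -> Phi N x = Phi M x.
  move=> xN xM.
  have [N0 M0] : 0 < N /\ 0 < M by split; apply: le_lt_trans (normr_ge0 x) _.
  have [PN0 PN] := hPhi N N0; have [PM0 PM] := hPhi M M0.
  apply/eqP; rewrite -subr_eq0; apply/eqP.
  transitivity ((Phi N - Phi M) 0); last by rewrite !fctE PN0 PM0 subrr.
  apply: (@derive0_eq (Phi N - Phi M)) => y yx.
  have yx' : `|y| <= `|x|.
    move: yx; case: (leP 0 x) => x0; rewrite ler_norml.
      by move=> /andP[? ?]; rewrite ger0_norm//; lra.
    by move=> /andP[? ?]; rewrite ltr0_norm//; lra.
  have h1 := PN y (le_lt_trans yx' xN); have h2 := PM y (le_lt_trans yx' xM).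
  by apply: is_derive_eq; rewrite subrr.
exists (fun x => Phi (`|x| + 1) x).
  by rewrite normr0 add0r; have [] := hPhi 1 ltr01.
move=> x.
(* The index [|x| + 1] moves with the point; near [x] it may be replaced by the fixed index
   [|x| + 2]. *)
have Mx : 0 < `|x| + 2 by rewrite ltr_wpDl.
apply: (@near_eq_is_derive _ _ _ (Phi (`|x| + 2))) => //.
  near=> y; apply: uniq; last by rewrite ltrDl.
  suff : `|x - y| < 1 by have := lerB_dist y x; rewrite distrC; lra.
  by near: y; exact: (@nbhsx_ballx _ _ x 1 ltr01).
by have [_] := hPhi _ Mx; apply; rewrite ltrDl.
Unshelve. all: by end_near. Qed.

Definition prim f : R -> R := xget (cst 0) [set F | F 0 = 0 /\ forall x, is_derive x 1 F (f x)].

Lemma primP f : continuous f -> prim f 0 = 0 /\ forall x, is_derive x 1 (prim f) (f x).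
Proof.
move=> /exists_primitive[F F0 hF]; rewrite /prim.
by case: xgetP => [y _ []//|/(_ F)[]].
Qed.

Lemma prim0 f : continuous f -> prim f 0 = 0. Proof. by case/primP. Qed.

Lemma is_derive_prim f x : continuous f -> is_derive x 1 (prim f) (f x).
Proof. by case/primP. Qed.

(** The limit inferior, as the supremum of the eventual lower bounds. For a geometrically Cauchy
    sequence it is the limit, with an explicit rate. *)
Definition eventual_inf (u : nat -> R) : R :=
  sup [set x | exists n0, forall n, (n0 <= n)%N -> x <= u n].

Lemma eventual_inf_geometric (u : nat -> R) C : 0 <= C ->
  (forall n, `|u n.+1 - u n| <= C / 2 ^+ n) ->
  forall n, `|u n - eventual_inf u| <= 2 * C / 2 ^+ n.
Proof.
move=> C0 h n.
(* The negative term is what closes the induction on [k]: adding [C / 2^(m+k)] to the right-hand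
   side gives the same expression for [k + 1]. *)
have h' m k : `|u (m + k)%N - u m| <= 2 * C / 2 ^+ m - 2 * C / 2 ^+ (m + k).
  elim: k => [|k IH]; first by rewrite addn0 !subrr normr0.
  rewrite addnS; apply: le_trans (ler_distD (u (m + k)%N) _ _) _.
  apply: le_trans (lerD (h _) IH) _; rewrite exprS.
  have : 0 < 2 ^+ (m + k) :> R by rewrite exprn_gt0.
  move: (2 ^+ (m + k)) => y y0.
  have -> : 2 * C / (2 * y) = C / y by field; rewrite gt_eqF.
  by rewrite -!mulrA; lra.
set S := [set x | exists n0, forall n, (n0 <= n)%N -> x <= u n].
have p2 m : 0 < 2 ^+ m :> R by rewrite exprn_gt0.
have q0 m : 0 <= 2 * C / 2 ^+ m by rewrite divr_ge0 ?mulr_ge0// ltW.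
have lo m : S (u m - 2 * C / 2 ^+ m).
  exists m => k mk; have := h' m (k - m)%N; rewrite subnKC//.
  by rewrite ler_norml => /andP[h1 _]; have := q0 k; lra.
have up m : ubound S (u m + 2 * C / 2 ^+ m).
  move=> x [n0 hx]; have := hx _ (leq_maxr m n0).
  have := h' m (maxn m n0 - m)%N; rewrite subnKC ?leq_maxl//.
  by rewrite ler_norml => /andP[_ h1]; have := q0 (maxn m n0); lra.
have hs : has_sup S by split; [exists (u 0%N - 2 * C / 2 ^+ 0); exact: lo|exists (u 0%N + 2 * C / 2 ^+ 0); exact: up].
have l1 : u n - 2 * C / 2 ^+ n <= sup S by apply: ub_le_sup => //; case: hs.
have l2 : sup S <= u n + 2 * C / 2 ^+ n by apply: ge_sup; [case: hs|exact: up].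
by rewrite /eventual_inf -/S ler_norml; apply/andP; split; lra.
Qed.

(** Passes estimates with an error of order [2^-n] to the limit, since [n <= 2^n] and [R] is
    archimedean. *)
Lemma le_geometric x y K : (forall n, x <= y + K / 2 ^+ n) -> x <= y.
Proof.
move=> h; rewrite leNgt; apply/negP => yx.
have xy0 : 0 < x - y by rewrite subr_gt0.
pose n := Num.bound (`|K| / (x - y)).
have hn : `|K| / (x - y) < n%:R by apply: archi_boundP; rewrite divr_ge0// ltW.
have h2 : n%:R <= 2 ^+ n :> R by rewrite -natrX ler_nat ltnW// ltn_expl.
have p2 : 0 < 2 ^+ n :> R by rewrite exprn_gt0.
have : `|K| / 2 ^+ n < x - y.
  rewrite ltr_pdivrMr// mulrC -ltr_pdivrMr//; exact: lt_le_trans h2.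
apply/negP; rewrite -leNgt; apply: le_trans (_ : K / 2 ^+ n <= _).
  by have := h n; lra.
by rewrite ler_wpM2r ?ler_norm// invr_ge0 ltW.
Qed.

(** Integrating [K expR (a |x|)] gains the factor [1 / a]. For large [a] this is the contraction in
    the weighted sup norm of the Picard iteration. *)
Lemma derive_expR_bound f df (a T K : R) : 0 < a -> 0 <= K -> f 0 = 0 ->
  (forall x, is_derive x 1 f (df x)) ->
  (forall x, `|x| <= T -> `|df x| <= K * expR (a * `|x|)) ->
  forall x, `|x| <= T -> `|f x| <= K / a * expR (a * `|x|).
Proof.
move=> a0 K0.
have pos g dg : g 0 = 0 -> (forall x, is_derive x 1 g (dg x)) ->
    (forall x, `|x| <= T -> `|dg x| <= K * expR (a * `|x|)) ->
    forall x, 0 <= x <= T -> g x <= K / a * expR (a * x).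
  move=> g0 hg hdg x /andP[x0 xT]; rewrite -subr_ge0.
  have dE y : is_derive y 1 (fun y => K / a * expR (a * y)) (K * expR (a * y)).
    have d2 := is_derive_exp (is_derive_mulc a (is_derive_id y 1)).
    apply: is_derive_eq (is_derive_mulc (K / a) d2) _.
    by field; rewrite gt_eqF.
  have dEg y : 0 <= y <= x -> is_derive y 1 (fun y => K / a * expR (a * y) - g y)
    (K * expR (a * y) - dg y) by move=> _; exact: is_derive_sub.
  have := @derive_ge0_le (fun y => K / a * expR (a * y) - g y)
     (fun y => K * expR (a * y) - dg y) 0 x x0 dEg.
  rewrite mulr0 expR0 g0 subr0 mulr1 => H; apply: le_trans (H _).
  - by rewrite divr_ge0// ltW.
  - move=> y /andP[y0 yx]; rewrite subr_ge0; apply: le_trans (ler_norm _) _.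
    by have := hdg y; rewrite ger0_norm//; apply; apply: le_trans yx xT.
have both g dg : g 0 = 0 -> (forall x, is_derive x 1 g (dg x)) ->
    (forall x, `|x| <= T -> `|dg x| <= K * expR (a * `|x|)) ->
    forall x, 0 <= x <= T -> `|g x| <= K / a * expR (a * x).
  move=> g0 hg hdg x x0; rewrite ler_norml; apply/andP; split; last exact: (pos g dg).
  rewrite lerNl; apply: (pos (fun x => - g x) (fun x => - dg x)) => //.
  - by rewrite g0 oppr0.
  - by move=> y; rewrite normrN; exact: hdg.
move=> f0 hf hdf x xT; have [x0|x0] := leP 0 x.
  have := both f df f0 hf hdf x; rewrite (ger0_norm x0); apply.
  by rewrite x0 (le_trans (ler_norm x)).
rewrite (ltr0_norm x0).
have d2 y : is_derive y 1 (fun y => f (- y)) (- df (- y)).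
  have d1 : is_derive y 1 (fun y : R => - y) (-1) by exact: is_derive_opp.
  by have := @is_derive1_comp _ f (fun y => - y) y _ _ (hf _) d1; rewrite mulrN1.
have := both (fun x => f (- x)) (fun x => - df (- x)) _ d2 _ (- x); rewrite opprK; apply.
- by rewrite oppr0.
- by move=> y yT; rewrite normrN; have := hdf (- y); rewrite normrN; apply.
- by rewrite oppr_ge0 ltW//= -ltr0_norm.
Qed.

(* Picard iteration: since [f1] is bounded by [A], the first component of every
   iterate stays in [`|x - x0| <= A * `|t|], on which [f1] and [f2] are Lipschitz;
   no maximal solution is needed. *)
Lemma picard (f1 f2 : R -> R -> R) (A x0 : R) : 0 <= A ->
  (forall x y, `|f1 x y| <= A) ->
  (forall T : R, exists L : R, forall x y, `|x| <= T -> `|f2 x y| <= L /\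
     forall x' y', `|x'| <= T ->
       `|f1 x y - f1 x' y'| <= L * (`|x - x'| + `|y - y'|) /\
       `|f2 x y - f2 x' y'| <= L * (`|x - x'| + `|y - y'|)) ->
  exists u v : R -> R, [/\ u 0 = x0, v 0 = 0,
    forall t : R, is_derive t 1 u (f1 (u t) (v t)) &
    forall t : R, is_derive t 1 v (f2 (u t) (v t))].
Proof.
move=> A0 hA hL.
have cont2 (g : R -> R -> R) : (forall T : R, exists L : R, forall x y, `|x| <= T ->
     forall x' y', `|x'| <= T -> `|g x y - g x' y'| <= L * (`|x - x'| + `|y - y'|)) ->
    forall u v : R -> R, continuous u -> continuous v -> continuous (fun t => g (u t) (v t)).
  move=> hg u v cu cv t.
  have [L hgL] := hg (`|u t| + 1).
  pose L' := `|L| + 1.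
  have L'0 : 0 < L' by rewrite ltr_wpDl.
  apply/cvgrPdist_le => e e0.
  have e1 : 0 < Num.min 1 (e / (L' *+ 2)) by rewrite lt_min ltr01 divr_gt0// pmulrn_lgt0.
  have e2 : 0 < e / (L' *+ 2) by rewrite divr_gt0// pmulrn_lgt0.
  near=> s.
  have h1 : `|u t - u s| <= Num.min 1 (e / (L' *+ 2)).
    by near: s; move/cvgrPdist_le : (cu t); exact.
  have h2 : `|v t - v s| <= e / (L' *+ 2).
    by near: s; move/cvgrPdist_le : (cv t); exact.
  move: h1; rewrite le_min => /andP[h0 h1].
  have us : `|u s| <= `|u t| + 1 by have := lerB_dist (u s) (u t); rewrite distrC; lra.
  have ut : `|u t| <= `|u t| + 1 by rewrite lerDl.
  apply: le_trans (hgL _ (v t) ut _ (v s) us) _.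
  have -> : e = L' * (e / (L' *+ 2) + e / (L' *+ 2)).
    by rewrite -mulr_natr; field; rewrite gt_eqF.
  apply: le_trans (_ : L' * (`|u t - u s| + `|v t - v s|) <= _).
    by rewrite ler_wpM2r ?addr_ge0// /L'; have := ler_norm L; lra.
  by rewrite ler_pM2l// lerD.
have c1 (u v : R -> R) : continuous u -> continuous v -> continuous (fun t => f1 (u t) (v t)).
  apply: cont2 => T; have [L h] := hL T; exists L => x y xT x' y' xT'.
  by have [_ /(_ _ y' xT')[]] := h x y xT.
have c2 (u v : R -> R) : continuous u -> continuous v -> continuous (fun t => f2 (u t) (v t)).
  apply: cont2 => T; have [L h] := hL T; exists L => x y xT x' y' xT'.
  by have [_ /(_ _ y' xT')[]] := h x y xT.
pose step (p : (R -> R) * (R -> R)) : (R -> R) * (R -> R) :=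
  (fun t => x0 + prim (fun s => f1 (p.1 s) (p.2 s)) t,
   prim (fun s => f2 (p.1 s) (p.2 s))).
pose it n := iter n step (fun=> x0, fun=> 0).
pose u n := (it n).1; pose v n := (it n).2.
have cprim f : continuous f -> continuous (prim f).
  by move=> cf x; exact: is_derive_continuous (is_derive_prim x cf).
have cuv n : continuous (u n) /\ continuous (v n).
  elim: n => [|n [cu cv]]; first by split=> x; exact: cvg_cst.
  split; last exact: cprim (c2 _ _ cu cv).
  by move=> x; apply: cvgD; [exact: cvg_cst|exact: cprim (c1 _ _ cu cv) x].
have cu n := (cuv n).1; have cv n := (cuv n).2.
have du n (t : R) : is_derive t 1 (u n.+1) (f1 (u n t) (v n t)).
  apply: is_derive_eq (is_derive_add (is_derive_cst x0 t 1) (is_derive_prim t (c1 _ _ (cu n) (cv n)))) _.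
  by rewrite add0r.
have dv n (t : R) : is_derive t 1 (v n.+1) (f2 (u n t) (v n t)).
  exact: (is_derive_prim t (c2 _ _ (cu n) (cv n))).
have u0 n : u n 0 = x0.
  by case: n => [//|n]; rewrite /u /= (prim0 (c1 _ _ (cu n) (cv n))) addr0.
have v0 n : v n 0 = 0.
  by case: n => [//|n]; rewrite /v /= (prim0 (c2 _ _ (cu n) (cv n))).
have ub n t : `|u n t| <= `|x0| + A * `|t|.
  suff h : `|u n t - x0| <= A * `|t| by have := lerB_dist (u n t) x0; lra.
  case: n => [|n]; first by rewrite subrr normr0 mulr_ge0.
  rewrite -(u0 n.+1) -[t in X in _ <= X]subr0.
  by apply: mvt_abs => x _; split; [exact: du|exact: hA].
(* contraction for the norm [sup_t exp (- a |t|) (|u t| + |v t|)] *)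
have est T : 0 <= T -> exists C, [/\ 0 <= C, (forall n t, `|t| <= T -> `|f2 (u n t) (v n t)| <= C) &
    forall n t, `|t| <= T -> `|u n.+1 t - u n t| <= C / 2 ^+ n /\ `|v n.+1 t - v n t| <= C / 2 ^+ n].
  move=> T0; have [L hLT] := hL (`|x0| + A * T).
  have ubT n t : `|t| <= T -> `|u n t| <= `|x0| + A * T.
    by move=> tT; apply: le_trans (ub n t) _; rewrite lerD2l ler_wpM2l.
  pose M := `|L| + A + 1.
  have M0 : 0 < M by rewrite /M ltr_wpDl// addr_ge0.
  have LM : L <= M by rewrite /M; have := ler_norm L; lra.
  have b2 n t : `|t| <= T -> `|f2 (u n t) (v n t)| <= M.
    by move=> tT; have [h _] := hLT _ (v n t) (ubT n t tT); exact: le_trans h LM.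
  have lip n t : `|t| <= T ->
      `|f1 (u n.+1 t) (v n.+1 t) - f1 (u n t) (v n t)| <= M * (`|u n.+1 t - u n t| + `|v n.+1 t - v n t|) /\
      `|f2 (u n.+1 t) (v n.+1 t) - f2 (u n t) (v n t)| <= M * (`|u n.+1 t - u n t| + `|v n.+1 t - v n t|).
    move=> tT; have [_ /(_ _ (v n t) (ubT n t tT))[h1 h2]] := hLT _ (v n.+1 t) (ubT n.+1 t tT).
    by split; [apply: le_trans h1 _|apply: le_trans h2 _]; rewrite ler_wpM2r// addr_ge0.
  (* Both components enter the Lipschitz bound, so one iteration gains [2 M / a = 1 / 2]. *)
  pose a := 4 * M.
  have a0 : 0 < a by rewrite mulr_gt0.
  pose K := M * T.
  have K0 : 0 <= K by rewrite mulr_ge0// ltW.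
  have key n t : `|t| <= T -> `|u n.+1 t - u n t| <= K / 2 ^+ n * expR (a * `|t|) /\
      `|v n.+1 t - v n t| <= K / 2 ^+ n * expR (a * `|t|).
    elim: n t => [|n IH] t tT.
      have e1 : 1 <= expR (a * `|t|) by rewrite -expR0 ler_expR mulr_ge0// ltW.
      rewrite expr0 divr1; split; apply: le_trans (_ : K * 1 <= _); rewrite ?ler_wpM2l// mulr1.
        rewrite -[u 0%N t](u0 1%N); apply: le_trans (_ : M * `|t - 0| <= _).
          apply: mvt_abs => x _; split; [exact: du|apply: le_trans (hA _ _) _].
          by rewrite /M; have := normr_ge0 L; lra.
        by rewrite subr0 ler_pM2l.
      rewrite -[v 0%N t](v0 1%N); apply: le_trans (_ : M * `|t - 0| <= _).
        apply: mvt_abs => x hx; split; [exact: dv|apply: b2].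
        apply: le_trans tT; move: hx; case: (leP t 0) => t0 /andP[? ?].
          by rewrite (ler0_norm t0) ler_norml; lra.
        by rewrite (gtr0_norm t0) ler_norml; lra.
      by rewrite subr0 ler_pM2l.
    have KE : K / 2 ^+ n.+1 = (M * 2 * (K / 2 ^+ n)) / a.
      rewrite exprS /a; field.
      by rewrite gt_eqF//= gt_eqF// exprn_gt0.
    have bnd x : `|x| <= T -> M * (`|u n.+1 x - u n x| + `|v n.+1 x - v n x|) <=
        M * 2 * (K / 2 ^+ n) * expR (a * `|x|).
      move=> xT; have [h1 h2] := IH x xT.
      apply: le_trans (ler_wpM2l (ltW M0) (lerD h1 h2)) _.
      by rewrite [leRHS](_ : _ = M * (K / 2 ^+ n * expR (a * `|x|) + K / 2 ^+ n * expR (a * `|x|)))//; ring.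
    have n0 : 0 <= M * 2 * (K / 2 ^+ n).
      by rewrite mulr_ge0// ?divr_ge0// ?mulr_ge0// ltW.
    rewrite KE; split.
      have := @derive_expR_bound (fun t => u n.+2 t - u n.+1 t)
        (fun t => f1 (u n.+1 t) (v n.+1 t) - f1 (u n t) (v n t)) a T _ a0 n0.
      apply=> //; first by rewrite !u0 subrr.
      by move=> x xT; apply: le_trans (lip n x xT).1 (bnd x xT).
    have := @derive_expR_bound (fun t => v n.+2 t - v n.+1 t)
        (fun t => f2 (u n.+1 t) (v n.+1 t) - f2 (u n t) (v n t)) a T _ a0 n0.
    apply=> //; first by rewrite !v0 subrr.
    by move=> x xT; apply: le_trans (lip n x xT).2 (bnd x xT).
  exists (M + K * expR (a * T)); split.
  - by rewrite addr_ge0 ?(ltW M0)// mulr_ge0// expR_ge0.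
  - move=> n t tT; apply: le_trans (b2 n t tT) _.
    by rewrite lerDl mulr_ge0// expR_ge0.
  - move=> n t tT.
    have h : K / 2 ^+ n * expR (a * `|t|) <= (M + K * expR (a * T)) / 2 ^+ n.
      rewrite mulrAC ler_wpM2r// ?invr_ge0 ?exprn_ge0//.
      apply: le_trans (_ : K * expR (a * T) <= _); last by rewrite lerDr ltW.
      by rewrite ler_wpM2l// ler_expR ler_pM2l.
    by have [h1 h2] := key n t tT; split; apply: le_trans h.
pose U t := eventual_inf (fun n => u n t); pose V t := eventual_inf (fun n => v n t).
have conv T : 0 <= T -> exists C, [/\ 0 <= C, forall n t, `|t| <= T -> `|f2 (u n t) (v n t)| <= C &
    forall n t, `|t| <= T -> `|u n t - U t| <= C / 2 ^+ n /\ `|v n t - V t| <= C / 2 ^+ n].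
  move=> /est[C [C0 h2 h]]; exists (2 * C); split.
  - by rewrite mulr_ge0.
  - by move=> n t /(h2 n); lra.
  - move=> n t tT; split.
      by apply: (@eventual_inf_geometric (fun n => u n t)) => // k; have [] := h k t tT.
    by apply: (@eventual_inf_geometric (fun n => v n t)) => // k; have [] := h k t tT.
have between (t s x T : R) : `|t| <= T -> `|s| <= T -> Num.min t s <= x <= Num.max t s -> `|x| <= T.
  by rewrite !ler_norml; case: (leP t s) => _ /andP[? ?] /andP[? ?] /andP[? ?]; lra.
have lipc (f : R -> R) : (forall T, 0 <= T -> exists C, 0 <= C /\
    forall t s, `|t| <= T -> `|s| <= T -> `|f t - f s| <= C * `|t - s|) -> continuous f.
  move=> hf t; have [C [C0 hC]] := hf (`|t| + 1) ltac:(by rewrite addr_ge0).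
  apply/cvgrPdist_le => e e0.
  have e1 : 0 < e / (C + 1) by rewrite divr_gt0// ltr_wpDl.
  near=> s.
  have ts1 : `|t - s| < 1 by near: s; exact: (@nbhsx_ballx _ _ t 1 ltr01).
  have ts2 : `|t - s| < e / (C + 1) by near: s; exact: (@nbhsx_ballx _ _ t _ e1).
  apply: le_trans (hC _ _ _ _) _; first by rewrite lerDl.
    by have := lerB_dist s t; rewrite distrC; lra.
  apply: le_trans (_ : (C + 1) * `|t - s| <= _); first by rewrite ler_wpM2r// lerDl.
  by rewrite mulrC -ler_pdivlMr ?ltr_wpDl// ltW.
have cU : continuous U.
  apply: lipc => T /conv[C [C0 _ h]]; exists A; split => // t s tT sT.
  apply: (@le_geometric _ _ (2 * C)) => n.
  have [h1 _] := h n.+1 t tT; have [h2 _] := h n.+1 s sT.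
  have h3 : `|u n.+1 t - u n.+1 s| <= A * `|t - s|.
    by apply: mvt_abs => x _; split; [exact: du|exact: hA].
  have h4 : C / 2 ^+ n.+1 <= C / 2 ^+ n.
    by rewrite ler_wpM2l// lef_pV2 ?posrE ?exprn_gt0// exprS ler_peMl ?exprn_ge0 ?ler1n.
  have e : U t - U s = (U t - u n.+1 t) + (u n.+1 t - u n.+1 s) + (u n.+1 s - U s) by ring.
  rewrite e; apply: le_trans (ler_normD _ _) _; have := ler_normD (U t - u n.+1 t) (u n.+1 t - u n.+1 s).
  by rewrite [`|U t - _|]distrC -mulrA; lra.
have cV : continuous V.
  apply: lipc => T /conv[C [C0 hC h]]; exists C; split => // t s tT sT.
  apply: (@le_geometric _ _ (2 * C)) => n.
  have [_ h1] := h n.+1 t tT; have [_ h2] := h n.+1 s sT.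
  have h3 : `|v n.+1 t - v n.+1 s| <= C * `|t - s|.
    apply: mvt_abs => x xts; split; [exact: dv|apply: hC; exact: between xts].
  have h4 : C / 2 ^+ n.+1 <= C / 2 ^+ n.
    by rewrite ler_wpM2l// lef_pV2 ?posrE ?exprn_gt0// exprS ler_peMl ?exprn_ge0 ?ler1n.
  have e : V t - V s = (V t - v n.+1 t) + (v n.+1 t - v n.+1 s) + (v n.+1 s - V s) by ring.
  rewrite e; apply: le_trans (ler_normD _ _) _; have := ler_normD (V t - v n.+1 t) (v n.+1 t - v n.+1 s).
  by rewrite [`|V t - _|]distrC -mulrA; lra.
pose pU := prim (fun s => f1 (U s) (V s)); pose pV := prim (fun s => f2 (U s) (V s)).
have dpU t := is_derive_prim t (c1 _ _ cU cV).
have dpV t := is_derive_prim t (c2 _ _ cU cV).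
(* The limit solves the integral equation: [u (n+1) - pU] and [v (n+1) - pV] have derivatives of
   order [2^-n] between 0 and [t], hence increments of that order. *)
have UV t : U t = x0 + pU t /\ V t = pV t.
  have [C [C0 _ hC]] := conv `|t| (normr_ge0 t).
  have [L hLT] := hL (`|x0| + A * `|t| + C).
  have uT n x : `|x| <= `|t| -> `|u n x| <= `|x0| + A * `|t| + C.
    by move=> xt; have := ub n x; have := ler_wpM2l A0 xt; lra.
  have UT x : `|x| <= `|t| -> `|U x| <= `|x0| + A * `|t| + C.
    move=> xt; have := ub 0%N x; have := ler_wpM2l A0 xt; have [+ _] := hC 0%N x xt.
    by rewrite expr0 divr1; have := lerB_dist (U x) (u 0%N x); rewrite [`|U x - _|]distrC; lra.
  have bt x : Num.min t 0 <= x <= Num.max t 0 -> `|x| <= `|t|.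
    by apply: between; rewrite ?normr0.
  have lip n x : `|x| <= `|t| ->
      `|f1 (u n x) (v n x) - f1 (U x) (V x)| <= `|L| * (2 * C) / 2 ^+ n /\
      `|f2 (u n x) (v n x) - f2 (U x) (V x)| <= `|L| * (2 * C) / 2 ^+ n.
    move=> xt; have [_ /(_ _ (V x) (UT x xt))[h1 h2]] := hLT _ (v n x) (uT n x xt).
    have [k1 k2] := hC n x xt.
    have k : L * (`|u n x - U x| + `|v n x - V x|) <= `|L| * (2 * C) / 2 ^+ n.
      apply: le_trans (_ : `|L| * (`|u n x - U x| + `|v n x - V x|) <= _).
        by rewrite ler_wpM2r ?ler_norm// addr_ge0.
      by rewrite -mulrA ler_wpM2l// -mulrA; lra.
    by split; [exact: le_trans h1 k|exact: le_trans h2 k].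
  have pU0 : pU 0 = 0 by exact: prim0 (c1 _ _ cU cV).
  have pV0 : pV 0 = 0 by exact: prim0 (c2 _ _ cU cV).
  pose D := `|L| * (2 * C) * `|t| + C.
  have hD n : `|L| * (2 * C) / 2 ^+ n * `|t| + C / 2 ^+ n.+1 <= D / 2 ^+ n.
    rewrite [X in X + _]mulrAC /D [leRHS]mulrDl lerD2l ler_wpM2l// lef_pV2 ?posrE ?exprn_gt0//.
    by rewrite exprS ler_peMl ?exprn_ge0 ?ler1n.
  split; apply/eqP; rewrite -subr_eq0 -normr_le0; apply: (@le_geometric _ _ D) => n; rewrite add0r.
    apply: le_trans (hD n); have [k1 _] := hC n.+1 t (lexx _).
    have h : `|u n.+1 t - pU t - (u n.+1 0 - pU 0)| <= `|L| * (2 * C) / 2 ^+ n * `|t - 0|.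
      apply: (@mvt_abs (fun x => u n.+1 x - pU x) (fun x => f1 (u n x) (v n x) - f1 (U x) (V x))) => x xt.
      by split; [exact: is_derive_sub|exact: (lip n x (bt x xt)).1].
    have e : U t - (x0 + pU t) = (U t - u n.+1 t) + (u n.+1 t - pU t - (u n.+1 0 - pU 0)).
      by rewrite u0 pU0; ring.
    rewrite e; apply: le_trans (ler_normD _ _) _; move: h; rewrite subr0 distrC.
    by rewrite [`|u n.+1 t - U t|]distrC in k1 *; lra.
  apply: le_trans (hD n); have [_ k1] := hC n.+1 t (lexx _).
  have h : `|v n.+1 t - pV t - (v n.+1 0 - pV 0)| <= `|L| * (2 * C) / 2 ^+ n * `|t - 0|.
    apply: (@mvt_abs (fun x => v n.+1 x - pV x) (fun x => f2 (u n x) (v n x) - f2 (U x) (V x))) => x xt.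
    by split; [exact: is_derive_sub|exact: (lip n x (bt x xt)).2].
  have e : V t - pV t = (V t - v n.+1 t) + (v n.+1 t - pV t - (v n.+1 0 - pV 0)).
    by rewrite v0 pV0; ring.
  rewrite e; apply: le_trans (ler_normD _ _) _; move: h; rewrite subr0 distrC.
  by rewrite [`|v n.+1 t - V t|]distrC in k1 *; lra.
exists U, V; split.
- by have [-> _] := UV 0; rewrite /pU prim0 ?addr0//; exact: c1.
- by have [_ ->] := UV 0; rewrite /pV prim0//; exact: c2.
- move=> t; rewrite [X in is_derive _ _ X _](_ : _ = fun t => x0 + pU t).
    by apply: is_derive_eq (is_derive_add (is_derive_cst x0 t 1) (dpU t)) _; rewrite add0r.
  by apply/funext => s; have [] := UV s.
- move=> t; rewrite [X in is_derive _ _ X _](_ : _ = pV); first exact: dpV.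
  by apply/funext => s; have [] := UV s.
Unshelve. all: by end_near. Qed.

End real_functions.

(** * The punctured plane *)

Lemma nbhs_ball_eq {R : realType} {V : normedModType R} (z : V) (P : set V) :
  nbhs z P <-> exists2 e : R, 0 < e & forall w, `|z - w| < e -> P w.
Proof.
split=> [/nbhs_ballP[e e0 h]|[e e0 h]].
  by exists e => // w zw; apply: h; rewrite -ball_normE.
by apply/nbhs_ballP; exists e => // w; rewrite -ball_normE; exact: h.
Qed.

Section punctured_plane.
Context {R : realType}.
Local Notation plane := 'rV[R]_2.

Definition vec2 (a b : R) : plane := \row_(j < 2) if j == 0 then a else b.

Lemma vec2_0 a b : vec2 a b 0 0 = a. Proof. by rewrite mxE eqxx. Qed.
Lemma vec2_1 a b : vec2 a b 0 1 = b. Proof. by rewrite mxE. Qed.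

Lemma vec2_eta (z : plane) : z = vec2 (z 0 0) (z 0 1).
Proof.
apply/rowP => j; rewrite mxE; case: ifPn => [/eqP->//|].
by case: j => [[|[|//]] jj]// _; congr (z 0 _); exact: val_inj.
Qed.

Lemma ord2P (j : 'I_2) : j = 0 \/ j = 1.
Proof. by case: j => [[|[|//]] jj]; [left|right]; exact: val_inj. Qed.

Lemma plane_eq0 (z : plane) : (z == 0) = (z 0 0 == 0) && (z 0 1 == 0).
Proof.
apply/eqP/andP => [->|[/eqP h0 /eqP h1]]; first by rewrite !mxE eqxx.
by rewrite (vec2_eta z) h0 h1; apply/rowP => j; rewrite !mxE if_same.
Qed.

Lemma planeBE (z w : plane) a : (z - w) 0 a = z 0 a - w 0 a.
Proof. by rewrite !mxE. Qed.

Lemma plane_norm_ltP (z : plane) e : `|z| < e <-> (`|z 0 0| < e /\ `|z 0 1| < e).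
Proof.
have E : `|z| < e <-> ball z e 0 by rewrite -ball_normE /= subr0.
rewrite E; split=> [[e0 h]|[h0 h1]].
  have h0 := h 0 0; have h1 := h 0 1.
  by rewrite -ball_normE /= mxE subr0 in h0; rewrite -ball_normE /= mxE subr0 in h1.
split; first exact: le_lt_trans (normr_ge0 _) h0.
by move=> i j; rewrite (ord1 i) -ball_normE /= mxE subr0; case: (ord2P j) => ->.
Qed.

Lemma plane_coord_le (z : plane) a : `|z 0 a| <= `|z|.
Proof.
rewrite leNgt; apply/negP => /plane_norm_ltP[].
by case: (ord2P a) => ->; rewrite ltxx.
Qed.

Lemma plane_norm_le (z : plane) e : `|z 0 0| <= e -> `|z 0 1| <= e -> `|z| <= e.
Proof.
move=> h0 h1; rewrite leNgt; apply/negP => ez; have : `|z| < `|z|; last by rewrite ltxx.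
by apply/plane_norm_ltP; split; [exact: le_lt_trans h0 ez|exact: le_lt_trans h1 ez].
Qed.

(** Removing the origin spares any condition on the metric there and leaves the single global chart
    [pval]; the price is a second end at the puncture. *)
Definition pplane := initial_topology (val : {z : plane | z != 0} -> plane).

Definition pval : pplane -> plane := val.

Lemma pval_neq0 (x : pplane) : pval x != 0. Proof. exact: (valP (x : {z : plane | z != 0})). Qed.

Lemma pval_inj : injective pval. Proof. exact: val_inj. Qed.

Lemma vec2_10 : vec2 1 0 != 0. Proof. by rewrite plane_eq0 vec2_0 oner_eq0. Qed.

Definition pbase : pplane := exist _ (vec2 1 0) vec2_10.

HB.instance Definition _ := Topological.on pplane.
HB.instance Definition _ := isPointed.Build pplane pbase.

(** The origin is sent to [pbase]. This default value is the reason why the origin has to be set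
    aside as a null set when the measure is transported by [pparam]. *)
Definition pparam (z : plane) : pplane := insubd pbase z.

Lemma pparamK z : z != 0 -> pval (pparam z) = z.
Proof. by move=> z0; rewrite /pval /pparam val_insubd z0. Qed.

Lemma pvalK x : pparam (pval x) = x.
Proof. exact: valKd. Qed.

Lemma pval_continuous : continuous pval.
Proof. exact: initial_continuous. Qed.

Definition pU := [set z : plane | z != 0].

Lemma open_pU : open pU.
Proof.
have -> : pU = ~` [set 0] by apply/seteqP; split=> z /=; [move=> /eqP|move/eqP].
by apply: closed_openC; exact: accessible_closed_set1 (hausdorff_accessible (@norm_hausdorff _ _)) _.
Qed.

Lemma pval_image : pval @` setT = pU.
Proof.
apply/seteqP; split=> [z [x _ <-]|z z0]; first exact: pval_neq0.
by exists (pparam z) => //; exact: pparamK.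
Qed.

Lemma nbhs_pplane (x : pplane) (A : set pplane) :
  nbhs x A <-> exists2 B, nbhs (pval x) B & pval @^-1` B `<=` A.
Proof.
split.
  rewrite nbhsE => -[_ [[B oB <-] xB] BA]; exists B => //.
  exact: open_nbhs_nbhs.
by move=> [B xB BA]; apply: filterS BA _; exact: pval_continuous.
Qed.

Lemma pparam_continuous z : z != 0 -> {for z, continuous pparam}.
Proof.
move=> z0 A /nbhs_pplane[B zB BA]; rewrite pparamK// in zB.
have zU : nbhs z pU by apply: open_nbhs_nbhs; split => //; exact: open_pU.
change (nbhs z (pparam @^-1` A)).
apply: filterS (filterI zB zU) => w [Bw Uw]; apply: BA.
by change (B (pval (pparam w))); rewrite pparamK.
Qed.

Lemma pplane_hausdorff : hausdorff_space pplane.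
Proof.
move=> p q pq; apply: pval_inj; apply: (@norm_hausdorff _ plane) => A B pA qB.
have [x [xA xB]] := pq _ _ (pval_continuous pA) (pval_continuous qB).
by exists (pval x).
Qed.

Definition qball (p : rat * rat * nat) : set plane :=
  ball (vec2 (ratr p.1.1) (ratr p.1.2)) (p.2.+1%:R^-1 : R).

(** Besides second countability, this countable basis serves to prove open sets measurable and to
    cover them by countably many boxes. *)
Lemma qball_basis (z : plane) (C : set plane) : nbhs z C ->
  exists2 p, qball p z & qball p `<=` C.
Proof.
move=> /nbhs_ball_eq[e e0 hC].
have e2 : 0 < e / 2 by rewrite divr_gt0.
pose n := Num.bound (2 / e).
have n0 : 0 < n.+1%:R :> R by [].
have ne : n.+1%:R^-1 < e / 2.
  rewrite -[e / 2]invrK ltf_pV2 ?posrE ?invr_gt0// invf_div.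
  apply: lt_le_trans (_ : n%:R <= _); last by rewrite ler_nat.
  by apply: archi_boundP; rewrite divr_ge0// ltW.
have n1 : 0 < n.+1%:R^-1 :> R by rewrite invr_gt0.
have rn (a : R) : exists q : rat, `|ratr q - a| < n.+1%:R^-1.
  have [q] := @rat_in_itvoo R (a - n.+1%:R^-1) (a + n.+1%:R^-1) ltac:(by rewrite ltrD2l gtrN ?invr_gt0).
  by rewrite in_itv/= => h; exists q; rewrite ltr_distl.
have [qa ha] := rn (z 0 0); have [qb hb] := rn (z 0 1).
have Bz : qball (qa, qb, n) z.
  split => // i j; rewrite (ord1 i); case: (ord2P j) => ->.
    by rewrite vec2_0 -ball_normE.
  by rewrite vec2_1 -ball_normE.
exists (qa, qb, n) => // y /= [_ By]; apply: hC; have [_ Bz'] := Bz.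
move: n1 ne By Bz' => /=; move: (n.+1%:R^-1) => d d0 de By Bz'.
apply/plane_norm_ltP; split; rewrite planeBE.
  have := By 0 0; have := Bz' 0 0; rewrite -!ball_normE /= vec2_0 !ltr_distl => /andP[? ?] /andP[? ?].
  by apply/andP; split; lra.
have := By 0 1; have := Bz' 0 1; rewrite -!ball_normE /= vec2_1 !ltr_distl => /andP[? ?] /andP[? ?].
by apply/andP; split; lra.
Qed.

Lemma pplane_second_countable : @second_countable pplane.
Proof.
exists (range (fun p => pval @^-1` qball p)).
  by apply: sub_countable (countableP [set: rat * rat * nat]); exact: card_image_le.
split.
  move=> _ [p _ <-]; exists (qball p) => //; exact: ball_open.
move=> x A /nbhs_pplane[C /qball_basis[p px pC] CA].
exists (pval @^-1` qball p); first by split => //; exists p.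
by move=> y py; apply: CA; exact: pC.
Qed.

(** Each [p] is joined to [pbase] by a segment bent by [s (1 - s)] towards the side of the first
    axis on which [p] lies, so that the second coordinate can vanish only at the two ends. Taking
    [s] to be the square of [sin t] keeps it in [[0, 1]] and makes the path a continuous map on all
    of [R]. *)
Lemma pplane_connected : connected [set: pplane].
Proof.
pose sg (p : pplane) : R := if 0 <= pval p 0 1 then 1 else -1.
pose g (p : pplane) (t : R) : plane := let s := sin t ^+ 2 in
  vec2 ((1 - s) + s * pval p 0 0) (s * pval p 0 1 + sg p * (s * (1 - s))).
have s01 (t : R) : 0 <= sin t ^+ 2 <= 1.
  by rewrite sqr_ge0/= -(cos2Dsin2 t) lerDr sqr_ge0.
have g0 p t : g p t != 0.
  apply/negP; rewrite plane_eq0 /g vec2_0 vec2_1 /sg => /andP[/eqP h0 /eqP h1].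
  have /andP[s0 s1] := s01 t; move: (sin t ^+ 2) h0 h1 s0 s1 => s h0 h1 s0 s1.
  have ss : 0 <= s * (1 - s) by rewrite mulr_ge0// subr_ge0.
  have : s * (1 - s) = 0.
    case: ifPn h1 => y0 h1; [have : 0 <= s * pval p 0 1 by rewrite mulr_ge0|
      have : s * pval p 0 1 <= 0 by rewrite mulr_ge0_le0// ltW// ltNge]; lra.
  move/eqP; rewrite mulf_eq0 => /orP[/eqP e|/eqP e].
    by move: h0; rewrite e mul0r subr0 addr0 => /eqP; rewrite oner_eq0.
  have e1 : s = 1 by lra.
  move: (pval_neq0 p); rewrite plane_eq0; move: h0 h1.
  by rewrite e1 subrr mulr0 mulr0 addr0 add0r !mul1r => -> ->; rewrite eqxx.
pose f p : R -> pplane := fun t => exist _ (g p t) (g0 p t).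
have cf p : continuous (f p).
  apply: continuous_comp_initial => t.
  have cs : {for t, continuous (fun t : R => sin t ^+ 2)}.
    by apply: cvgM; exact: continuous_sin.
  have -> : val \o f p = g p by apply/funext.
  apply/cvgrPdist_lt => e e0.
  have c0 : {for t, continuous (fun t => g p t 0 0)}.
    have -> : (fun t => g p t 0 0) = fun t => (1 - sin t ^+ 2) + sin t ^+ 2 * pval p 0 0.
      by apply/funext => s; rewrite /g vec2_0.
    apply: cvgD; first by apply: cvgB; [exact: cvg_cst|exact: cs].
    by apply: cvgM; [exact: cs|exact: cvg_cst].
  have c1 : {for t, continuous (fun t => g p t 0 1)}.
    have -> : (fun t => g p t 0 1) = fun t => sin t ^+ 2 * pval p 0 1 + sg p * (sin t ^+ 2 * (1 - sin t ^+ 2)).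
      by apply/funext => s; rewrite /g vec2_1.
    apply: cvgD; first by apply: cvgM; [exact: cs|exact: cvg_cst].
    apply: cvgM; first exact: cvg_cst.
    by apply: cvgM; [exact: cs|apply: cvgB; [exact: cvg_cst|exact: cs]].
  near=> s; apply/plane_norm_ltP; split; rewrite planeBE.
    by near: s; move/cvgrPdist_lt : c0; apply.
  by near: s; move/cvgrPdist_lt : c1; apply.
have -> : [set: pplane] = \bigcup_(p in [set: pplane]) (f p @` `[0, pi / 2]).
  apply/seteqP; split=> // p _; exists p => //; exists (pi / 2).
    by rewrite /= in_itv/= lexx andbT divr_ge0// pi_ge0.
  apply: pval_inj; rewrite [RHS]vec2_eta; change (g p (pi / 2) = vec2 (pval p 0 0) (pval p 0 1)).
  by rewrite /g sin_pihalf expr1n subrr !mulr0 addr0 add0r !mul1r.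
apply: bigcup_connected.
  exists pbase => p _; exists 0; first by rewrite /= in_itv/= lexx divr_ge0// pi_ge0.
  apply: pval_inj; change (g p 0 = vec2 1 0).
  by rewrite /g sin0 expr0n /= subr0 !mul0r !mulr0 !addr0.
move=> p _; apply: connected_continuous_connected; first exact: segment_connected.
exact: continuous_subspaceT.
Unshelve. all: by end_near. Qed.

Lemma pplane_unbounded : ~ compact [set: pplane].
Proof.
move=> cM; pose h (x : pplane) : R := pval x 0 0.
have ch : continuous h.
  move=> x; apply: (@continuous_comp _ _ _ pval (fun z : plane => z 0 0)).
    exact: pval_continuous.
  exact: coord_continuous.
have [x _ hx] := @compact_EVT_max _ _ h [set: pplane] ltac:(by exists pbase) cM ltac:(exact: continuous_subspaceT).
have w0 : vec2 (`|h x| + 1) 0 != 0 by rewrite plane_eq0 vec2_0 gt_eqF// ltr_wpDl.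
have := hx (pparam (vec2 (`|h x| + 1) 0)) ltac:(by rewrite inE).
rewrite {1}/h pparamK// vec2_0; have := ler_norm (h x); lra.
Qed.

End punctured_plane.

Section smooth_closure.
Context {R : realType} {V : normedModType R} {I : Type} (d : I -> V).
Implicit Types (U : set V) (f : V -> R).
Local Notation pos := [set x : R | 0 < x].

Lemma smooth_powR U f a : open U -> (forall z, U z -> 0 < f z) ->
  smooth_in d U f -> smooth_in d U (fun z => f z `^ a).
Proof.
move=> oU f0; apply: (@smooth_comp _ _ _ d U pos (fun x => x `^ a) _ oU f0).
exact: smooth1_powR.
Qed.

Lemma smooth_ln U f : open U -> (forall z, U z -> 0 < f z) ->
  smooth_in d U f -> smooth_in d U (fun z => ln (f z)).
Proof.
move=> oU f0; apply: (@smooth_comp _ _ _ d U pos (@ln R) _ oU f0).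
exact: smooth1_ln.
Qed.

Lemma smooth_inv U f : open U -> (forall z, U z -> 0 < f z) ->
  smooth_in d U f -> smooth_in d U (fun z => (f z)^-1).
Proof.
move=> oU f0 hf; apply: (@smooth_congr _ _ _ d U (fun z => f z `^ (-1)) _ oU).
  by move=> z Uz; rewrite powR_inv1// ltW// f0.
exact: smooth_powR.
Qed.

Lemma smooth_sqr U f : open U -> smooth_in d U f -> smooth_in d U (fun z => f z ^+ 2).
Proof.
move=> oU hf; apply: (@smooth_congr _ _ _ d U (fun z => f z * f z) _ oU).
  by [].
exact: smoothM.
Qed.

End smooth_closure.

Lemma sum_ord2 {V : nmodType} (F : 'I_2 -> V) : \sum_i F i = F 0 + F 1.
Proof.
by rewrite !big_ord_recl big_ord0 addr0; congr (_ + F _); exact: val_inj.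
Qed.

Lemma det_mx2 {R : comPzRingType} (A : 'M[R]_2) :
  \det A = A 0 0 * A 1 1 - A 0 1 * A 1 0.
Proof.
rewrite (expand_det_row _ 0) sum_ord2 /cofactor !det_mx11 !mxE /=.
have l00 : lift 0 0 = 1 :> 'I_2 by exact: val_inj.
have l10 : lift 1 0 = 0 :> 'I_2 by exact: val_inj.
by rewrite l00 l10 /= expr0 expr1 mul1r mulN1r mulrN.
Qed.

(** * Calculus in Cartesian coordinates of the half squared norm and of the rotation by a right
    angle *)

Section plane_calculus.
Context {R : realType}.
Local Notation plane := 'rV[R]_2.
Local Notation pos := [set x : R | 0 < x].
Implicit Types (z v w : plane).

Definition dirs (k : 'I_2) : plane := delta_mx 0 k.

Lemma smooth_onE (U : set plane) (f : plane -> R) :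
  smooth_on U f <-> smooth_in dirs U f.
Proof. by []. Qed.

Lemma is_derive_coord a z v : is_derive z v (fun z : plane => z 0 a) (v 0 a).
Proof.
apply/is_derive_line.
have -> : (fun h : R => (h *: v + z) 0 a) = (fun h => h * v 0 a + z 0 a).
  by apply/funext => h; rewrite !mxE.
apply: is_derive_eq (is_derive_add (is_derive_mul (is_derive_self 0)
  (is_derive_const (v 0 a) 0)) (is_derive_const (z 0 a) 0)) _.
by rewrite mulr0 add0r mulr1 addr0.
Qed.

Lemma smooth_coord a (U : set plane) : open U -> smooth_in dirs U (fun z => z 0 a).
Proof.
move=> oU; apply/smooth_inP => n; apply: CnS.
apply: (@Cn_succ _ _ _ _ _ _ _ (fun k => cst (dirs k 0 a)) oU).
- by move=> z _; exact: coord_continuous.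
- by move=> k z _; exact: is_derive_coord.
- by move=> k; exact: Cn_cst.
Qed.

Definition sq z : R := (z 0 0 ^+ 2 + z 0 1 ^+ 2) / 2.
Definition perp z : plane := vec2 (- z 0 1) (z 0 0).
Definition dot v w : R := v 0 0 * w 0 0 + v 0 1 * w 0 1.

Lemma perp_0 z : perp z 0 0 = - z 0 1. Proof. exact: vec2_0. Qed.
Lemma perp_1 z : perp z 0 1 = z 0 0. Proof. exact: vec2_1. Qed.

Lemma sq_gt0 z : z != 0 -> 0 < sq z.
Proof.
rewrite plane_eq0 negb_and => h; rewrite divr_gt0//.
case/orP: h => h; [apply: ltr_pwDl|apply: ltr_wpDl]; rewrite ?sqr_ge0//;
  by rewrite lt_def sqr_ge0 sqrf_eq0 h.
Qed.

Lemma smooth_sq (U : set plane) : open U -> smooth_in dirs U sq.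
Proof.
move=> oU; apply: smoothM => //; last exact: smooth_cst.
by apply: smoothD => //; apply: smooth_sqr => //; exact: smooth_coord.
Qed.

Lemma is_derive_sq z v : is_derive z v sq (dot z v).
Proof.
apply/is_derive_line.
have c a := (is_derive_line (fun z : plane => z 0 a) z v (v 0 a)).1 (is_derive_coord a z v).
pose f a (h : R) := (h *: v + z) 0 a.
have h0 := is_derive_mul (c 0) (c 0); have h1 := is_derive_mul (c 1) (c 1).
apply: is_derive_eq (is_derive_mul (is_derive_add h0 h1) (is_derive_const 2^-1 0)) _.
by rewrite !scale0r !add0r mulr0 add0r /dot; field.
Qed.

Lemma smooth_radial (f : R -> R) : smooth1 pos f ->
  smooth_in dirs pU (fun z => f (sq z)).
Proof.
move=> hf; apply: smooth_comp hf _ => //; first exact: open_pU.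
  by move=> z; exact: sq_gt0.
by apply: smooth_sq; exact: open_pU.
Qed.

Lemma is_derive_radial (f : R -> R) df z v : is_derive (sq z) 1 f df ->
  is_derive z v (fun z => f (sq z)) (df * dot z v).
Proof. by move=> h; apply: is_derive_chain => //; exact: is_derive_sq. Qed.

Lemma smooth_perp a (U : set plane) : open U -> smooth_in dirs U (fun z => perp z 0 a).
Proof.
move=> oU; case: (ord2P a) => ->.
  apply: (@smooth_congr _ _ _ _ _ (fun z => - z 0 1)) => //.
    by move=> z _; rewrite perp_0.
  by apply: smoothN => //; exact: smooth_coord.
apply: (@smooth_congr _ _ _ _ _ (fun z => z 0 0)) => //.
  by move=> z _; rewrite perp_1.
exact: smooth_coord.
Qed.

(** For the map [pval \o pparam], which is the identity off the origin. It is both the transition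
    map and the change of components. *)
Lemma jacobian_near_id (f : plane -> plane) z : (\near z, f z = z) -> 'J f z = 1%:M.
Proof.
move=> fz.
have dfE : 'd f z = (fun v => v) :> (plane -> plane).
  apply: (@diff_unique _ _ _ f (idfun : {linear plane -> plane})).
    by move=> x; exact: cvg_id.
  apply/eqaddoP => e e0.
  have fz0 := nbhs_singleton fz.
  have [r r0 hr] := (nbhs_ball_eq z (fun z => f z = z)).1 fz.
  apply/nbhs_ball_eq; exists r => // h; rewrite sub0r normrN => hr'.
  rewrite /= !fctE /= hr; last by rewrite /= opprD addrCA subrr addr0 normrN.
  by rewrite fz0 [h + z]addrC subrr normr0 mulr_ge0// ltW.
apply/row_matrixP => i; rewrite rowE /jacobian mul_rV_lin1 dfE.
by rewrite row1.
Qed.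

End plane_calculus.

(** * The radial metric and its geodesics *)

(* In polar form, with s = |z|^2 / 2 and theta the angle, the metric is
   ds^2 / k(s)^2 + k(s)^2 dtheta^2.  Since ds dtheta = dx dy its volume density
   is 1, and ds = z . dz, dtheta = (perp z . dz) / (2 s). *)
Section radial_metric.
Context {R : realType}.
Local Notation plane := 'rV[R]_2.
Local Notation pos := [set x : R | 0 < x].
Variable k : R -> R.
Hypothesis k_smooth : smooth1 pos k.
Hypothesis k_gt0 : forall s, 0 < s -> 0 < k s.
Implicit Types (z v w : plane).

Definition rad_coef (s : R) := (k s ^+ 2)^-1.
Definition ang_coef (s : R) := k s ^+ 2 / (4 * s ^+ 2).

Definition gmat z : 'M[R]_2 := \matrix_(a, b)
  (rad_coef (sq z) * (z 0 a * z 0 b) + ang_coef (sq z) * (perp z 0 a * perp z 0 b)).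

Lemma gmatE z a b : gmat z a b =
  rad_coef (sq z) * (z 0 a * z 0 b) + ang_coef (sq z) * (perp z 0 a * perp z 0 b).
Proof. by rewrite /gmat mxE. Qed.

Lemma smooth_rad_coef : smooth1 pos rad_coef.
Proof.
apply: smooth_inv; [exact: open_pos|by move=> s s0; rewrite exprn_gt0 ?k_gt0|].
exact: (smooth_sqr open_pos k_smooth).
Qed.

Lemma smooth_ang_coef : smooth1 pos ang_coef.
Proof.
have oP := @open_pos R.
apply: (smoothM oP (smooth_sqr oP k_smooth)).
apply: (smooth_inv oP); first by move=> s s0; rewrite mulr_gt0// exprn_gt0.
apply: (smoothM oP (smooth_cst _ _ oP)).
by apply: (smooth_sqr oP); exact: smooth_sub (@smooth1_id R).
Qed.

Lemma gmat_form z v w : (v *m gmat z *m w^T) 0 0 =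
  rad_coef (sq z) * (dot z v * dot z w) +
  ang_coef (sq z) * (dot (perp z) v * dot (perp z) w).
Proof.
rewrite mxE sum_ord2 ![(_ *m gmat z) _ _]mxE !sum_ord2.
by rewrite !gmatE ![(w^T) _ _]mxE /dot !perp_0 !perp_1; ring.
Qed.

(** Lagrange's identity: [z] and [perp z] are orthogonal of squared length [2 sq z]. It shows that
    the two squares in [gmat_form] do not vanish together. *)
Lemma dot_decomp z v : 2 * sq z * dot v v = dot z v ^+ 2 + dot (perp z) v ^+ 2.
Proof. by rewrite /sq /dot perp_0 perp_1; field. Qed.

Lemma dot_gt0 v : v != 0 -> 0 < dot v v.
Proof.
by move=> /sq_gt0; rewrite /sq /dot !expr2 pmulr_lgt0// invr_gt0.
Qed.

Lemma gmat_gt0 z v : z != 0 -> v != 0 -> 0 < (v *m gmat z *m v^T) 0 0.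
Proof.
move=> z0 v0; rewrite gmat_form; have s0 := sq_gt0 z0.
have a0 : 0 < rad_coef (sq z) by rewrite invr_gt0 exprn_gt0 ?k_gt0.
have b0 : 0 < ang_coef (sq z).
  by rewrite divr_gt0 ?exprn_gt0 ?k_gt0// mulr_gt0 ?exprn_gt0.
have := dot_decomp z v; have := dot_gt0 v0; rewrite -!expr2 => vv e.
have h : 0 < dot z v ^+ 2 + dot (perp z) v ^+ 2 by rewrite -e mulr_gt0// mulr_gt0.
have [dz|dz] := eqVneq (dot z v) 0.
  rewrite dz expr0n /= mulr0 !add0r in h *.
  by rewrite mulr_gt0.
apply: ltr_pwDl; first by rewrite mulr_gt0// lt_def sqr_ge0 sqrf_eq0 dz.
by rewrite mulr_ge0 ?sqr_ge0// ltW.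
Qed.

Lemma gmat_sym z : (gmat z)^T = gmat z.
Proof. by apply/matrixP => a b; rewrite [LHS]mxE !gmatE; ring. Qed.

(** The metric is a sum of two rank-one forms along orthogonal vectors of squared length [2 s], so
    the determinant is the product of the two coefficients with [(2 s)^2]. *)
Lemma det_gmat z : z != 0 -> \det (gmat z) = 1.
Proof.
move=> z0; have s0 := sq_gt0 z0; have k0 := k_gt0 s0.
rewrite det_mx2 !gmatE !perp_0 !perp_1 /rad_coef /ang_coef.
have e : z 0 0 ^+ 2 + z 0 1 ^+ 2 = 2 * sq z by rewrite /sq; field.
move: (sq z) s0 k0 e => s s0 k0 e; move: (k s) k0 => K K0.
transitivity ((K ^+ 2)^-1 * (K ^+ 2 / (4 * s ^+ 2)) * (z 0 0 ^+ 2 + z 0 1 ^+ 2) ^+ 2); first by ring.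
by rewrite e; field; rewrite !gt_eqF.
Qed.

Lemma smooth_gmat a b : smooth_in dirs pU (fun z => gmat z a b).
Proof.
have oU := @open_pU R.
apply: (@smooth_congr _ _ _ dirs pU (fun z => rad_coef (sq z) * (z 0 a * z 0 b) +
   ang_coef (sq z) * (perp z 0 a * perp z 0 b)) _ oU); first by move=> z _; rewrite gmatE.
apply: (smoothD oU); apply: (smoothM oU).
- exact: smooth_radial smooth_rad_coef.
- exact: (smoothM oU (smooth_coord a oU) (smooth_coord b oU)).
- exact: smooth_radial smooth_ang_coef.
- exact: (smoothM oU (smooth_perp a oU) (smooth_perp b oU)).
Qed.

Lemma pparam_near_id z : z != 0 -> \near z, pval (pparam z) = z.
Proof.
move=> z0; have zU : nbhs z pU by apply: open_nbhs_nbhs; split => //; exact: open_pU.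
by apply: filterS zU => w; exact: pparamK.
Qed.

Lemma pimage (A : set (@pplane R)) z : (pval @` A) z -> z != 0.
Proof. by move=> [x _ <-]; exact: pval_neq0. Qed.

(** Transparent, because the carrier, the chart and the metric are recovered by conversion in what
    follows. *)
Definition radial_manifold : riemannian_manifold R 1.
Proof.
refine (@RiemannianManifold R 1 (@pplane R) pplane_hausdorff pplane_second_countable
  pplane_connected unit (fun _ => setT) (fun _ => pval) (fun _ => pparam)
  (fun _ => tt) _ _ _ _ _ _ _ (fun _ => gmat) _ _ _ _).
- by [].
- by move=> _; exact: openT.
- by move=> _; rewrite pval_image; exact: open_pU.
- by move=> _ x _; exact: pvalK.
- by move=> _ x _; exact: pval_continuous.
- by move=> _ z /pimage; exact: pparam_continuous.
- move=> _ _ l; rewrite setTI pval_image; apply/smooth_onE.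
  apply: (@smooth_congr _ _ _ dirs pU (fun z => z 0 l) _ open_pU).
    by move=> z /pparamK ->.
  exact: smooth_coord open_pU.
- by move=> _ a b; rewrite pval_image; exact: smooth_gmat.
- by move=> _ z _; exact: gmat_sym.
- by move=> _ z v /pimage; exact: gmat_gt0.
- move=> _ _ z /pimage z0.
  rewrite jacobian_near_id; last exact: pparam_near_id.
  by rewrite mul1mx trmx1 mulmx1 pparamK.
Defined.

End radial_metric.

Section derivative_rules.
Context {R : realType} {V : normedModType R}.
Implicit Types (f g : V -> R) (z v : V) (a b : R).

Lemma is_derive_mulV f g z v a b : is_derive z v f a -> is_derive z v g b ->
  is_derive z v (fun w => f w * g w) (f z * b + g z * a).
Proof. by move=> ? ?; exact: is_deriveM. Qed.

Lemma is_derive_addV f g z v a b : is_derive z v f a -> is_derive z v g b ->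
  is_derive z v (fun w => f w + g w) (a + b).
Proof. by move=> ? ?; exact: is_deriveD. Qed.

End derivative_rules.

Section radial_geometry.
Context {R : realType}.
Local Notation plane := 'rV[R]_2.
Local Notation pos := [set x : R | 0 < x].
Variable k : R -> R.
Hypothesis k_smooth : smooth1 pos k.
Hypothesis k_gt0 : forall s, 0 < s -> 0 < k s.
Local Notation M := (radial_manifold k_smooth k_gt0).
Implicit Types (z v w : plane) (x : M).

Definition radius2 x : R := sq (pval x).

Lemma radius2_gt0 x : 0 < radius2 x.
Proof. by apply: sq_gt0; exact: pval_neq0. Qed.

Lemma rad_coef_gt0 s : 0 < s -> 0 < rad_coef k s.
Proof. by move=> s0; rewrite invr_gt0 exprn_gt0 ?k_gt0. Qed.

Lemma ang_coef_gt0 s : 0 < s -> 0 < ang_coef k s.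
Proof. by move=> s0; rewrite divr_gt0 ?exprn_gt0 ?k_gt0// mulr_gt0 ?exprn_gt0. Qed.

Lemma radial_innerE x v w : inner x v w =
  rad_coef k (radius2 x) * (dot (pval x) v * dot (pval x) w) +
  ang_coef k (radius2 x) * (dot (perp (pval x)) v * dot (perp (pval x)) w).
Proof. exact: gmat_form. Qed.

Lemma radial_componentE x (i : chart M) v : component i x v = v.
Proof.
change (v *m 'J (pval \o pparam) (pval x) = v).
rewrite jacobian_near_id ?mulmx1//.
by apply: pparam_near_id; exact: pval_neq0.
Qed.

Lemma radial_vol_density (i : chart M) z : z != 0 -> vol_density i z = 1.
Proof.
move=> z0; change (Num.sqrt (\det (gmat k z)) = 1).
by rewrite det_gmat// sqrtr1.
Qed.


Lemma radial_image (i : chart M) : Defs.coord i @` dom i = pU :> set plane.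
Proof. exact: pval_image. Qed.

Definition field_on (X : M -> plane) (j : 'I_2) (z : plane) : R := X (pparam z) 0 j.

Lemma radial_smooth_fieldE (X : M -> plane) :
  smooth_field X <-> forall j, smooth_in dirs pU (field_on X j).
Proof.
have oU := @open_pU R.
split=> [h j|h i j].
  have := h tt j; rewrite radial_image => /smooth_onE h'.
  by apply: (smooth_congr oU _ h') => z z0; rewrite radial_componentE.
rewrite radial_image; apply/smooth_onE; apply: (smooth_congr oU _ (h j)) => z z0.
by rewrite radial_componentE.
Qed.

(** As the density is 1, the Riemannian divergence is the Euclidean one, and integration by parts
    reduces to that on the plane. *)
Lemma radial_divergenceE (X : M -> plane) x :
  divergence X x = \sum_j pd dirs j (field_on X j) (pval x).
Proof.
rewrite /divergence radial_vol_density ?invr1 ?mul1r; last exact: pval_neq0.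
apply: eq_bigr => j _; apply: (@pd_congr _ _ _ dirs pU) => //.
- exact: open_pU.
- by move=> z z0; rewrite radial_vol_density// mul1r radial_componentE.
- exact: pval_neq0.
Qed.

(** The form [ds], here [dot (pval x)], has norm [k]. This bounds curve lengths from below, and
    later the pairing of the flux with a weak gradient from above. *)
Lemma tnorm_ge_radial x v : `|dot (pval x) v| <= k (radius2 x) * tnorm x v.
Proof.
have s0 := radius2_gt0 x; have K0 := k_gt0 s0.
rewrite -ler_pdivrMl// -[leLHS]ger0_norm; last by rewrite mulr_ge0// invr_ge0 ltW.
rewrite -sqrtr_sqr ler_sqrt; last first.
  by rewrite radial_innerE -!expr2 addr_ge0// mulr_ge0 ?sqr_ge0// ltW// ?rad_coef_gt0 ?ang_coef_gt0.
rewrite radial_innerE -!expr2 exprMn exprVn real_normK ?num_real// lerDl.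
by rewrite mulr_ge0 ?sqr_ge0// ltW// ang_coef_gt0.
Qed.

Lemma dot_perp z : dot (perp z) z = 0.
Proof. by rewrite /dot perp_0 perp_1; ring. Qed.

Lemma dot_self z : dot z z = 2 * sq z.
Proof. by rewrite /dot /sq; field. Qed.

Lemma dotZ z w c : dot z (c *: w) = c * dot z w.
Proof. by rewrite /dot !mxE; ring. Qed.

Lemma tnorm_radial x c : tnorm x (c *: pval x) = `|c| * (2 * radius2 x) / k (radius2 x).
Proof.
have s0 := radius2_gt0 x; have K0 := k_gt0 s0.
rewrite /tnorm radial_innerE !dotZ dot_perp !(mulr0, mul0r) addr0 dot_self -/(radius2 x).
have -> : rad_coef k (radius2 x) * (c * (2 * radius2 x) * (c * (2 * radius2 x))) =
   (c * (2 * radius2 x) / k (radius2 x)) ^+ 2.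
  by rewrite /rad_coef; field; rewrite gt_eqF.
have h : 0 < 2 * radius2 x / k (radius2 x) by rewrite divr_gt0// mulr_gt0.
by rewrite sqrtr_sqr -mulrA normrM (gtr0_norm h) mulrA.
Qed.

Lemma inner_radial x c w : inner x (c *: pval x) w =
  c * (2 * radius2 x) / k (radius2 x) ^+ 2 * dot (pval x) w.
Proof.
rewrite radial_innerE !dotZ dot_perp !(mulr0, mul0r) addr0 dot_self -/(radius2 x).
by rewrite /rad_coef; ring.
Qed.

Lemma pd_gmat z (a b l : 'I_2) da db : z != 0 ->
  is_derive (sq z) 1 (rad_coef k) da -> is_derive (sq z) 1 (ang_coef k) db ->
  pd dirs l (fun w => gmat k w a b) z =
    da * z 0 l * (z 0 a * z 0 b)
    + rad_coef k (sq z) * ((l == a)%:R * z 0 b + z 0 a * (l == b)%:R)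
    + db * z 0 l * (perp z 0 a * perp z 0 b)
    + ang_coef k (sq z) * (perp (dirs l) 0 a * perp z 0 b + perp z 0 a * perp (dirs l) 0 b).
Proof.
move=> z0 hda hdb.
have dc c : is_derive z (dirs l) (fun z : plane => z 0 c) (l == c)%:R.
  by apply: is_derive_eq (is_derive_coord c z (dirs l)) _; rewrite mxE eqxx eq_sym.
have dp c : is_derive z (dirs l) (fun z : plane => perp z 0 c) (perp (dirs l) 0 c).
  case: (ord2P c) => ->.
    rewrite [X in is_derive _ _ X _](_ : _ = - (fun z : plane => z 0 1)); last first.
      by apply/funext => w; rewrite perp_0.
    by rewrite perp_0; apply: is_deriveN; exact: is_derive_coord.
  rewrite [X in is_derive _ _ X _](_ : _ = (fun z : plane => z 0 0)); last first.
    by apply/funext => w; rewrite perp_1.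
  by rewrite perp_1; exact: is_derive_coord.
have dl : dot z (dirs l) = z 0 l.
  by rewrite /dot !mxE /=; case: (ord2P l) => ->; rewrite /= ?mulr1 ?mulr0 ?addr0 ?add0r.
have hA := is_derive_radial (dirs l) hda; have hB := is_derive_radial (dirs l) hdb.
have h := is_derive_addV (is_derive_mulV hA (is_derive_mulV (dc a) (dc b)))
  (is_derive_mulV hB (is_derive_mulV (dp a) (dp b))).
have -> : (fun w => gmat k w a b) = fun z => rad_coef k (sq z) * (z 0 a * z 0 b) +
  ang_coef k (sq z) * (perp z 0 a * perp z 0 b) by apply/funext => w; rewrite gmatE.
by apply: derive_val; apply: is_derive_eq h _; rewrite dl; ring.
Qed.

End radial_geometry.

Section smooth1_derivative.
Context {R : realType}.
Implicit Types (J : set R) (f : R -> R).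

Lemma smooth1_is_derive J f x : smooth1 J f -> J x -> is_derive x 1 f (derive1 f x).
Proof.
move=> hf Jx; rewrite derive1E; apply: derivableP.
exact: (@smooth_derivable _ _ _ one_dir _ _ tt _ hf Jx).
Qed.

Lemma smooth1_derive1 J f : smooth1 J f -> smooth1 J (derive1 f).
Proof.
move=> /(@smooth_pd _ _ _ one_dir _ _ tt).
by rewrite (_ : pd _ _ _ = derive1 f)//; apply/funext => x; rewrite derive1E.
Qed.

End smooth1_derivative.

Section plane_curves.
Context {R : realType}.
Local Notation plane := 'rV[R]_2.

Lemma continuous_plane (f : R -> plane) t :
  {for t, continuous (fun t => f t 0 0)} -> {for t, continuous (fun t => f t 0 1)} ->
  {for t, continuous f}.
Proof.
move=> c0 c1; apply/cvgrPdist_lt => e e0.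
near=> s; apply/plane_norm_ltP; split; rewrite planeBE.
  by near: s; move/cvgrPdist_lt : c0; apply.
by near: s; move/cvgrPdist_lt : c1; apply.
Unshelve. all: by end_near. Qed.

Lemma is_derive_plane (f : R -> plane) (t d0 d1 : R) :
  is_derive t 1 (fun t => f t 0 0) d0 -> is_derive t 1 (fun t => f t 0 1) d1 ->
  derivable f t 1 /\ derive1 f t = vec2 d0 d1.
Proof.
move=> h0 h1.
have df : derivable f t 1.
  apply/derivable_mxP => i j; rewrite (ord1 i); case: (ord2P j) => ->; [by case: h0|by case: h1].
split=> //; rewrite derive1E derive_mx//; apply/rowP => j; rewrite !mxE.
by case: (ord2P j) => -> /=; rewrite derive_val.
Qed.

Lemma is_derive_vec2 (a b : R -> R) (t d0 d1 : R) :
  is_derive t 1 a d0 -> is_derive t 1 b d1 ->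
  derivable (fun u => vec2 (a u) (b u)) t 1 /\
  derive1 (fun u => vec2 (a u) (b u)) t = vec2 d0 d1.
Proof.
move=> h0 h1; apply: is_derive_plane.
  by rewrite [X in is_derive _ _ X _](_ : _ = a)//; apply/funext => u; rewrite vec2_0.
by rewrite [X in is_derive _ _ X _](_ : _ = b)//; apply/funext => u; rewrite vec2_1.
Qed.

End plane_curves.

(** * The geodesic equation and completeness *)

Section radial_geodesics.
Context {R : realType}.
Local Notation plane := 'rV[R]_2.
Local Notation pos := [set x : R | 0 < x].
Variable k : R -> R.
Hypothesis k_smooth : smooth1 pos k.
Hypothesis k_gt0 : forall s, 0 < s -> 0 < k s.
Local Notation M := (radial_manifold k_smooth k_gt0).
Local Notation dk := (derive1 k).

Lemma is_derive_k (s : R) : 0 < s -> is_derive s 1 k (dk s).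
Proof.
exact: (smooth1_is_derive k_smooth).
Qed.

Lemma is_derive_rad_coef (s : R) : 0 < s -> is_derive s 1 (rad_coef k) (- 2 * dk s / k s ^+ 3).
Proof.
move=> s0; have dks := is_derive_k s0; have K0 := k_gt0 s0.
have -> : rad_coef k = fun s => (k s * k s)^-1 by apply/funext => t; rewrite /rad_coef expr2.
apply: is_derive_eq (is_derive_inv _ (is_derive_mul dks dks)) _.
  by rewrite gt_eqF// mulr_gt0.
by field; rewrite gt_eqF.
Qed.

Lemma is_derive_ang_coef (s : R) : 0 < s -> is_derive s 1 (ang_coef k)
  (k s * dk s / (2 * s ^+ 2) - k s ^+ 2 / (2 * s ^+ 3)).
Proof.
move=> s0; have dks := is_derive_k s0; have K0 := k_gt0 s0.
have -> : ang_coef k = fun s => k s * k s * (4 * (s * s))^-1.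
  by apply/funext => t; rewrite /ang_coef !expr2.
have ds := is_derive_self s.
apply: is_derive_eq (is_derive_mul (is_derive_mul dks dks)
  (is_derive_inv _ (is_derive_mulc 4 (is_derive_mul ds ds)))) _.
  by rewrite gt_eqF// !mulr_gt0.
by field; rewrite gt_eqF.
Qed.

(* P = k theta' and Q = s' / k are the components of the velocity in the
   orthonormal frame of the polar coordinates. *)
Lemma radial_geodesic (c : R -> M) (P Q : R -> R) :
  (forall t : R, is_derive t 1 (fun t => pval (c t) 0 0)
    (k (radius2 (c t)) * Q t / (2 * radius2 (c t)) * pval (c t) 0 0
     - P t / k (radius2 (c t)) * pval (c t) 0 1)) ->
  (forall t : R, is_derive t 1 (fun t => pval (c t) 0 1)
    (k (radius2 (c t)) * Q t / (2 * radius2 (c t)) * pval (c t) 0 1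
     + P t / k (radius2 (c t)) * pval (c t) 0 0)) ->
  (forall t : R, is_derive t 1 P (- (dk (radius2 (c t)) * P t * Q t))) ->
  (forall t : R, is_derive t 1 Q (dk (radius2 (c t)) * P t ^+ 2)) ->
  geodesic c.
Proof.
move=> d0 d1 dP dQ.
pose X (t : R) : R := pval (c t) 0 0; pose Y (t : R) : R := pval (c t) 0 1.
pose s t := radius2 (c t).
have s0 t : 0 < s t by exact: radius2_gt0.
have K0 t : 0 < k (s t) by exact: k_gt0.
have sE t : s t = (X t * X t + Y t * Y t) / 2 by rewrite /s /radius2 /sq !expr2.
(* The velocity is [A z + B (perp z)], with [A = s' / (2 s)] and [B = theta']. *)
pose A t := k (s t) * Q t / (2 * s t); pose B t := P t / k (s t).
have dX (t : R) : is_derive t 1 X (A t * X t - B t * Y t) by exact: d0.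
have dY (t : R) : is_derive t 1 Y (A t * Y t + B t * X t) by exact: d1.
have ds (t : R) : is_derive t 1 s (k (s t) * Q t).
  rewrite [X in is_derive _ _ X _](_ : _ = fun t => (X t * X t + Y t * Y t) * 2^-1); last exact/funext.
  have eN : X t * X t + Y t * Y t = 2 * s t by rewrite sE; field.
  apply: is_derive_eq (is_derive_mul (is_derive_add (is_derive_mul (dX t) (dX t))
    (is_derive_mul (dY t) (dY t))) (is_derive_const 2^-1 t)) _.
  transitivity (A t * (X t * X t + Y t * Y t)); first by field.
  by rewrite eN /A; field; rewrite gt_eqF.
have dK (t : R) : is_derive t 1 (fun t => k (s t)) (dk (s t) * (k (s t) * Q t)).
  exact: (@is_derive1_comp _ k s t _ _ (is_derive_k (s0 t)) (ds t)).
have dA (t : R) : is_derive t 1 A ((dk (s t) * k (s t) * Q t ^+ 2 + k (s t) * dk (s t) * P t ^+ 2) / (2 * s t)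
   - k (s t) ^+ 2 * Q t ^+ 2 / (2 * s t ^+ 2)).
  have n0 : 2 * s t != 0 by rewrite gt_eqF// mulr_gt0.
  apply: is_derive_eq (is_derive_mul (is_derive_mul (dK t) (dQ t))
    (@is_derive_inv _ (fun t => 2 * s t) t _ n0 (is_derive_mulc 2 (ds t)))) _.
  by rewrite -/(s t); field; rewrite gt_eqF.
have dB (t : R) : is_derive t 1 B (- (2 * dk (s t) * P t * Q t / k (s t))).
  have n0 : k (s t) != 0 by rewrite gt_eqF.
  apply: is_derive_eq (is_derive_mul (dP t) (@is_derive_inv _ (fun t => k (s t)) t _ n0 (dK t))) _.
  by rewrite -/(s t); field.
have cc : continuous (fun t => pval (c t)).
  by move=> t; apply: continuous_plane; exact: is_derive_continuous.
split; first exact: (@continuous_comp_initial _ _ _ _ c cc).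
move=> [] t _ /=; set f := _ \o c.
have f1 u : derivable f u 1 /\ derive1 f u = vec2 (A u * X u - B u * Y u) (A u * Y u + B u * X u).
  exact: is_derive_plane.
have f1E : derive1 f = fun u => vec2 (A u * X u - B u * Y u) (A u * Y u + B u * X u).
  by apply/funext => u; have [] := f1 u.
have [f2 f2E] := is_derive_vec2
  (is_derive_sub (is_derive_mul (dA t) (dX t)) (is_derive_mul (dB t) (dY t)))
  (is_derive_add (is_derive_mul (dA t) (dY t)) (is_derive_mul (dB t) (dX t))).
have [f1t _] := f1 t.
split; [exact: f1t|rewrite f1E; exact: f2|rewrite f1E f2E].
set W := vec2 _ _; pose v0 := A t * X t - B t * Y t; pose v1 := A t * Y t + B t * X t.
set z := f t; have z0 : z != 0 by exact: pval_neq0.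
have zs : sq z = s t by [].
have g0 : gmat k z \in unitmx by rewrite unitmxE det_gmat// unitr1.
have gV i j : invmx (gmat k z) i 0 * gmat k z 0 j + invmx (gmat k z) i 1 * gmat k z 1 j = (i == j)%:R.
  by have /matrixP/(_ i j) := mulVmx g0; rewrite mxE sum_ord2 [1%:M _ _]mxE.
pose C l := \sum_a \sum_b (pd dirs a (fun w => gmat k w b l) z + pd dirs b (fun w => gmat k w a l) z
   - pd dirs l (fun w => gmat k w a b) z) * vec2 v0 v1 0 a * vec2 v0 v1 0 b.
(* The geodesic equation with its index lowered. The inverse metric then enters only through [gV],
   and its entries are never computed. *)
have hC l : gmat k z l 0 * W 0 0 + gmat k z l 1 * W 0 1 = - 2^-1 * C l.
  have da := is_derive_rad_coef (s0 t); have db := is_derive_ang_coef (s0 t).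
  have zX : z 0 0 = X t by [].
  have zY : z 0 1 = Y t by [].
  have n0 : X t * X t + Y t * Y t != 0.
    have -> : X t * X t + Y t * Y t = 2 * s t by rewrite sE; field.
    by rewrite gt_eqF// mulr_gt0.
  have K1 : k (s t) != 0 by rewrite gt_eqF.
  rewrite /C; case: (ord2P l) => ->; rewrite !sum_ord2 !(pd_gmat _ _ _ z0 da db) !gmatE zs.
  - rewrite !perp_0 !perp_1 /dirs /W !vec2_0 !vec2_1 !mxE /= !zX !zY.
    rewrite /rad_coef /ang_coef /v0 /v1 /A /B -/(s t).
    move: (k (s t)) K1 (dk (s t)) (P t) (Q t) => K K1 D p q.
    rewrite sE; move: (X t) (Y t) n0 => x y n0.
    by field; rewrite K1 n0.
  - rewrite !perp_0 !perp_1 /dirs /W !vec2_0 !vec2_1 !mxE /= !zX !zY.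
    rewrite /rad_coef /ang_coef /v0 /v1 /A /B -/(s t).
    move: (k (s t)) K1 (dk (s t)) (P t) (Q t) => K K1 D p q.
    rewrite sE; move: (X t) (Y t) n0 => x y n0.
    by field; rewrite K1 n0.
move=> i.
pose D a b l := pd dirs a (fun w => gmat k w b l) z + pd dirs b (fun w => gmat k w a l) z
   - pd dirs l (fun w => gmat k w a b) z.
pose I l := invmx (gmat k z) i l.
have chrE a b : @christoffel R 1 M tt z i a b = 2^-1 * (I 0 * D a b 0 + I 1 * D a b 1).
  by rewrite /christoffel sum_ord2 mulrDr.
have sumE : \sum_a \sum_b @christoffel R 1 M tt z i a b * vec2 v0 v1 0 a * vec2 v0 v1 0 b =
    I 0 * (2^-1 * C 0) + I 1 * (2^-1 * C 1).
  have CE l : C l = \sum_a \sum_b D a b l * vec2 v0 v1 0 a * vec2 v0 v1 0 b by [].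
  under eq_bigr do under eq_bigr do rewrite chrE.
  rewrite !CE; move: (vec2 v0 v1) D I {chrE CE} => v D I.
  by rewrite !sum_ord2; ring.
have e l : 2^-1 * C l = - (gmat k z l 0 * W 0 0 + gmat k z l 1 * W 0 1).
  by rewrite hC mulNr opprK.
have g1 : I 0 * gmat k z 0 0 + I 1 * gmat k z 1 0 = (i == 0)%:R := gV i 0.
have g2 : I 0 * gmat k z 0 1 + I 1 * gmat k z 1 1 = (i == 1)%:R := gV i 1.
have WE : W 0 i = (i == 0)%:R * W 0 0 + (i == 1)%:R * W 0 1.
  by case: (ord2P i) => ->; rewrite /= ?mul1r ?mul0r ?addr0 ?add0r.
apply: etrans (_ : W 0 i + \sum_a \sum_b @christoffel R 1 M tt z i a b * vec2 v0 v1 0 a * vec2 v0 v1 0 b = 0).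
  by [].
have fin (i0 i1 a1 a2 a3 a4 w0 w1 : R) : (i0 * a1 + i1 * a3) * w0 + (i0 * a2 + i1 * a4) * w1
    + (i0 * - (a1 * w0 + a2 * w1) + i1 * - (a3 * w0 + a4 * w1)) = 0 by ring.
rewrite (etrans sumE (congr2 (fun a b => I 0 * a + I 1 * b) (e 0) (e 1))).
by rewrite WE -g1 -g2 fin.
Qed.

(* [ln s] is used as a coordinate: t = Phi (ln s) is the arclength of the
   meridians. *)
Lemma meridian_arclength (P dP : R -> R) :
  (forall s : R, 0 < s -> is_derive s 1 P (dP s) /\ k s * `|dP s| <= 1) ->
  (forall B : R, exists2 s : R, 0 < s <= 1 & P s <= B) ->
  (forall B : R, exists2 s : R, 1 <= s & B <= P s) ->
  exists Psi : R -> R,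
    (forall t : R, is_derive t 1 Psi (k (expR (Psi t)) / expR (Psi t))) /\
    (forall x, exists t, Psi t = x).
Proof.
move=> hP P_lo P_hi.
pose g (x : R) := expR x / k (expR x).
have e0 (x : R) := expR_gt0 x.
have g0 x : 0 < g x by rewrite divr_gt0 ?k_gt0.
have de (x : R) : is_derive x 1 expR (expR x) by exact: is_derive_expR.
have dg (x : R) : exists d, is_derive x 1 g d.
  have n0 : k (expR x) != 0 by rewrite gt_eqF ?k_gt0.
  have dke := @is_derive1_comp _ k expR x _ _ (is_derive_k (e0 x)) (de x).
  by eexists; exact: is_derive_mul (de x) (@is_derive_inv _ (fun x => k (expR x)) x _ n0 dke).
have cg : continuous g by move=> x; have [d] := dg x; exact: is_derive_continuous.
pose Phi := prim g.
have dPhi x := is_derive_prim x cg.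
have Phi0 : Phi 0 = 0 by exact: prim0.
have cPhi : continuous Phi by move=> x; exact: is_derive_continuous (dPhi x).
have Phi_lt x y : x < y -> Phi x < Phi y.
  by move=> xy; apply: (@derive_gt0_lt _ Phi g x y xy) => z _; exact: g0.
(* The bound [k |dP| <= 1] says that [P] along [expR] has derivative at most [Phi']. Hence [Phi]
   inherits the divergence of [P] at both ends and is a bijection of [R]. *)
have Phi_P x : (0 <= x -> P (expR x) - P 1 <= Phi x) /\ (x <= 0 -> Phi x <= P (expR x) - P 1).
  have dPe (y : R) : is_derive y 1 (fun y => P (expR y)) (dP (expR y) * expR y).
    exact: (@is_derive1_comp _ P expR y _ _ (hP _ (e0 y)).1 (de y)).
  have dd (y : R) : is_derive y 1 (fun y => Phi y - P (expR y)) (g y - dP (expR y) * expR y).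
    exact: is_derive_sub (dPhi y) (dPe y).
  have dd0 y : 0 <= g y - dP (expR y) * expR y.
    have [_ h] := hP _ (e0 y); rewrite subr_ge0 /g mulrC ler_pM2l//.
    apply: le_trans (ler_norm _) _.
    by rewrite -[X in _ <= X]mul1r ler_pdivlMr ?k_gt0// mulrC.
  split=> x0.
    have := @derive_ge0_le _ (fun y => Phi y - P (expR y)) _ 0 x x0 (fun y _ => dd y) (fun y _ => dd0 y).
    by rewrite Phi0 expR0; lra.
  have := @derive_ge0_le _ (fun y => Phi y - P (expR y)) _ x 0 x0 (fun y _ => dd y) (fun y _ => dd0 y).
  by rewrite Phi0 expR0; lra.
have Phi_hi B : exists x, B <= Phi x.
  have [s s1 hs] := P_hi (B + P 1); have s0 := lt_le_trans ltr01 s1.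
  have [h _] := Phi_P (ln s); exists (ln s).
  by have := h (ln_ge0 s1); rewrite lnK ?posrE//; lra.
have Phi_lo B : exists x, Phi x <= B.
  have [s /andP[s0 s1] hs] := P_lo (B + P 1).
  have [_ h] := Phi_P (ln s); exists (ln s).
  by have := h (ln_le0 s1); rewrite lnK ?posrE//; lra.
have Phi_surj t : exists x, Phi x = t.
  have [a ha] := Phi_lo t; have [b hb] := Phi_hi t.
  have ab : a <= b.
    rewrite leNgt; apply/negP => /Phi_lt; lra.
  have [||x _ hx] := @IVT _ Phi a b t ab; last by exists x.
    exact: continuous_subspaceT.
  by rewrite ge_min le_max ha hb orbT.
have [Psi hPsi] := choice Phi_surj.
have PsiK x : Psi (Phi x) = x.
  by have [/Phi_lt|/Phi_lt|//] := ltgtP (Psi (Phi x)) x; rewrite hPsi ltxx.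
exists Psi; split; last by move=> x; exists (Phi x).
move=> t; have := @is_derive_inverse _ Phi Psi (g (Psi t)) (Psi t).
rewrite hPsi /g invf_div; apply.
- by near=> x; exact: PsiK.
- by near=> x; exact: cPhi.
- by rewrite gt_eqF// divr_gt0 ?k_gt0.
Unshelve. all: by end_near. Qed.

Lemma bounded_on_segment (f : R -> R) : continuous f ->
  forall T : R, exists2 L, 0 <= L & forall x, `|x| <= T -> `|f x| <= L.
Proof.
move=> cf T; have [T0|T0] := leP 0 T; last first.
  by exists 0 => // x xT; have := le_lt_trans xT T0; rewrite normr_lt0.
have cf' : continuous (fun x => `|f x|).
  by move=> x; apply: continuous_comp; [exact: cf|exact: norm_continuous].
have [c _ hc] := @EVT_max _ (fun x => `|f x|) (- T) T ltac:(lra)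
   ltac:(exact: continuous_subspaceT).
exists `|f c| => // x; rewrite ler_norml => h; apply: hc.
by rewrite in_itv.
Qed.

(** In the orthonormal frame the speed is constant, so the velocity is the initial one turned by an
    angle [b]. With [T] the arclength coordinate of the meridians, the equations become [T' = fQ b]
    and [b' = k' (S T) fP b]. The right-hand side of the first is bounded, as [picard] asks, so the
    solution is global; the polar angle is then a primitive of [P1 / k]. *)
Lemma radial_complete (P dP : R -> R) :
  (forall s : R, 0 < s -> is_derive s 1 P (dP s) /\ k s * `|dP s| <= 1) ->
  (forall B : R, exists2 s : R, 0 < s <= 1 & P s <= B) ->
  (forall B : R, exists2 s : R, 1 <= s & B <= P s) ->
  geodesically_complete M.
Proof.
move=> hP P_lo P_hi; have [Psi [dPsi Psi_surj]] := meridian_arclength hP P_lo P_hi.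
move=> x v.
pose x0 := pval x 0 0; pose y0 := pval x 0 1; pose s0 := radius2 x.
have s0_gt0 : 0 < s0 by exact: radius2_gt0.
have k0 := k_gt0 s0_gt0.
pose S t := expR (Psi t).
have S0 t : 0 < S t by exact: expR_gt0.
have dS (t : R) : is_derive t 1 S (k (S t)).
  apply: is_derive_eq (is_derive_exp (dPsi t)) _.
  by rewrite -/(S t); field; rewrite gt_eqF.
have [t0 ht0] := Psi_surj (ln s0).
have St0 : S t0 = s0 by rewrite /S ht0 lnK.
(* initial velocity in the orthonormal frame *)
pose P0 := k s0 / (2 * s0) * dot (perp (pval x)) v.
pose Q0 := dot (pval x) v / k s0.
pose c t := dk (S t).
have dkd := smooth1_derive1 k_smooth; have ddkd := smooth1_derive1 dkd.
have dc (t : R) : is_derive t 1 c (derive1 dk (S t) * k (S t)).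
  exact: (@is_derive1_comp _ dk S t _ _ (smooth1_is_derive dkd (S0 t)) (dS t)).
have cc : continuous c by move=> t; exact: is_derive_continuous (dc t).
have cdc : continuous (fun t => derive1 dk (S t) * k (S t)).
  move=> t; have d1 := @is_derive1_comp _ _ S t _ _ (smooth1_is_derive ddkd (S0 t)) (dS t).
  have d2 := @is_derive1_comp _ _ S t _ _ (is_derive_k (S0 t)) (dS t).
  exact: is_derive_continuous (is_derive_mul d1 d2).
have dsin (f : R -> R) (t a : R) : is_derive t 1 f a -> is_derive t 1 (fun t => sin (f t)) (cos (f t) * a).
  by move=> df; exact: (@is_derive1_comp _ sin f t _ _ (is_derive_sin _) df).
have dcos (f : R -> R) (t a : R) : is_derive t 1 f a -> is_derive t 1 (fun t => cos (f t)) (- sin (f t) * a).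
  by move=> df; exact: (@is_derive1_comp _ cos f t _ _ (is_derive_cos _) df).
pose fQ (b : R) := P0 * sin b + Q0 * cos b; pose fP (b : R) := P0 * cos b - Q0 * sin b.
pose A := `|P0| + `|Q0|.
have A0 : 0 <= A by rewrite addr_ge0.
have sc1 (b : R) : `|sin b| <= 1 /\ `|cos b| <= 1.
  by rewrite !ler_norml sin_geN1 sin_le1 cos_geN1 cos_le1.
have fQA b : `|fQ b| <= A.
  apply: le_trans (ler_normD _ _) _; have [h1 h2] := sc1 b.
  by apply: lerD; rewrite normrM ler_piMr.
have fPA b : `|fP b| <= A.
  apply: le_trans (ler_normB _ _) _; have [h1 h2] := sc1 b.
  by apply: lerD; rewrite normrM ler_piMr.
have dfQ (b : R) : is_derive b 1 fQ (fP b).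
  apply: is_derive_eq (is_derive_add (is_derive_mulc P0 (dsin _ _ _ (is_derive_self b)))
    (is_derive_mulc Q0 (dcos _ _ _ (is_derive_self b)))) _.
  by rewrite /fP; ring.
have dfP (b : R) : is_derive b 1 fP (- fQ b).
  apply: is_derive_eq (is_derive_sub (is_derive_mulc P0 (dcos _ _ _ (is_derive_self b)))
    (is_derive_mulc Q0 (dsin _ _ _ (is_derive_self b)))) _.
  by rewrite /fQ; ring.
have lQ b b' : `|fQ b - fQ b'| <= A * `|b - b'|.
  by apply: mvt_abs => y _; split; [exact: dfQ|exact: fPA].
have lP b b' : `|fP b - fP b'| <= A * `|b - b'|.
  by apply: mvt_abs => y _; split; [exact: dfP|rewrite normrN; exact: fQA].
have [T [b [T0 b0 dT db]]] : exists T b : R -> R, [/\ T 0 = t0, b 0 = 0,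
    forall t : R, is_derive t 1 T (fQ (b t)) & forall t : R, is_derive t 1 b (c (T t) * fP (b t))].
  apply: (@picard _ (fun _ b => fQ b) (fun x b => c x * fP b) A t0 A0) => //.
  (* [L1] bounds [c] and [L2] its derivative on the segment, while [fP] and [fQ] are bounded by [A]
     and Lipschitz with constant [A]. *)
  move=> T; have [L1 L10 hL1] := bounded_on_segment cc T.
  have [L2 L20 hL2] := bounded_on_segment cdc T.
  exists ((1 + L1 + L2) * A) => y b yT; split.
    rewrite normrM; apply: ler_pM => //; apply: le_trans (hL1 _ yT) _; lra.
  move=> y' b' y'T; split.
    apply: le_trans (lQ _ _) _; rewrite [_ * A]mulrC -mulrA ler_wpM2l//.
    rewrite mulrDl mulrDl mul1r.
    have := mulr_ge0 L10 (addr_ge0 (normr_ge0 (y - y')) (normr_ge0 (b - b'))).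
    have := mulr_ge0 L20 (addr_ge0 (normr_ge0 (y - y')) (normr_ge0 (b - b'))).
    have := normr_ge0 (y - y'); lra.
  have -> : c y * fP b - c y' * fP b' = (c y - c y') * fP b + c y' * (fP b - fP b') by ring.
  have h1 : `|c y - c y'| <= L2 * `|y - y'|.
    apply: mvt_abs => w hw; split; [exact: dc|apply: hL2].
    move: yT y'T hw; rewrite !ler_norml; case: (leP y y') => _ /andP[? ?] /andP[? ?] /andP[? ?]; lra.
  apply: le_trans (ler_normD _ _) _; rewrite !normrM.
  apply: le_trans (_ : L2 * `|y - y'| * A + L1 * (A * `|b - b'|) <= _).
    by apply: lerD; apply: ler_pM => //; exact: hL1.
  have -> : L2 * `|y - y'| * A + L1 * (A * `|b - b'|) = (L2 * `|y - y'| + L1 * `|b - b'|) * A by ring.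
  have -> : (1 + L1 + L2) * A * (`|y - y'| + `|b - b'|) = ((1 + L1 + L2) * (`|y - y'| + `|b - b'|)) * A by ring.
  rewrite ler_wpM2r//.
  have p1 := mulr_ge0 L10 (normr_ge0 (y - y')); have p2 := mulr_ge0 L20 (normr_ge0 (b - b')).
  have -> : (1 + L1 + L2) * (`|y - y'| + `|b - b'|) = `|y - y'| + `|b - b'| + L1 * `|y - y'|
     + L1 * `|b - b'| + L2 * `|y - y'| + L2 * `|b - b'| by ring.
  have := normr_ge0 (y - y'); have := normr_ge0 (b - b'); lra.
pose P1 t := fP (b t); pose Q1 t := fQ (b t).
have dP1 (t : R) : is_derive t 1 P1 (- (dk (S (T t)) * P1 t * Q1 t)).
  apply: is_derive_eq (@is_derive1_comp _ fP b t _ _ (dfP _) (db t)) _.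
  by rewrite /P1 /Q1 /c; ring.
have dQ1 (t : R) : is_derive t 1 Q1 (dk (S (T t)) * P1 t ^+ 2).
  apply: is_derive_eq (@is_derive1_comp _ fQ b t _ _ (dfQ _) (db t)) _.
  by rewrite /P1 /Q1 /c; ring.
have dsig (t : R) : is_derive t 1 (fun t => S (T t)) (k (S (T t)) * Q1 t).
  exact: (@is_derive1_comp _ S T t _ _ (dS _) (dT t)).
have dks (t : R) := @is_derive1_comp _ k (fun t => S (T t)) t _ _ (is_derive_k (S0 _)) (dsig t).
have kS0 t : k (S (T t)) != 0 by rewrite gt_eqF// k_gt0.
pose w t := P1 t / k (S (T t)).
have cw : continuous w.
  move=> t; apply: (is_derive_continuous (is_derive_mul (dP1 t)
    (@is_derive_inv _ (fun t => k (S (T t))) t _ (kS0 t) (dks t)))).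
pose Th := prim w; have dTh t := is_derive_prim t cw; have Th0 : Th 0 = 0 := prim0 cw.
(* This is the square root of [S (T t) / s0]. Since [s] is half the squared norm, the curve is the
   initial point turned by [Th] and scaled by [lam]. *)
pose lam t := expR ((Psi (T t) - ln s0) / 2).
have dPT (t : R) : is_derive t 1 (fun t => Psi (T t)) (k (S (T t)) / S (T t) * Q1 t).
  exact: (@is_derive1_comp _ Psi T t _ _ (dPsi _) (dT t)).
have dlam (t : R) : is_derive t 1 lam (lam t * (k (S (T t)) * Q1 t / (2 * S (T t)))).
  apply: is_derive_eq (is_derive_exp (is_derive_mul (is_derive_sub (dPT t) (is_derive_const (ln s0) t)) (is_derive_const 2^-1 t))) _.
  by rewrite -/(lam t); field; rewrite gt_eqF.
pose Z0 t := lam t * (x0 * cos (Th t) - y0 * sin (Th t)).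
pose Z1 t := lam t * (x0 * sin (Th t) + y0 * cos (Th t)).
have sqZ t : sq (vec2 (Z0 t) (Z1 t)) = S (T t).
  have -> : sq (vec2 (Z0 t) (Z1 t)) = lam t ^+ 2 * (s0 * (cos (Th t) ^+ 2 + sin (Th t) ^+ 2)).
    by rewrite /s0 /radius2 /sq vec2_0 vec2_1 /Z0 /Z1 -/x0 -/y0; field.
  have -> : lam t ^+ 2 = expR (Psi (T t) - ln s0).
    by rewrite /lam -expRM_natl; congr expR; field.
  by rewrite cos2Dsin2 mulr1 expRB lnK ?posrE// divfK ?gt_eqF.
have Z_neq0 t : vec2 (Z0 t) (Z1 t) != 0.
  by apply/eqP => e; have := S0 (T t); rewrite -sqZ e /sq !mxE expr0n /= addr0 mul0r ltxx.
pose C t : M := pparam (vec2 (Z0 t) (Z1 t)).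
have CE t : pval (C t) = vec2 (Z0 t) (Z1 t) by exact: pparamK.
have rC t : radius2 (C t) = S (T t) by rewrite /radius2 CE sqZ.
have dZ0 (t : R) : is_derive t 1 Z0 (k (S (T t)) * Q1 t / (2 * S (T t)) * Z0 t - P1 t / k (S (T t)) * Z1 t).
  apply: is_derive_eq (is_derive_mul (dlam t) (is_derive_sub (is_derive_mulc x0 (dcos _ _ _ (dTh t)))
    (is_derive_mulc y0 (dsin _ _ _ (dTh t))))) _.
  by rewrite -/Th /Z0 /Z1 /w; ring.
have dZ1 (t : R) : is_derive t 1 Z1 (k (S (T t)) * Q1 t / (2 * S (T t)) * Z1 t + P1 t / k (S (T t)) * Z0 t).
  apply: is_derive_eq (is_derive_mul (dlam t) (is_derive_add (is_derive_mulc x0 (dsin _ _ _ (dTh t)))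
    (is_derive_mulc y0 (dcos _ _ _ (dTh t))))) _.
  by rewrite -/Th /Z0 /Z1 /w; ring.
have lam0 : lam 0 = 1 by rewrite /lam T0 ht0 subrr mul0r expR0.
have Z00 : Z0 0 = x0 by rewrite /Z0 lam0 Th0 cos0 sin0; ring.
have Z10 : Z1 0 = y0 by rewrite /Z1 lam0 Th0 cos0 sin0; ring.
exists C; split.
- apply: (@radial_geodesic C P1 Q1) => t.
  + rewrite [X in is_derive _ _ X _](_ : _ = Z0); last by apply/funext => u; rewrite CE vec2_0.
    by rewrite rC CE vec2_0 vec2_1.
  + rewrite [X in is_derive _ _ X _](_ : _ = Z1); last by apply/funext => u; rewrite CE vec2_1.
    by rewrite rC CE vec2_0 vec2_1.
  + by rewrite rC.
  + by rewrite rC.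
- by rewrite /C Z00 Z10 -vec2_eta pvalK.
- have CV : pval \o C = fun t => vec2 (Z0 t) (Z1 t) by apply/funext => t /=; rewrite CE.
  have [_ e] := is_derive_vec2 (dZ0 0) (dZ1 0).
  apply: etrans (_ : derive1 (pval \o C) 0 = v); first by [].
  rewrite CV e Z00 Z10 T0 St0 (vec2_eta v) /P1 /Q1 /fP /fQ b0 sin0 cos0.
  have n0 : x0 * x0 + y0 * y0 != 0.
    have -> : x0 * x0 + y0 * y0 = 2 * s0 by rewrite /s0 /radius2 /sq -/x0 -/y0; field.
    by rewrite gt_eqF// mulr_gt0.
  have K0 : k s0 != 0 by rewrite gt_eqF.
  rewrite /P0 /Q0 /dot perp_0 perp_1 -/x0 -/y0; move: (k s0) K0 => K K0.
  have -> : s0 = (x0 * x0 + y0 * y0) / 2 by rewrite /s0 /radius2 /sq -/x0 -/y0; field.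
  by congr vec2; field; rewrite n0 K0.
Qed.

End radial_geodesics.

(** * The Riemannian measure *)

Section plane_measure.
Context {R : realType}.
Local Notation plane := 'rV[R]_2.
Local Notation RR := (measurableTypeR R * measurableTypeR R)%type.
Local Notation leb := (@lebesgue_measure R).
Local Notation bplane := (g_sigma_algebraType (@open (@pplane R))).

Definition lebesgue2 : {measure set RR -> \bar R} := (leb \x leb)%E.

Definition pair_vec (p : RR) : plane := vec2 p.1 p.2.

Lemma measurable_qball (p : rat * rat * nat) : measurable (pair_vec @^-1` qball p).
Proof.
have -> : pair_vec @^-1` qball p =
    ball (ratr p.1.1 : R) (p.2.+1%:R^-1 : R) `*` ball (ratr p.1.2 : R) (p.2.+1%:R^-1 : R).
  apply/seteqP; split=> -[a b] /=.
    by move=> [_ h]; have := h 0 0; have := h 0 1; rewrite !vec2_0 !vec2_1.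
  move=> [h0 h1]; split; first by rewrite invr_gt0.
  by move=> i j; rewrite (ord1 i); case: (ord2P j) => ->; rewrite ?vec2_0 ?vec2_1.
by apply: measurableX; apply: measurable_realfun.open_measurable; exact: (@ball_open R R).
Qed.

Lemma measurable_plane_open (W : set plane) : open W -> measurable (pair_vec @^-1` W).
Proof.
move=> oW.
have -> : pair_vec @^-1` W = \bigcup_(p in [set p | qball p `<=` W]) (pair_vec @^-1` qball p).
  apply/seteqP; split=> [x Wx|x [p pW /pW//]].
  have [p px pW] := qball_basis (open_nbhs_nbhs (conj oW Wx)).
  by exists p.
rewrite bigcup_mkcond; apply: countable_bigcupT_measurable; first exact: countableP.
by move=> p; case: ifP => _ //; exact: measurable_qball.
Qed.

Definition chart_point (p : RR) : bplane := pparam (pair_vec p).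

Definition origin : set RR := [set (0, 0)].

Lemma pair_vec_eq0 p : (pair_vec p == 0) = (p == (0, 0)).
Proof.
by rewrite plane_eq0 vec2_0 vec2_1; case: p => a b; rewrite xpair_eqE.
Qed.

Lemma measurable_origin : measurable origin.
Proof.
have -> : origin = [set 0] `*` [set 0].
  by apply/seteqP; split=> [[a b] [-> ->]|[a b] [/= -> ->]].
by apply: measurableX; exact: measurable_set1.
Qed.

Lemma lebesgue2_origin : lebesgue2 origin = 0%E.
Proof.
have -> : origin = [set 0] `*` [set 0].
  by apply/seteqP; split=> [[a b] [-> ->]|[a b] [/= -> ->]].
apply: etrans (product_measure1E _ _ _ _) _; [exact: measurable_set1..|].
by rewrite [X in (X * _)%E](lebesgue_measure_set1 (0 : R)) mul0e.
Qed.

(** [pparam] is continuous off the origin only, so the preimage of an open set is that of an open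
    set of the plane up to the single point [(0, 0)]. *)
Lemma measurable_chart_point : measurable_fun setT chart_point.
Proof.
apply: (@measurability _ _ RR bplane setT chart_point (@open (@pplane R))) => // _ [A oA <-]; rewrite setTI.
have [W oW WA] := oA.
have h : chart_point @^-1` A `\` origin = (pair_vec @^-1` W) `\` origin.
  apply/seteqP; split=> p [/= hp p0]; split => //; rewrite -WA in hp *.
    by move: hp; rewrite /chart_point /= -/(pval _) pparamK// pair_vec_eq0; exact/eqP.
  by rewrite /chart_point /= -/(pval _) pparamK// pair_vec_eq0; exact/eqP.
rewrite -(setUIDK (chart_point @^-1` A) origin); apply: measurableU.
  have [A0|A0] := pselect (A (chart_point (0, 0))).
    rewrite (_ : _ `&` _ = origin); first exact: measurable_origin.
    by apply/seteqP; split=> [p []//|p ->]; split.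
  rewrite (_ : _ `&` _ = set0) //; apply/seteqP; split=> // p [/= + p0].
  by rewrite p0.
by rewrite h; apply: measurableD; [exact: measurable_plane_open|exact: measurable_origin].
Qed.

Definition chart_pushforward (A : set bplane) : \bar R := lebesgue2 (chart_point @^-1` A).

Lemma measurable_preimage_chart (A : set bplane) : measurable A ->
  measurable (chart_point @^-1` A).
Proof. by move=> mA; rewrite -[_ @^-1` _]setTI; exact: measurable_chart_point. Qed.

Let chart_pushforward0 : chart_pushforward set0 = 0%E.
Proof. by rewrite /chart_pushforward preimage_set0 measure0. Qed.

Let chart_pushforward_ge0 A : (0 <= chart_pushforward A)%E.
Proof. exact: measure_ge0. Qed.

Let chart_pushforward_sigma_additive : semi_sigma_additive chart_pushforward.
Proof.
move=> F mF tF mUF; rewrite /chart_pushforward preimage_bigcup.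
apply: (@measure_semi_sigma_additive _ _ _ lebesgue2 (fun i => chart_point @^-1` F i)).
- by move=> i; exact: measurable_preimage_chart.
- apply/trivIsetP => i j _ _ ij; rewrite -preimage_setI.
  by move/trivIsetP : tF => /(_ i j I I ij) ->; rewrite preimage_set0.
- by rewrite -preimage_bigcup; exact: measurable_preimage_chart.
Qed.

HB.instance Definition _ := isMeasure.Build _ _ _ chart_pushforward
  chart_pushforward0 chart_pushforward_ge0 chart_pushforward_sigma_additive.

(* A measure is only constrained on measurable sets; the value 0 elsewhere
   makes it unnecessary to know that geodesic balls are Borel sets. *)
Definition pmeasure (A : set bplane) : \bar R :=
  if `[< measurable A >] then chart_pushforward A else 0%E.

Lemma pmeasureE A : measurable A -> pmeasure A = lebesgue2 (chart_point @^-1` A).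
Proof. by move=> mA; rewrite /pmeasure asboolT. Qed.

Let pmeasure0 : pmeasure set0 = 0%E.
Proof. by rewrite pmeasureE// preimage_set0 measure0. Qed.

Let pmeasure_ge0 A : (0 <= pmeasure A)%E.
Proof. by rewrite /pmeasure; case: ifP. Qed.

Let pmeasure_sigma_additive : semi_sigma_additive pmeasure.
Proof.
move=> F mF tF mUF; rewrite pmeasureE//.
have -> : (fun n => \sum_(0 <= i < n) pmeasure (F i))%E =
          (fun n => \sum_(0 <= i < n) chart_pushforward (F i))%E.
  by apply/funext => n; apply: eq_bigr => i _; rewrite pmeasureE.
exact: chart_pushforward_sigma_additive.
Qed.

HB.instance Definition _ := isMeasure.Build _ _ _ pmeasure
  pmeasure0 pmeasure_ge0 pmeasure_sigma_additive.

Lemma pmeasure_le (A B : set bplane) : measurable B -> A `<=` B ->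
  (pmeasure A <= lebesgue2 (chart_point @^-1` B))%E.
Proof.
move=> mB AB; rewrite /pmeasure; case: asboolP => // mA.
rewrite /chart_pushforward le_measure ?inE//.
- exact: measurable_preimage_chart.
- exact: measurable_preimage_chart.
- by move=> p; exact: AB.
Qed.

Lemma pmeasure_integral (D : set bplane) (f : bplane -> \bar R) :
  (\int[pmeasure]_(x in D) f x = \int[chart_pushforward]_(x in D) f x)%E.
Proof. by apply: eq_measure_integral => A mA _; exact: pmeasureE. Qed.

Lemma ge0_integral_pmeasure (D : set bplane) (f : bplane -> \bar R) : measurable D ->
  @measurable_fun _ _ bplane _ D f -> (forall x, D x -> (0 <= f x)%E) ->
  (\int[pmeasure]_(x in D) f x = \int[lebesgue2]_(p in chart_point @^-1` D) f (chart_point p))%E.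
Proof.
move=> mD mf f0; rewrite pmeasure_integral.
apply: (ge0_integral_pushforward measurable_chart_point lebesgue2 mD mf).
by move=> x; rewrite inE; exact: f0.
Qed.

Lemma integral_pmeasure (D : set bplane) (f : bplane -> \bar R) : measurable D ->
  @measurable_fun _ _ bplane _ setT f ->
  lebesgue2.-integrable (chart_point @^-1` D) (f \o chart_point) ->
  (\int[pmeasure]_(x in D) f x = \int[lebesgue2]_(p in chart_point @^-1` D) f (chart_point p))%E.
Proof.
move=> mD mf intf; rewrite pmeasure_integral.
exact: (integral_pushforward measurable_chart_point mf intf mD).
Qed.

Lemma pmeasure_iterated (A : set bplane) : measurable A ->
  pmeasure A = integral_rV (fun z : plane => (\1_(pval @` A) z)%:E).
Proof.
move=> mA; rewrite pmeasureE//.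
pose B := chart_point @^-1` A `\` origin.
have mB : measurable B.
  by apply: measurableD; [exact: measurable_preimage_chart|exact: measurable_origin].
have -> : lebesgue2 (chart_point @^-1` A) = lebesgue2 B.
  rewrite -(setUIDK (chart_point @^-1` A) origin) measureU//.
  - rewrite [X in (X + _)%E](_ : _ = 0%E) ?add0e//.
    apply/eqP; rewrite eq_le measure_ge0 andbT -lebesgue2_origin.
    apply: le_measure; rewrite ?inE; [|exact: measurable_origin|by move=> ? []].
    by apply: measurableI; [exact: measurable_preimage_chart|exact: measurable_origin].
  - by apply: measurableI; [exact: measurable_preimage_chart|exact: measurable_origin].
  - by rewrite -subset0 => p [[_ +] [_]].
(* The product measure is the integral of the measures of the sections, so what remains is to
   compare the section of [B] at [t] with the inner integral of an indicator. *)
apply: eq_integral => t _.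
rewrite -[RHS]/(\int[leb]_t' (\1_(pval @` A) (row_mx t%:M (row_mx t'%:M 0) : plane))%:E)%E.
rewrite /= -[X in leb X = _]setIT -integral_indic//; last exact: measurable_xsection.
apply: eq_integral => t' _; rewrite !indicE; congr ((nat_of_bool _)%:R%:E).
have -> : row_mx t%:M (row_mx t'%:M 0) = vec2 t t'.
  apply/rowP => j; rewrite mxE; case: splitP => i ji.
    rewrite (_ : j = 0) ?vec2_0 ?mxE ?(ord1 i)//.
    by apply/val_inj; rewrite /= ji (ord1 i).
  rewrite (_ : j = 1) ?vec2_1 ?mxE; last by apply/val_inj; rewrite /= ji; case: i {ji} => -[].
  by case: splitP => i' _; rewrite ?mxE ?(ord1 i')//; case: i'.
apply/idP/idP.
  rewrite mem_xsection => /set_mem [At t0]; apply/mem_set.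
  exists (chart_point (t, t')) => //; rewrite /chart_point pparamK// pair_vec_eq0.
  by apply/eqP.
move=> /set_mem [x Ax xt]; rewrite mem_xsection; apply/mem_set; split.
  by rewrite /= /chart_point /pair_vec /= -xt pvalK.
by move/eqP; rewrite -pair_vec_eq0 /pair_vec /= -xt; apply/negP; exact: pval_neq0.
Qed.

End plane_measure.

(** * Integrals over the plane of functions that vanish outside a bounded set *)

Section plane_integrals.
Context {R : realType}.
Local Notation plane := 'rV[R]_2.
Local Notation RR := (measurableTypeR R * measurableTypeR R)%type.
Local Notation leb := (@lebesgue_measure R).
Local Notation bplane := (g_sigma_algebraType (@open (@pplane R))).
Implicit Types (g : plane -> R) (N : R).

Lemma measurable_continuous_plane g : continuous g ->
  @measurable_fun _ _ RR (measurableTypeR R) setT (g \o pair_vec).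
Proof.
move=> cg; apply: (measurability _ (RGenOpens.measurableE R)) => _ [_ [a [b ->]] <-]; rewrite setTI.
rewrite comp_preimage; apply: measurable_plane_open; apply: open_comp => [z _|]; [exact: cg|exact: interval_open].
Qed.

Lemma measurable_continuous_pplane (h : pplane -> R) : continuous h ->
  @measurable_fun _ _ bplane (measurableTypeR R) setT h.
Proof.
move=> ch; apply: (measurability _ (RGenOpens.measurableE R)) => _ [_ [a [b ->]] <-]; rewrite setTI.
by apply: sub_sigma_algebra; apply: open_comp => [z _|]; [exact: ch|exact: interval_open].
Qed.

Lemma plane_ball_compact N : compact [set z : plane | `|z| <= N].
Proof.
apply: bounded_closed_compact.
  by exists N; split=> [|x Nx y /= yN]; [exact: num_real|exact: le_trans yN (ltW Nx)].
by apply: (@closed_comp _ _ (fun z : plane => `|z|) [set x | x <= N]);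
  [move=> z _; exact: norm_continuous|exact: closed_le].
Qed.

Lemma compact_ge0_bound {T : topologicalType} (K : set T) (f : T -> R) :
  compact K -> {within K, continuous f} -> exists2 C, 0 <= C & forall x, K x -> `|f x| <= C.
Proof.
move=> cK cf; have [M [_ h]] := compact_bounded (continuous_compact cf cK).
exists (`|M| + 1) => [|x Kx]; first by rewrite addr_ge0.
by apply: h; [rewrite (le_lt_trans (ler_norm _))// ltrDl|exists x].
Qed.

Lemma compact_support_bound g N : continuous g -> (forall z, N < `|z| -> g z = 0) ->
  exists2 C, 0 <= C & forall z, `|g z| <= C.
Proof.
move=> cg g0.
have [C C0 h] := compact_ge0_bound (@plane_ball_compact N) (continuous_subspaceT cg).
by exists C => // z; have [/h//|/g0 ->] := leP `|z| N; rewrite normr0.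
Qed.

Definition square N : set RR := `[- N, N]%classic `*` `[- N, N]%classic.

Lemma measurable_square N : measurable (square N).
Proof. by apply: measurableX; exact: measurable_itv. Qed.

Lemma squareP N p : square N p <-> `|pair_vec p| <= N.
Proof.
case: p => a b; rewrite /square /= !in_itv /= -!ler_norml; split.
  by case=> ha hb; apply: plane_norm_le; rewrite ?vec2_0 ?vec2_1.
by move=> h; split; apply: le_trans h; [have := plane_coord_le (vec2 a b) 0|
  have := plane_coord_le (vec2 a b) 1]; rewrite ?vec2_0 ?vec2_1.
Qed.

Lemma lebesgue2_square N : 0 <= N -> lebesgue2 (square N) = ((2 * N) ^+ 2)%:E.
Proof.
move=> N0; apply: etrans (product_measure1E _ _ _ _) _; [exact: measurable_itv..|].
rewrite [X in (X * _)%E](lebesgue_measure_itv `[- N, N]).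
rewrite [X in (_ * X)%E](lebesgue_measure_itv `[- N, N]) /= lte_fin.
case: ltP => h; last first.
  have -> : N = 0 by lra.
  by rewrite mul0e mulr0 expr0n.
by rewrite -EFinB -EFinM; congr (_%:E); ring.
Qed.

Lemma bounded_support_integrable (f : RR -> R) N C : measurable_fun setT f ->
  (forall p, `|f p| <= C) -> (forall p, N < `|pair_vec p| -> f p = 0) ->
  lebesgue2.-integrable setT (EFin \o f).
Proof.
move=> mf fC f0.
have -> : EFin \o f = (EFin \o f) \_ (square `|N|).
  apply/funext => p; rewrite patchE; case: ifPn => // /negP pN /=.
  rewrite f0// (le_lt_trans (ler_norm N))// ltNge; apply/negP => h; apply: pN.
  by apply/mem_set/squareP.
apply/(integrable_mkcond _ (measurable_square `|N|)).
apply: measurable_bounded_integrable; first exact: measurable_square.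
- by rewrite lebesgue2_square ?ltry.
- exact: measurable_funTS.
- exists C; split=> [|x Cx y _]; [exact: num_real|exact: le_trans (fC _) (ltW Cx)].
Qed.

Lemma plane_integrable g N : continuous g -> (forall z, N < `|z| -> g z = 0) ->
  lebesgue2.-integrable setT (EFin \o (g \o pair_vec)).
Proof.
move=> cg g0; have [C _ gC] := compact_support_bound cg g0.
apply: (@bounded_support_integrable _ N C) => [|p|p]; [|exact: gC|exact: g0].
exact: measurable_continuous_plane.
Qed.

Lemma integral_derivative_eq0 (f f' : R -> R) N : (forall t : R, is_derive t 1 f (f' t)) ->
  continuous f' -> (forall t, N < `|t| -> f t = 0) -> (forall t, N < `|t| -> f' t = 0) ->
  (\int[leb]_t (f' t)%:E)%E = 0%E.
Proof.
(* [m] is positive and larger than [N], so that [[-m, m]] is a proper segment at whose ends [f]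
   vanishes. *)
move=> df cf' f0 f'0; pose m : R := `|N| + 1.
have mN (t : R) : m <= `|t| -> N < `|t|.
  by move=> h; rewrite (le_lt_trans (ler_norm N))// (lt_le_trans _ h)// ltrDl.
have m0 : 0 < m by rewrite ltr_wpDl.
have cf t : {for t, continuous f} by exact: is_derive_continuous.
have -> : (\int[leb]_t (f' t)%:E = \int[leb]_(t in `[(- m)%R, m]%classic) (f' t)%:E)%E.
  rewrite [RHS]integral_mkcond; apply: eq_integral => t _; rewrite patchE.
  case: ifPn => // /negP tm; rewrite f'0// mN//.
  rewrite leNgt; apply/negP => h; apply: tm; apply/mem_set.
  by rewrite /= in_itv /= -ler_norml ltW.
rewrite (@continuous_FTC2 _ f' f (- m) m).
- by rewrite !f0 ?mN ?normrN ?(gtr0_norm m0)//; exact: subee.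
- lra.
- exact: continuous_subspaceT.
- by split=> [t _||]; [exact: ex_derive|apply: cvg_at_right_filter; exact: cf|
    apply: cvg_at_left_filter; exact: cf].
- by move=> t _; rewrite derive1E; exact: derive_val.
Qed.

Lemma vec2_line (a b h : R) : (h *: dirs 0 + vec2 a b = vec2 (h + a) b :> plane) /\
  (h *: dirs 1 + vec2 a b = vec2 a (h + b) :> plane).
Proof.
by split; apply/rowP => j; case: (ord2P j) => ->; rewrite ?vec2_0 ?vec2_1;
  rewrite [LHS]mxE ?vec2_0 ?vec2_1 !mxE/= ?mulr1 ?mulr0 ?add0r.
Qed.

Lemma is_derive_pd g (z : plane) j : derivable g z (dirs j) ->
  forall (c : R -> plane) (t0 : R), c t0 = z -> (forall t, c t = (t - t0) *: dirs j + z) ->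
  is_derive t0 1 (g \o c) (pd dirs j g z).
Proof.
move=> dg c t0 ct ce.
have /is_derive_line h : is_derive z (dirs j) g (pd dirs j g z) by exact: DeriveDef.
have -> : g \o c = (fun h : R => g (h *: dirs j + z)) \o (fun t => t - t0).
  by apply/funext => t /=; rewrite ce.
rewrite -[pd _ _ _ _]mulr1; apply: is_derive_chain; first by rewrite subrr.
by change (is_derive t0 1 (fun t => t - t0) 1); apply: is_derive_eq (is_derive_sub (is_derive_self _) (is_derive_const _ _)) _; rewrite subr0.
Qed.

(** By Fubini, the variable that is differentiated is integrated first, and each inner integral
    vanishes by [integral_derivative_eq0]. *)
Lemma integral_pd_eq0 g N j : (forall z, derivable g z (dirs j)) ->
  continuous (pd dirs j g) ->
  (forall z, N < `|z| -> g z = 0) -> (forall z, N < `|z| -> pd dirs j g z = 0) ->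
  (\int[lebesgue2]_p (pd dirs j g (pair_vec p))%:E)%E = 0%E.
Proof.
move=> dg cg' g0 g'0.
have ig := plane_integrable cg' g'0.
have cvec2 (a b : R) : continuous (fun t => vec2 t b) /\ continuous (vec2 a).
  have e0 (f h : R -> R) : (fun t => vec2 (f t) (h t) 0 0) = f by apply/funext => t; rewrite vec2_0.
  have e1 (f h : R -> R) : (fun t => vec2 (f t) (h t) 0 1) = h by apply/funext => t; rewrite vec2_1.
  split=> t; apply: continuous_plane.
  - by rewrite (e0 id); exact: cvg_id.
  - by rewrite (e1 _ (cst b)); exact: cst_continuous.
  - by rewrite (e0 (cst a)); exact: cst_continuous.
  - by rewrite (e1 _ id); exact: cvg_id.
case: (ord2P j) => jE; subst j.
- rewrite -[LHS](integral21_prod_meas1 ig); apply: integral0_eq => b _.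
  apply: (@integral_derivative_eq0 (fun t => g (vec2 t b)) (fun t => pd dirs 0 g (vec2 t b)) N).
  + move=> t; apply: (is_derive_pd (dg (vec2 t b)) (c := fun t => vec2 t b)) => // t'.
    by rewrite (vec2_line _ _ _).1 subrK.
  + by move=> t; apply: continuous_comp; [exact: (cvec2 0 b).1|exact: cg'].
  + by move=> t Nt; apply: g0; apply: lt_le_trans Nt _; have := plane_coord_le (vec2 t b) 0; rewrite vec2_0.
  + by move=> t Nt; apply: g'0; apply: lt_le_trans Nt _; have := plane_coord_le (vec2 t b) 0; rewrite vec2_0.
- rewrite -[LHS](integral12_prod_meas1 ig); apply: integral0_eq => a _.
  apply: (@integral_derivative_eq0 (fun t => g (vec2 a t)) (fun t => pd dirs 1 g (vec2 a t)) N).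
  + move=> t; apply: (is_derive_pd (dg (vec2 a t)) (c := fun t => vec2 a t)) => // t'.
    by rewrite (vec2_line _ _ _).2 subrK.
  + by move=> t; apply: continuous_comp; [exact: (cvec2 a 0).2|exact: cg'].
  + by move=> t Nt; apply: g0; apply: lt_le_trans Nt _; have := plane_coord_le (vec2 a t) 1; rewrite vec2_1.
  + by move=> t Nt; apply: g'0; apply: lt_le_trans Nt _; have := plane_coord_le (vec2 a t) 1; rewrite vec2_1.
Qed.

End plane_integrals.

(** * Compact supports in the punctured plane and the divergence theorem *)

Section annulus.
Context {R : realType}.
Local Notation plane := 'rV[R]_2.
Local Notation RR := (measurableTypeR R * measurableTypeR R)%type.
Local Notation bplane := (g_sigma_algebraType (@open (@pplane R))).
Local Notation pmu := (@pmeasure R).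
Implicit Types (g f : plane -> R) (N e : R).

Lemma chart_ae (h : pplane -> R) g : (forall x, h x = g (pval x)) ->
  ae_eq lebesgue2 setT (fun p : RR => (h (chart_point p))%:E) (fun p => (g (pair_vec p))%:E).
Proof.
move=> hg; exists origin; split; [exact: measurable_origin|exact: lebesgue2_origin|].
move=> p /= np; apply: contrapT => p0; apply: np => _.
by rewrite hg /chart_point pparamK// pair_vec_eq0; apply/eqP.
Qed.

Lemma pplane_integral (h : pplane -> R) g N : (forall x, h x = g (pval x)) ->
  continuous g -> (forall z, N < `|z| -> g z = 0) ->
  pmu.-integrable setT (fun x : bplane => (h x)%:E) /\
  (\int[pmu]_x (h x)%:E = \int[lebesgue2]_p (g (pair_vec p))%:E)%E.
Proof.
move=> hg cg g0.
have ch : continuous h.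
  have -> : h = g \o pval by apply/funext => x; rewrite hg.
  by move=> x; apply: continuous_comp; [exact: pval_continuous|exact: cg].
have mh := measurable_continuous_pplane ch.
have ig := plane_integrable cg g0.
have mg := measurable_int _ ig.
have mhc : @measurable_fun _ _ RR _ setT (fun p : RR => (h (chart_point p))%:E).
  by apply/measurable_EFinP; apply: measurableT_comp mh _; exact: measurable_chart_point.
have ihc : lebesgue2.-integrable setT (fun p : RR => (h (chart_point p))%:E).
  apply/integrableP; split=> //.
  rewrite (@ae_eq_integral _ _ _ lebesgue2 setT (fun p => `|(g (pair_vec p))%:E|%E)) //.
  - by have /integrableP[] := ig.
  - exact: measurableT_comp.
  - exact: measurableT_comp.
  - by apply: ae_eq_abse; exact: chart_ae.
have e1 : (\int[pmu]_x (h x)%:E = \int[lebesgue2]_p (h (chart_point p))%:E)%E.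
  by rewrite (@integral_pmeasure _ setT (fun x => (h x)%:E))//; exact/measurable_EFinP.
split.
  apply/integrableP; split; first exact/measurable_EFinP.
  rewrite (@ge0_integral_pmeasure _ setT (fun x => `|(h x)%:E|%E))//.
    by have /integrableP[] := ihc.
  by apply: measurableT_comp => //; exact/measurable_EFinP.
by rewrite e1; apply: ae_eq_integral => //; exact: chart_ae.
Qed.

(** A compact subset of the punctured plane lies in such an annulus (for the sup norm). A smooth
    function supported there extends by 0 to a smooth function on the whole plane, which is how the
    puncture disappears from integrations by parts. *)
Definition annulus_supported e N f := forall z, z != 0 -> ~~ (e <= `|z| <= N) -> f z = 0.

Definition ext0 f z := if z == 0 then 0 else f z.

Lemma smooth_ext0 e N f : 0 < e -> annulus_supported e N f -> smooth_in dirs (@pU R) f ->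
  smooth_in dirs setT (ext0 f).
Proof.
move=> e0 f0 sf; apply: smooth_local => z _.
have [->|z0] := eqVneq z 0.
  exists (ball (0 : plane) e); first by split; [exact: ball_open|exact: ballxx].
  have ob : open (ball (0 : plane) e) by exact: ball_open.
  apply: (smooth_congr ob) (smooth_cst _ 0 ob).
  move=> w; rewrite -ball_normE /= sub0r normrN => we; rewrite /ext0; case: eqVneq => // w0.
  by rewrite f0// leNgt we.
exists (@pU R); first by split=> //; exact: open_pU.
by apply: smooth_congr open_pU _ sf => w w0; rewrite /ext0 (negbTE w0).
Qed.

Lemma ext0_support e N f z : annulus_supported e N f -> N < `|z| -> ext0 f z = 0.
Proof.
by move=> f0 Nz; rewrite /ext0; case: eqVneq => // z0; rewrite f0// [(`|z| <= N)]leNgt Nz andbF.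
Qed.

Lemma annulus_integrable e N f : 0 < e -> annulus_supported e N f ->
  smooth_in dirs (@pU R) f ->
  pmu.-integrable setT (fun x : bplane => (f (pval x))%:E).
Proof.
move=> e0 f0 sf; have sx := smooth_ext0 e0 f0 sf.
apply: (@pplane_integral (fun x => f (pval x)) (ext0 f) N _ _ _).1.
- by move=> x; rewrite /ext0 (negbTE (pval_neq0 x)).
- by move=> z; exact: smooth_continuous sx _.
- by move=> z; exact: (ext0_support f0).
Qed.

Lemma integral_divergence_eq0 e N (f : 'I_2 -> plane -> R) : 0 < e ->
  (forall j, annulus_supported e N (f j)) -> (forall j, smooth_in dirs (@pU R) (f j)) ->
  (\int[pmu]_x (\sum_j pd dirs j (f j) (pval x))%:E)%E = 0%E.
Proof.
move=> e0 f0 sf.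
have sx j := smooth_ext0 e0 (f0 j) (sf j).
have oN : open [set z : plane | N < `|z|].
  apply: (@open_comp _ _ (fun z : plane => `|z|) [set x | N < x]) => [z _|].
    exact: norm_continuous.
  exact: open_gt.
have c j : continuous (pd dirs j (ext0 (f j))).
  by move=> z; apply: smooth_continuous (smooth_pd _ (sx j)) _.
have z0 j z : N < `|z| -> pd dirs j (ext0 (f j)) z = 0.
  move=> Nz; rewrite (@pd_congr _ _ _ _ _ _ (cst 0) j z oN)//; first exact: derive_cst.
  by move=> w; exact: (ext0_support (f0 j)).
have eq_pd j x : pd dirs j (f j) (pval x) = pd dirs j (ext0 (f j)) (pval x).
  apply: (@pd_congr _ _ _ _ _ _ _ j _ open_pU); last exact: pval_neq0.
  by move=> w w0; rewrite /ext0 (negbTE w0).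
have H j := pplane_integral (eq_pd j) (c j) (z0 j).
under eq_integral => x _ do rewrite sum_ord2 EFinD.
rewrite (integralD measurableT (H 0).1 (H 1).1) (H 0).2 (H 1).2.
have I0 j : (\int[lebesgue2]_p (pd dirs j (ext0 (f j)) (pair_vec p))%:E)%E = 0%E.
  apply: (@integral_pd_eq0 _ _ N).
  - by move=> z; exact: (sx j [::] z I).2.
  - exact: c.
  - by move=> z; exact: (ext0_support (f0 j)).
  - exact: z0.
by rewrite !I0 adde0.
Qed.

Lemma compact_pplane_bounds (K : set (@pplane R)) : compact K ->
  exists e N, 0 < e /\ forall x, K x -> e <= `|pval x| <= N.
Proof.
move=> cK.
have cn : continuous (fun x : @pplane R => `|pval x|).
  by move=> x; apply: continuous_comp; [exact: pval_continuous|exact: norm_continuous].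
have ci : continuous (fun x : @pplane R => `|pval x|^-1).
  move=> x; have n0 : `|pval x| != 0 by rewrite normr_eq0 pval_neq0.
  by apply: (@continuous_comp _ _ _ (fun x => `|pval x|) (@GRing.inv R));
    [exact: cn|exact: inv_continuous].
have [N _ hN] := compact_ge0_bound cK (continuous_subspaceT cn).
have [C C0 hC] := compact_ge0_bound cK (continuous_subspaceT ci).
have C1 : 0 < C + 1 by rewrite ltr_wpDl.
exists (C + 1)^-1, N; rewrite invr_gt0; split=> // x Kx; apply/andP; split.
  have x0 : 0 < `|pval x| by rewrite normr_gt0 pval_neq0.
  rewrite -[leRHS]invrK lef_pV2 ?posrE ?invr_gt0//.
  by apply: le_trans (ler_norm _) (le_trans (hC x Kx) _); rewrite lerDl.
by apply: le_trans (ler_norm _) (hN x Kx).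
Qed.

Lemma compact_pval_preimage (C : set plane) : compact C -> ~ C 0 -> compact (pval @^-1` C).
Proof.
move=> cC C0.
have -> : pval @^-1` C = pparam @` C.
  apply/seteqP; split=> [x Cx|x [z Cz <-]]; first by exists (pval x) => //; exact: pvalK.
  by rewrite /= pparamK//; apply/eqP => z0; apply: C0; rewrite -z0.
apply: continuous_compact => //; apply/continuous_in_subspaceT => z /set_mem Cz.
by apply: pparam_continuous; apply/eqP => z0; apply: C0; rewrite -z0.
Qed.

End annulus.

(** * Fundamental lemma of the calculus of variations *)

Section fundamental_lemma.
Context {R : realType}.
Local Notation plane := 'rV[R]_2.
Local Notation bplane := (g_sigma_algebraType (@open (@pplane R))).
Local Notation pmu := (@pmeasure R).
Implicit Types (a b c d t : R) (z : plane).

(** The limit is 0 also at [t = 0], so products of such functions tend to the indicator of an open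
    box while staying between 0 and 1. *)
Lemma flat_cvg t : (fun n => flat 0%N (n.+1%:R * t)) @ \oo --> ((0 < t)%R%:R : R).
Proof.
have [t0|t0] := ltP 0 t; last first.
  rewrite (_ : (fun n => _) = cst 0); first exact: cvg_cst.
  apply/funext => n; rewrite /flat ifF//; apply/negbTE; rewrite -leNgt.
  by rewrite mulr_ge0_le0.
rewrite (_ : (fun n => _) = fun n => expR (- (@harmonic R n * t^-1))).
  rewrite -[X in _ --> X]expR0.
  apply: (@continuous_cvg _ _ _ _ _ (fun n => - (@harmonic R n * t^-1)) expR 0); first exact: continuous_expR.
  rewrite -oppr0 -(mul0r t^-1); apply: cvgN; apply: cvgMl; exact: cvg_harmonic.
apply/funext => n; rewrite /flat mulr_gt0// expr0 mulr1 invfM.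
by [].
Qed.

Lemma flat_le1 t : 0 <= flat 0%N t <= 1.
Proof.
rewrite flat_ge0 /flat; case: ifPn => /= t0; rewrite ?ler01// expr0 mulr1 -expR0 ler_expR.
by rewrite oppr_le0 invr_ge0 ltW.
Qed.

Definition rect a b c d : set plane := [set z | [/\ a <= z 0 0, z 0 0 <= b, c <= z 0 1 & z 0 1 <= d]].
Definition box a b c d : set (@pplane R) :=
  [set x | [/\ a < pval x 0 0, pval x 0 0 < b, c < pval x 0 1 & pval x 0 1 < d]].

Definition bump (n : nat) a b c d z : R :=
  flat 0%N (n.+1%:R * (z 0 0 - a)) * flat 0%N (n.+1%:R * (b - z 0 0)) *
  (flat 0%N (n.+1%:R * (z 0 1 - c)) * flat 0%N (n.+1%:R * (d - z 0 1))).

Lemma smooth_bump n a b c d : smooth_in dirs setT (bump n a b c d).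
Proof.
have oT : open [set: plane] by exact: openT.
have sc (x : R) i : smooth_in dirs setT (fun z : plane => flat 0%N (n.+1%:R * (z 0 i - x))).
  apply: (smooth_comp oT (J := setT)) => //; first exact: smooth1_flat.
  by apply: (smoothM oT); [exact: smooth_cst|apply: (smoothB oT); [exact: smooth_coord|exact: smooth_cst]].
have sc' (x : R) i : smooth_in dirs setT (fun z : plane => flat 0%N (n.+1%:R * (x - z 0 i))).
  apply: (smooth_comp oT (J := setT)) => //; first exact: smooth1_flat.
  by apply: (smoothM oT); [exact: smooth_cst|apply: (smoothB oT); [exact: smooth_cst|exact: smooth_coord]].
by apply: (smoothM oT); apply: (smoothM oT).
Qed.

Lemma bump_le1 n a b c d z : 0 <= bump n a b c d z <= 1.
Proof.
have h t := flat_le1 t.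
have m (x y : R) : 0 <= x <= 1 -> 0 <= y <= 1 -> 0 <= x * y <= 1.
  by move=> /andP[x0 x1] /andP[y0 y1]; rewrite mulr_ge0// mulr_ile1.
by apply: (m _ _ (m _ _ (h _) (h _)) (m _ _ (h _) (h _))).
Qed.

Lemma bump_cvg a b c d (x : @pplane R) :
  (fun n => bump n a b c d (pval x)) @ \oo --> (\1_(box a b c d) x : R).
Proof.
have -> : \1_(box a b c d) x = ((0 < pval x 0 0 - a)%R%:R * (0 < b - pval x 0 0)%R%:R *
   ((0 < pval x 0 1 - c)%R%:R * (0 < d - pval x 0 1)%R%:R) : R).
  rewrite !subr_gt0 -!natrM !mulnb indicE; congr (_ _)%:R.
  by apply/idP/idP => [/set_mem[-> -> -> ->]//|/andP[/andP[h1 h2] /andP[h3 h4]]]; apply/mem_set.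
by apply: cvgM; apply: cvgM; exact: flat_cvg.
Qed.

Lemma bump_eq0 n a b c d z : ~ rect a b c d z -> bump n a b c d z = 0.
Proof.
move=> h.
have f0 t : t <= 0 -> flat 0%N (n.+1%:R * t) = 0 :> R.
  by move=> t0; rewrite /flat ifF//; apply/negbTE; rewrite -leNgt mulr_ge0_le0.
rewrite /bump; have [h1|h1] := leP a (z 0 0); last by rewrite f0 ?mul0r// subr_le0 ltW.
have [h2|h2] := leP (z 0 0) b; last by rewrite [X in _ * X * _]f0 ?mulr0 ?mul0r// subr_le0 ltW.
have [h3|h3] := leP c (z 0 1); last by rewrite [X in _ * (X * _)]f0 ?mul0r ?mulr0// subr_le0 ltW.
have [h4|h4] := leP (z 0 1) d; last by rewrite [X in _ * (_ * X)]f0 ?mulr0// subr_le0 ltW.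
by case: h.
Qed.

Lemma rect_compact a b c d : compact (rect a b c d).
Proof.
have -> : rect a b c d = [set v : plane | forall i, [set` if i == 0 then `[a, b] else `[c, d]] (v ord0 i)].
  apply/seteqP; split=> z /=.
    by case=> h1 h2 h3 h4 i; case: (ord2P i) => -> /=; rewrite in_itv /= ?h1 ?h2 ?h3 ?h4.
  by move=> h; have := h 0; have := h 1; rewrite /= !in_itv /= => /andP[? ?] /andP[? ?].
apply: (@rV_compact _ _ (fun i : 'I_2 => [set` if i == 0 then `[a, b] else `[c, d]])).
by move=> i; case: ifP => _; exact: segment_compact.
Qed.

Lemma box_open a b c d : open (box a b c d).
Proof.
have cc i : continuous (fun x : @pplane R => pval x 0 i).
  move=> x; apply: (@continuous_comp _ _ _ (@pval R) (fun z : plane => z 0 i)).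
    exact: pval_continuous.
  exact: coord_continuous.
have -> : box a b c d = (((fun x : @pplane R => pval x 0 0) @^-1` [set t | a < t]) `&`
   ((fun x : @pplane R => pval x 0 0) @^-1` [set t | t < b])) `&`
  (((fun x : @pplane R => pval x 0 1) @^-1` [set t | c < t]) `&`
   ((fun x : @pplane R => pval x 0 1) @^-1` [set t | t < d])).
  by apply/seteqP; split=> [x []|x [[? ?] []]].
by do 2![apply: openI]; apply: open_comp => [x _|]; try exact: cc; [exact: open_gt|exact: open_lt|exact: open_gt|exact: open_lt].
Qed.

Lemma boxI a b c d a' b' c' d' : box a b c d `&` box a' b' c' d' =
  box (Num.max a a') (Num.min b b') (Num.max c c') (Num.min d d').
Proof.
apply/seteqP; split=> x; rewrite /box /= !gt_max !lt_min.
  by move=> [[-> -> -> ->] [-> -> -> ->]].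
by move=> [/andP[? ?] /andP[? ?] /andP[? ?] /andP[? ?]].
Qed.

Lemma pmeasurable_open (A : set bplane) : open (A : set (@pplane R)) -> measurable A.
Proof. exact: sub_sigma_algebra. Qed.

Lemma qball_box (p : rat * rat * nat) : pval @^-1` qball p =
  box (ratr p.1.1 - p.2.+1%:R^-1) (ratr p.1.1 + p.2.+1%:R^-1)
      (ratr p.1.2 - p.2.+1%:R^-1) (ratr p.1.2 + p.2.+1%:R^-1).
Proof.
apply/seteqP; split=> x; rewrite /box /= /qball -ball_normE /= => h.
  by move: h => /plane_norm_ltP[]; rewrite !planeBE vec2_0 vec2_1 !ltr_distlC => /andP[? ?] /andP[? ?].
move: h => [h1 h2 h3 h4]; apply/plane_norm_ltP; rewrite !planeBE vec2_0 vec2_1 !ltr_distlC.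
by rewrite h1 h2 h3 h4.
Qed.

Lemma open_qball_cover (A : set (@pplane R)) : open A ->
  A = \bigcup_(p in [set p : rat * rat * nat | pval @^-1` qball p `<=` A]) (pval @^-1` qball p).
Proof.
move=> oA; apply/seteqP; split=> [x Ax|x [p pA /pA//]].
have [B nB BA] := (nbhs_pplane x A).1 (open_nbhs_nbhs (conj oA Ax)).
by have [p px pB] := qball_basis nB; exists p => // y /pB; exact: BA.
Qed.

Variables (w : bplane -> R) (O : set (@pplane R)).
Hypothesis mw : measurable_fun setT w.
Hypothesis iw : forall C : set (@pplane R), compact C -> pmu.-integrable C (EFin \o w).
Hypothesis w0 : forall th : plane -> R, smooth_in dirs setT th ->
  forall C, compact C -> C `<=` O -> (forall x, ~ C x -> th (pval x) = 0) ->
  (\int[pmu]_x (th (pval x) * w x)%:E)%E = 0%E.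

(** Avoiding the origin makes the trace of the closed rectangle on the punctured plane compact, so
    that [iw] and [w0] apply to it. *)
Let good a b c d := ~ rect a b c d 0 /\ pval @^-1` rect a b c d `<=` O.

(** The bumps converge to the indicator of the box and are bounded by 1; dominated convergence
    applies with [|w|], integrable on the closed rectangle. *)
Lemma integral_box_eq0 a b c d : good a b c d ->
  (\int[pmu]_(x in box a b c d) (w x)%:E)%E = 0%E.
Proof.
move=> [r0 rO]; pose C := pval @^-1` rect a b c d.
have cC : compact C by apply: compact_pval_preimage => //; exact: rect_compact.
have mC : measurable (C : set bplane).
  by rewrite -[C : set bplane]setCK; apply: measurableC; apply: pmeasurable_open;
    apply: closed_openC; apply: compact_closed cC; exact: pplane_hausdorff.
have boxC : box a b c d `<=` C by move=> x [] *; split; exact: ltW.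
have mb : measurable (box a b c d : set bplane) by apply: pmeasurable_open; exact: box_open.
pose f n (x : bplane) := (bump n a b c d (pval x) * w x)%:E.
have mf n : measurable_fun setT (f n).
  apply/measurable_EFinP; apply: measurable_funM mw => //.
  apply: measurable_continuous_pplane => x.
  apply: (@continuous_comp _ _ _ (@pval R) (bump n a b c d)); first exact: pval_continuous.
  exact: smooth_continuous (@smooth_bump n a b c d) _.
have If n : (\int[pmu]_(x in C) f n x)%E = 0%E.
  rewrite -(w0 (@smooth_bump n a b c d) cC rO) => [|x Cx]; last exact: bump_eq0.
  rewrite integral_mkcond; apply: eq_integral => x _; rewrite patchE; case: ifPn => // /negP xC.
  by rewrite bump_eq0 ?mul0r// => xr; apply: xC; apply/mem_set.
have m1 : measurable_fun setT (fun x : bplane => (\1_(box a b c d) x * w x)%:E).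
  by apply/measurable_EFinP; apply: measurable_funM mw => //; exact: measurable_indic.
have fc : {ae pmu, forall x, C x -> f ^~ x @ \oo --> (\1_(box a b c d) x * w x)%:E}.
  apply: aeW => x _; apply: (@cvg_comp _ _ _ (fun n => bump n a b c d (pval x) * w x) EFin).
    by apply: cvgMl; exact: bump_cvg.
  exact: cvg_id.
have fb : {ae pmu, forall x n, C x -> (`|f n x| <= `|(w x)%:E|)%E}.
  apply: aeW => x n _; rewrite /f lee_fin normrM ler_piMl//.
  by have /andP[h0 h1] := bump_le1 n a b c d (pval x); rewrite ger0_norm.
have [_ _ h] := @dominated_convergence _ _ _ pmu C mC f _ _ (fun n => measurable_funTS (mf n))
  (measurable_funTS m1) fc (integrable_abse (iw cC)) fb.
have {}h : (\int[pmu]_(x in C) (\1_(box a b c d) x * w x)%:E)%E = 0%E.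
  apply: cvg_unique h _ => //; rewrite (_ : (fun n => _) = cst 0%E); first exact: cvg_cst.
  by apply/funext => n; exact: If.
rewrite -h -[in LHS](setIidr boxC) integral_mkcondr; apply: eq_integral => x _.
by rewrite patchE indicE; case: ifP => _; rewrite ?mul1r ?mul0r.
Qed.

(** The boxes form a family stable under intersection that generates the Borel sets, and the sets on
    whose trace in the fixed good box [w] has integral 0 form a Dynkin system. *)
Lemma integral_measurable_eq0 a b c d (A : set bplane) : good a b c d -> measurable A ->
  (\int[pmu]_(x in A `&` (box a b c d : set bplane)) (w x)%:E)%E = 0%E.
Proof.
move=> gd mA; pose Q : set bplane := box a b c d.
have mb a' b' c' d' : measurable (box a' b' c' d' : set bplane).
  by apply: pmeasurable_open; exact: box_open.
have mQ : measurable Q by exact: mb.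
have Q0 : (\int[pmu]_(x in Q) (w x)%:E)%E = 0%E by exact: integral_box_eq0.
have iQ : pmu.-integrable Q (EFin \o w).
  have cC : compact (pval @^-1` rect a b c d).
    by apply: compact_pval_preimage gd.1; exact: rect_compact.
  apply: integrableS (iw cC) => //; last by move=> x [] *; split; exact: ltW.
  rewrite -[X in measurable X]setCK; apply: measurableC; apply: pmeasurable_open.
  by apply: closed_openC; apply: compact_closed cC; exact: pplane_hausdorff.
pose G : set (set bplane) := [set B | exists a b c d, B = box a b c d].
pose P (B : set bplane) := (\int[pmu]_(x in B `&` Q) (w x)%:E)%E = 0%E.
have GE : @measurable _ bplane = <<s G >>.
  apply/seteqP; split; last first.
    by apply: sub_sigma_algebra2 => _ [a1 [b1 [c1 [d1 ->]]]]; exact: box_open.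
  apply: smallest_sub; first exact: sigma_algebra_measurable (g_sigma_algebraType G).
  move=> A' oA; rewrite -[<<s G>>]/(@measurable _ (g_sigma_algebraType G)).
  rewrite (open_qball_cover oA) bigcup_mkcond.
  apply: countable_bigcupT_measurable; first exact: countableP.
  move=> p; case: ifP => _ //; rewrite qball_box.
  by apply: sub_sigma_algebra; do 4!eexists.
suff : forall B, <<s G >> B -> P B by apply; rewrite -GE.
apply: (dynkin_induction GE).
- by move=> _ _ [a1 [b1 [c1 [d1 ->]]]] [a2 [b2 [c2 [d2 ->]]]]; rewrite boxI; do 4!eexists.
- by rewrite /P setTI.
- move=> _ [a1 [b1 [c1 [d1 ->]]]]; rewrite /P boxI; apply: integral_box_eq0; split.
    apply: contra_not gd.1; rewrite /rect /= !ge_max !le_min.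
    by move=> [/andP[_ ->] /andP[_ ->] /andP[_ ->] /andP[_ ->]].
  move=> x; rewrite /rect /= !ge_max !le_min => -[/andP[_ h1] /andP[_ h2] /andP[_ h3] /andP[_ h4]].
  exact: gd.2.
- move=> S mS; rewrite /P => S0.
  have e : (\int[pmu]_(x in Q) (w x)%:E = \int[pmu]_(x in Q `&` S) (w x)%:E +
      \int[pmu]_(x in Q `\` S) (w x)%:E)%E.
    rewrite -integral_setU ?setUIDK//; first exact: measurableI.
    - exact: measurableD.
    - exact: measurable_int iQ.
    - by apply/disj_setPS => x [[_ ?] []].
  by move: e; rewrite Q0 [Q `&` S]setIC S0 add0e setDE setIC.
- move=> F mF tF F0; rewrite /P setI_bigcupl integral_bigcup.
  + by apply: eseries0 => i _ _; exact: F0.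
  + exact: trivIset_setIr.
  + by move=> i; exact: measurableI.
  + apply: integrableS iQ => //; last by move=> x [i _ []].
    by apply: bigcup_measurable => i _; exact: measurableI.
Qed.

(** Inside a good box all integrals of [w] over measurable sets vanish, so [w] does almost
    everywhere there. The good boxes given by rational balls are countably many and cover [O]. *)
Lemma ae_eq0_of_integral_bump : open O -> {ae pmu, forall x, O x -> w x = 0}.
Proof.
move=> oO; pose cen (p : rat * rat * nat) : plane := vec2 (ratr p.1.1) (ratr p.1.2).
pose rad (p : rat * rat * nat) : R := p.2.+1%:R^-1.
have r0 p : 0 < rad p by rewrite invr_gt0.
pose gd p := good (cen p 0 0 - rad p) (cen p 0 0 + rad p) (cen p 0 1 - rad p) (cen p 0 1 + rad p).
pose Nz p : set bplane := [set x | [/\ gd p, (pval @^-1` qball p) x & w x <> 0]].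
have nN p : pmu.-negligible (Nz p).
  have [g|ng] := pselect (gd p); last first.
    by apply: negligibleS (negligible_set0 _) => x [].
  have Q0 : ae_eq pmu (pval @^-1` qball p : set bplane) (EFin \o w) (cst 0%E).
    have e : pval @^-1` qball p = box (cen p 0 0 - rad p) (cen p 0 0 + rad p)
        (cen p 0 1 - rad p) (cen p 0 1 + rad p) by rewrite qball_box /cen vec2_0 vec2_1.
    rewrite e; apply: integral_ae_eq => //.
    - by apply: pmeasurable_open; exact: box_open.
    - have cC : compact (pval @^-1` rect (cen p 0 0 - rad p) (cen p 0 0 + rad p)
        (cen p 0 1 - rad p) (cen p 0 1 + rad p)).
        by apply: compact_pval_preimage g.1; exact: rect_compact.
      apply: integrableS (iw cC) => //.
      + rewrite -[X in measurable X]setCK; apply: measurableC; apply: pmeasurable_open.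
        by apply: closed_openC; apply: compact_closed cC; exact: pplane_hausdorff.
      + by apply: pmeasurable_open; exact: box_open.
      + by move=> x [] *; split; exact: ltW.
    - move=> E EQ mE; rewrite integral0 -(integral_measurable_eq0 g mE).
      by rewrite (setIidl EQ).
  apply: negligibleS Q0 => x [_ Qx wx] /= h; apply: wx.
  by have /= [] := h Qx.
pose F k : set bplane := if unpickle k is Some p then Nz p else set0.
have nF k : pmu.-negligible (F k).
  by rewrite /F; case: unpickle => [p|]; [exact: nN|exact: negligible_set0].
apply: negligibleS (negligible_bigcup nF) => x /= /not_implyP[Ox wx].
suff [p gp px] : exists2 p, gd p & qball p (pval x).
  have [k pk] : exists k, unpickle k = Some p by exists (pickle p); exact: pickleK.
  by exists k => //; rewrite /F pk.
have [B nB BO] := (nbhs_pplane x O).1 (open_nbhs_nbhs (conj oO Ox)).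
have nB0 : nbhs (pval x) (B `&` @pU R).
  by apply: filterI => //; apply: open_nbhs_nbhs; split; [exact: open_pU|exact: pval_neq0].
have [e e0 he] := (nbhs_ball_eq _ _).1 nB0.
have nb : nbhs (pval x) (ball (pval x) (e / 3)) by apply: nbhsx_ballx; rewrite divr_gt0.
have [p px pB] := qball_basis nb.
(* Membership in a rational ball controls the open box, whereas [good] concerns the closed one. The
   midpoint of [z] and the centre is in the open box, hence within [e / 3] of the point, like the
   centre; reflecting the centre through it puts [z] within [e]. *)
have hz z : rect (cen p 0 0 - rad p) (cen p 0 0 + rad p) (cen p 0 1 - rad p) (cen p 0 1 + rad p) z ->
    (B `&` @pU R) z.
  move=> [h1 h2 h3 h4]; apply: he.
  have : ball (pval x) (e / 3) (cen p + 2^-1 *: (z - cen p)).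
    apply: pB; rewrite /qball -ball_normE /= opprD addNKr normrN normrZ.
    have : `|z - cen p| <= rad p.
      by apply: plane_norm_le; rewrite planeBE ler_distl ?h1 ?h2 ?h3 ?h4.
    have := r0 p; rewrite -/(rad p) (@gtr0_norm _ 2^-1)//; set y := `|_|; move=> ? ?; lra.
  have : ball (pval x) (e / 3) (cen p) by apply: pB; exact: ballxx.
  rewrite -!ball_normE /= => a1 a2.
  have -> : pval x - z = 2 *: (pval x - (cen p + 2^-1 *: (z - cen p))) - (pval x - cen p).
    by apply/rowP => j; rewrite !mxE; field.
  apply: le_lt_trans (ler_normB _ _) _; rewrite normrZ (@gtr0_norm _ 2)//; lra.
exists p => //; split; first by move=> /hz[_]; rewrite /pU /= eqxx.
by move=> y /hz[By _]; exact: BO.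
Qed.

End fundamental_lemma.

(** * Radial weak solutions *)

Lemma powRD_gt0 {R : realType} (x a b : R) : 0 < x -> x `^ (a + b) = x `^ a * x `^ b.
Proof. by move=> x0; rewrite powRD//; apply/implyP => _; rewrite gt_eqF. Qed.

Lemma adde_eq0_opp {R : realType} (x y : \bar R) : x \is a fin_num -> y \is a fin_num ->
  (x + y = 0 -> x = - y)%E.
Proof. by case: x y => [a| |] [b| |] // _ _ [] /eqP; rewrite addr_eq0 => /eqP ->. Qed.

Lemma annulus_pd {R : realType} (e N : R) (f : 'rV[R]_2 -> R) j :
  annulus_supported e N f -> annulus_supported e N (pd dirs j f).
Proof.
move=> f0 z z0 hz.
have [oe oN] : open [set z : 'rV[R]_2 | `|z| < e] /\ open [set z : 'rV[R]_2 | N < `|z|].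
  by split; [apply: (@open_comp _ _ (fun z : 'rV[R]_2 => `|z|) [set x | x < e])
    |apply: (@open_comp _ _ (fun z : 'rV[R]_2 => `|z|) [set x | N < x])];
    try (by move=> w _; exact: norm_continuous); [exact: open_lt|exact: open_gt].
have oU : open (@pU R `&` ([set z | `|z| < e] `|` [set z | N < `|z|])).
  by apply: openI; [exact: open_pU|exact: openU].
rewrite (@pd_congr _ _ _ _ _ _ (cst 0) j z oU).
- exact: derive_cst.
- by move=> w [w0 hw]; apply: f0 => //; rewrite negb_and -!ltNge; apply/orP.
- by split=> //; move: hz; rewrite negb_and -!ltNge => /orP.
Qed.

Section radial_solution.
Context {R : realType}.
Local Notation plane := 'rV[R]_2.
Local Notation pos := [set x : R | 0 < x].
Local Notation bplane := (g_sigma_algebraType (@open (@pplane R))).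
Local Notation pmu := (@pmeasure R).
Variables (k u v F dF : R -> R) (m p q : R).
Hypothesis k_smooth : smooth1 pos k.
Hypothesis k_gt0 : forall s, 0 < s -> 0 < k s.
Hypothesis u_smooth : smooth1 pos u.
Hypothesis v_smooth : smooth1 pos v.
Hypothesis F_smooth : smooth1 pos F.
Hypothesis m_gt1 : 1 < m.
Hypothesis u_gt0 : forall s, 0 < s -> 0 < u s.
Hypothesis v_gt0 : forall s, 0 < s -> 0 < v s.
Hypothesis du : forall s : R, 0 < s -> is_derive s 1 u (- v s).
Hypothesis dFE : forall s : R, 0 < s -> is_derive s 1 F (dF s).
Hypothesis FE : forall s, 0 < s -> F s = k s `^ m * v s `^ (m - 1).
Hypothesis F_ineq : forall s, 0 < s -> u s `^ p * (k s * v s) `^ q <= dF s.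
Local Notation M := (radial_manifold k_smooth k_gt0).
Implicit Types (x : M) (w z : plane).

Lemma radial_riemannian_measure : @riemannian_measure R 1 M pmu.
Proof.
move=> i A mA _; rewrite [LHS](pmeasure_iterated mA); congr integral_rV; apply/funext => z.
change (\1_[set Defs.coord i x | x in A] z) with (\1_(pval @` A) z : R).
have [[x Ax xz]|nz] := pselect ((pval @` A) z); last first.
  by rewrite indicE memNset// mul0r.
by rewrite radial_vol_density ?mulr1// -xz; exact: pval_neq0.
Qed.

Definition sol x : R := u (radius2 x).
(** The field [d/ds] is [z / (2 s)]. The gradient of [u] is thus [k^2 u' d/ds], and [flux] is
    [- F d/ds], which [flux_grad] identifies with [|grad u|^(m-2) grad u]. *)
Definition grad x : plane := (- v (radius2 x) * k (radius2 x) ^+ 2 / (2 * radius2 x)) *: pval x.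
Definition flux x : plane := (- F (radius2 x) / (2 * radius2 x)) *: pval x.

Lemma inner_grad x w : inner x (grad x) w = - v (radius2 x) * dot (pval x) w.
Proof.
have s0 := radius2_gt0 x; have k0 := k_gt0 s0.
by rewrite inner_radial; field; rewrite !gt_eqF.
Qed.

Lemma inner_flux x w : inner x (flux x) w = - F (radius2 x) / k (radius2 x) ^+ 2 * dot (pval x) w.
Proof.
have s0 := radius2_gt0 x; have k0 := k_gt0 s0.
by rewrite inner_radial; field; rewrite !gt_eqF.
Qed.

Lemma tnorm_grad x : tnorm x (grad x) = k (radius2 x) * v (radius2 x).
Proof.
have s0 := radius2_gt0 x; have k0 := k_gt0 s0; have v0 := v_gt0 s0.
rewrite tnorm_radial mulNr mulNr normrN gtr0_norm; first by field; rewrite !gt_eqF.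
by rewrite !mulr_gt0// ?exprn_gt0// invr_gt0 mulr_gt0.
Qed.

Lemma flux_grad x w : tnorm x (grad x) `^ (m - 2) * inner x (grad x) w = inner x (flux x) w.
Proof.
have s0 := radius2_gt0 x; have k0 := k_gt0 s0; have v0 := v_gt0 s0.
rewrite tnorm_grad inner_grad inner_flux FE// powRM ?ltW//.
have -> : k (radius2 x) `^ m = k (radius2 x) `^ (m - 2) * k (radius2 x) ^+ 2.
  by rewrite -powR_mulrn ?ltW// -powRD_gt0// subrK.
have -> : v (radius2 x) `^ (m - 1) = v (radius2 x) `^ (m - 2) * v (radius2 x).
  rewrite -[X in _ * X]powRr1 ?ltW// -powRD_gt0//.
  by congr (_ `^ _); ring.
by field; rewrite gt_eqF.
Qed.

Lemma field_support (X : M -> plane) : compactly_supported X ->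
  exists e N, 0 < e /\ forall j, annulus_supported e N (field_on X j).
Proof.
move=> [K cK XK]; have [e [N [e0 h]]] := compact_pplane_bounds cK.
exists e, N; split=> // j z z0 hz; rewrite /field_on XK ?mxE// => Kz.
by have := h _ Kz; rewrite pparamK//; exact/negP.
Qed.

(** The divergence of [u X] has integral 0 and splits into the two integrands [f1] and [f2]. Each is
    smooth with support in an annulus, so the two integrals are finite and may be separated. *)
Lemma radial_weak_gradient : @weak_gradient R 1 M pmu sol grad.
Proof.
move=> X /radial_smooth_fieldE sX /field_support[e [N [e0 hX]]].
have oU := @open_pU R.
pose f1 z := u (sq z) * \sum_j pd dirs j (field_on X j) z.
pose f2 z := - v (sq z) * (z 0 0 * field_on X 0 z + z 0 1 * field_on X 1 z).
have su := smooth_radial u_smooth; have sv := smooth_radial v_smooth.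
have s1 : smooth_in dirs (@pU R) f1.
  apply: (smoothM oU su); apply: (@smooth_congr _ _ _ _ _ (fun z => pd dirs 0 (field_on X 0) z
    + pd dirs 1 (field_on X 1) z) _ oU).
    by move=> z _; rewrite sum_ord2.
  exact: (smoothD oU (smooth_pd 0 (sX 0)) (smooth_pd 1 (sX 1))).
have s2 : smooth_in dirs (@pU R) f2.
  exact: (smoothM oU (smoothN oU sv) (smoothD oU (smoothM oU (smooth_coord 0 oU) (sX 0))
    (smoothM oU (smooth_coord 1 oU) (sX 1)))).
have h2 : annulus_supported e N f2.
  by move=> z z0 hz; rewrite /f2 !hX// !mulr0 addr0 mulr0.
have h1 : annulus_supported e N f1.
  by move=> z z0 hz; rewrite /f1 sum_ord2 !(annulus_pd _ (hX _))// addr0 mulr0.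
have i1 := annulus_integrable e0 h1 s1.
have i2 := annulus_integrable e0 h2 s2.
have e2 x : inner x (grad x) (X x) = f2 (pval x).
  by rewrite inner_grad /f2 /field_on /dot pvalK.
have e1 x : sol x * divergence X x = f1 (pval x) by rewrite radial_divergenceE.
under eq_integral => x _ do rewrite e2.
under [in RHS]eq_integral => x _ do rewrite e1.
pose f j z := u (sq z) * field_on X j z.
have H : (\int[pmu]_x (\sum_j pd dirs j (f j) (pval x))%:E)%E = 0%E.
  apply: (@integral_divergence_eq0 _ e N f e0 _ (fun j => smoothM oU su (sX j))) => j z z0 hz.
  by rewrite /f hX// mulr0.
have ef x : \sum_j pd dirs j (f j) (pval x) = f2 (pval x) + f1 (pval x).
  have x0 := pval_neq0 x; have s0 := sq_gt0 x0.
  have pf j : pd dirs j (f j) (pval x) = u (sq (pval x)) * pd dirs j (field_on X j) (pval x) +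
      field_on X j (pval x) * (- v (sq (pval x)) * dot (pval x) (dirs j)).
    apply: derive_val; apply: is_derive_mulV; first exact: is_derive_radial (du s0).
    by apply: DeriveDef => //; exact: (sX j [::] _ x0).2.
  rewrite sum_ord2 !pf /f2 /f1 sum_ord2 /dot /dirs !mxE /=; ring.
have {}H : (\int[pmu]_x (f2 (pval x))%:E + \int[pmu]_x (f1 (pval x))%:E)%E = 0%E.
  rewrite -(integralD measurableT i2 i1) -H; apply: eq_integral => x _.
  by rewrite ef EFinD.
exact: adde_eq0_opp (integrable_fin_num measurableT i2) (integrable_fin_num measurableT i1) H.
Qed.

End radial_solution.

(** * Compact sets, local integrability and radial cutoffs *)

Section plane_tools.
Context {R : realType}.
Local Notation plane := 'rV[R]_2.
Local Notation bplane := (g_sigma_algebraType (@open (@pplane R))).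
Local Notation pmu := (@pmeasure R).
Local Notation pos := [set x : R | 0 < x].

Lemma smooth_pval_continuous (f : plane -> R) : smooth_in dirs (@pU R) f ->
  continuous (fun x : @pplane R => f (pval x)).
Proof.
move=> sf x; apply: (@continuous_comp _ _ _ (@pval R) f); first exact: pval_continuous.
exact: smooth_continuous sf (pval_neq0 x).
Qed.

Lemma compact_measurable_pplane (K : set (@pplane R)) : compact K -> measurable (K : set bplane).
Proof.
move=> cK; rewrite -[X in measurable X]setCK; apply: measurableC; apply: pmeasurable_open.
by apply: closed_openC; apply: compact_closed cK; exact: pplane_hausdorff.
Qed.

Lemma compact_pmeasure_lty (K : set (@pplane R)) : compact K -> (pmu K < +oo)%E.
Proof.
move=> cK; have [e [N [e0 hK]]] := compact_pplane_bounds cK.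
pose A : set (measurableTypeR R * measurableTypeR R) := square N `|` origin.
have mA : measurable A by apply: measurableU; [exact: measurable_square|exact: measurable_origin].
rewrite (pmeasureE (compact_measurable_pplane cK)).
apply: (@le_lt_trans _ _ (lebesgue2 A)).
  apply: le_measure; rewrite ?inE//.
    by apply: measurable_preimage_chart; exact: compact_measurable_pplane.
  move=> t Kt; have [t0|t0] := eqVneq t (0, 0); first by right.
  left; apply/squareP; have := hK _ Kt; rewrite /chart_point pparamK ?pair_vec_eq0//.
  by case/andP.
apply: le_lt_trans (measureU2 _ (measurable_square N) measurable_origin) _.
rewrite [X in (_ + X)%E](_ : _ = 0%E) ?adde0; last exact: lebesgue2_origin.
have [N0|N0] := leP 0 N; first by rewrite [X in (X < _)%E](lebesgue2_square N0) ltry.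
suff -> : square N = set0 by rewrite measure0.
rewrite -subset0 => t /squareP; apply/negP; rewrite -ltNge.
exact: lt_le_trans N0 _.
Qed.

Lemma continuous_compact_integral_lty (f : @pplane R -> R) (K : set (@pplane R)) :
  continuous f -> (forall x, 0 <= f x) -> compact K ->
  (\int[pmu]_(x in (K : set bplane)) (f x)%:E < +oo)%E.
Proof.
move=> cf f0 cK; have mK := compact_measurable_pplane cK.
have [C C0 hC] := compact_ge0_bound cK (continuous_subspaceT cf).
apply: (@le_lt_trans _ _ (C%:E * pmu K)%E).
  rewrite -integral_cst//; apply: ge0_le_integral => //.
  - by move=> x _; rewrite lee_fin.
  - by apply/measurable_EFinP; apply: measurable_funTS; exact: measurable_continuous_pplane.
  - by move=> x Kx; rewrite lee_fin (le_trans (ler_norm _))// hC.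
by rewrite lte_mul_pinfty// ?lee_fin//; exact: compact_pmeasure_lty.
Qed.

Definition step (t : R) : R := flat 0%N t / (flat 0%N t + flat 0%N (1 - t)).

Lemma flat_gt0 (t : R) : 0 < t -> 0 < flat 0%N t.
Proof. by move=> t0; rewrite /flat t0 mulr_gt0 ?expR_gt0// expr0. Qed.

Lemma step_den_gt0 (t : R) : 0 < flat 0%N t + flat 0%N (1 - t).
Proof.
have [t0|t0] := ltP 0 t; first by rewrite ltr_pwDl ?flat_gt0 ?flat_ge0.
by rewrite ltr_wpDl ?flat_ge0// flat_gt0//; lra.
Qed.

Lemma step_eq1 (t : R) : 1 <= t -> step t = 1.
Proof.
move=> t1; rewrite /step [flat _ (1 - t)]/flat ifF; last by apply/negbTE; rewrite -leNgt; lra.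
by rewrite addr0 divff// gt_eqF// flat_gt0//; lra.
Qed.

Lemma step_eq0 (t : R) : t <= 0 -> step t = 0.
Proof. by move=> t0; rewrite /step /flat ifF ?mul0r//; apply/negbTE; rewrite -leNgt. Qed.

Lemma smooth1_step : smooth1 setT step.
Proof.
have oT : open [set: R] by exact: openT.
have s1 := @smooth1_flat R 0.
have s2 : smooth1 setT (fun t : R => flat 0%N (1 - t)).
  exact: (smooth_comp oT (fun _ _ => I) s1 (smoothB oT (smooth_cst _ 1 oT) (@smooth1_id R))).
apply: (smoothM oT s1 (smooth_inv oT _ (smoothD oT s1 s2))) => t _; exact: step_den_gt0.
Qed.

Definition cutoff (a b : R) (z : plane) : R := step (2 / a * sq z - 1) * step (2 - b^-1 * sq z).

Lemma smooth_cutoff a b : smooth_in dirs (@pU R) (cutoff a b).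
Proof.
have oU := @open_pU R; have ssq := smooth_sq oU.
have s1 : smooth_in dirs (@pU R) (fun z => step (2 / a * sq z - 1)).
  exact: (smooth_comp oU (fun _ _ => I) smooth1_step
    (smoothB oU (smoothM oU (smooth_cst _ (2 / a) oU) ssq) (smooth_cst _ 1 oU))).
have s2 : smooth_in dirs (@pU R) (fun z => step (2 - b^-1 * sq z)).
  exact: (smooth_comp oU (fun _ _ => I) smooth1_step
    (smoothB oU (smooth_cst _ 2 oU) (smoothM oU (smooth_cst _ b^-1 oU) ssq))).
exact: (smoothM oU s1 s2).
Qed.

Lemma cutoff_eq1 a b z : 0 < a -> 0 < b -> a <= sq z -> sq z <= b -> cutoff a b z = 1.
Proof.
move=> a0 b0 az zb.
have h1 : 1 <= sq z / a by rewrite ler_pdivlMr// mul1r.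
have h2 : sq z / b <= 1 by rewrite ler_pdivrMr// mul1r.
by rewrite /cutoff !step_eq1 ?mulr1// 1?mulrAC -1?mulrA ?[b^-1 * _]mulrC; lra.
Qed.

Lemma cutoff_eq0 a b z : 0 < a -> 0 < b -> ~~ (a / 2 <= sq z <= 2 * b) -> cutoff a b z = 0.
Proof.
move=> a0 b0; rewrite negb_and -!ltNge /cutoff => /orP[h|h].
  have h1 : sq z / a < 1 / 2 by rewrite ltr_pdivrMr//; lra.
  by rewrite step_eq0 ?mul0r// mulrAC -mulrA; lra.
have h1 : 2 < sq z / b by rewrite ltr_pdivlMr.
by rewrite [X in _ * X]step_eq0 ?mulr0// [b^-1 * _]mulrC; lra.
Qed.

Lemma shell_compact (a b : R) : 0 < a -> compact [set x : @pplane R | a <= sq (pval x) <= b].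
Proof.
move=> a0; apply: (@compact_pval_preimage _ [set z : plane | a <= sq z <= b]); last first.
  by rewrite /= /sq !mxE expr0n /= addr0 mul0r leNgt a0.
have csq : continuous (sq : plane -> R).
  by move=> z; apply: (smooth_continuous (smooth_sq openT)).
apply: bounded_closed_compact.
  exists (2 * b + 1); split=> [|x Nx z /= /andP[_ zb]]; first exact: num_real.
  apply: le_trans (ltW Nx).
  have h i : `|z 0 i| <= 2 * b + 1.
    have z2 : (z 0 i) ^+ 2 <= 2 * b.
      move: zb; rewrite /sq ler_pdivrMr// mulrC; apply: le_trans.
      by case: (ord2P i) => ->; rewrite ?lerDl ?lerDr sqr_ge0.
    by have [|] := ler0P (z 0 i) => _; nra.
  exact: plane_norm_le.
have -> : [set z : plane | a <= sq z <= b] = (sq @^-1` [set t | a <= t]) `&` (sq @^-1` [set t | t <= b]).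
  by apply/seteqP; split=> z /=; [move/andP|move=> [-> ->]].
by apply: closedI; apply: (@closed_comp _ _ sq); [by move=> z _; exact: csq|exact: closed_ge
  |by move=> z _; exact: csq|exact: closed_le].
Qed.

Lemma compact_shell (K : set (@pplane R)) : compact K ->
  exists a b, [/\ 0 < a, 0 < b & forall x, K x -> a < sq (pval x) < b].
Proof.
move=> cK.
have s0 (x : @pplane R) : 0 < sq (pval x) by exact/sq_gt0/pval_neq0.
have oU := @open_pU R; have ssq := smooth_sq oU.
have cs := smooth_pval_continuous ssq.
have ci := smooth_pval_continuous (smooth_inv oU (fun z => @sq_gt0 R z) ssq).
have [b b0 hb] := compact_ge0_bound cK (continuous_subspaceT cs).
have [a a0 ha] := compact_ge0_bound cK (continuous_subspaceT ci).
exists (a + 1)^-1, (b + 1); rewrite invr_gt0 !ltr_wpDl//; split=> // x Kx; apply/andP; split.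
  have a1 : 0 < a + 1 by lra.
  rewrite invf_plt ?posrE//.
  by have := le_trans (ler_norm _) (ha x Kx); lra.
by have := le_trans (ler_norm _) (hb x Kx); lra.
Qed.

End plane_tools.

(** * The weak differential inequality *)

Section radial_weak_inequality.
Context {R : realType}.
Local Notation plane := 'rV[R]_2.
Local Notation pos := [set x : R | 0 < x].
Local Notation bplane := (g_sigma_algebraType (@open (@pplane R))).
Local Notation pmu := (@pmeasure R).
Variables (k u v F dF : R -> R) (m p q : R).
Hypothesis k_smooth : smooth1 pos k.
Hypothesis k_gt0 : forall s, 0 < s -> 0 < k s.
Hypothesis u_smooth : smooth1 pos u.
Hypothesis v_smooth : smooth1 pos v.
Hypothesis F_smooth : smooth1 pos F.
Hypothesis m_gt1 : 1 < m.
Hypothesis u_gt0 : forall s, 0 < s -> 0 < u s.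
Hypothesis v_gt0 : forall s, 0 < s -> 0 < v s.
Hypothesis du : forall s : R, 0 < s -> is_derive s 1 u (- v s).
Hypothesis dFE : forall s : R, 0 < s -> is_derive s 1 F (dF s).
Hypothesis FE : forall s, 0 < s -> F s = k s `^ m * v s `^ (m - 1).
Hypothesis F_ineq : forall s, 0 < s -> u s `^ p * (k s * v s) `^ q <= dF s.
Local Notation M := (radial_manifold k_smooth k_gt0).
Local Notation grad := (@grad R k v k_smooth k_gt0).
Local Notation flux := (@flux R k F k_smooth k_gt0).
Local Notation sol := (@sol R k u k_smooth k_gt0).
Implicit Types (x : @pplane R) (w z : plane).

Let oP := @open_pos R.
Let oU := @open_pU R.

Lemma smooth1_scaled (f : R -> R) : smooth1 pos f -> smooth1 pos (fun s => f s / (2 * s)).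
Proof.
move=> sf; apply: (smoothM oP sf).
apply: (smooth_inv oP); first by move=> s s0; rewrite mulr_gt0.
exact: (smoothM oP (smooth_cst _ 2 oP) (smooth_sub (@subsetT _ _) (@smooth1_id R))).
Qed.

Lemma smooth1_grad_coef : smooth1 pos (fun s => - v s * k s ^+ 2 / (2 * s)).
Proof.
exact: smooth1_scaled (smoothM oP (smoothN oP v_smooth) (smooth_sqr oP k_smooth)).
Qed.

Lemma smooth1_flux_coef : smooth1 pos (fun s => - F s / (2 * s)).
Proof. exact: smooth1_scaled (smoothN oP F_smooth). Qed.

Lemma dF_smooth : smooth1 pos dF.
Proof.
apply: (smooth_congr oP _ (smooth1_derive1 F_smooth)) => s s0.
by rewrite derive1E; apply: derive_val; exact: dFE.
Qed.

Lemma sol_continuous : continuous (sol : @pplane R -> R).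
Proof. exact: smooth_pval_continuous (smooth_radial u_smooth). Qed.

Lemma measurable_pplane_comp (f : plane -> R) : smooth_in dirs (@pU R) f ->
  @measurable_fun _ _ bplane (measurableTypeR R) setT (fun x => f (pval x)).
Proof. by move=> sf; apply: measurable_continuous_pplane; exact: smooth_pval_continuous. Qed.

Lemma radial_sobolev_loc : @sobolev_loc R 1 M pmu m sol grad.
Proof.
split.
- by apply: measurable_continuous_pplane; exact: sol_continuous.
- move=> i j.
  rewrite (_ : (fun x => _) = fun x : bplane => (fun z => - v (sq z) * k (sq z) ^+ 2 / (2 * sq z) * z 0 j) (pval x)).
    exact: measurable_pplane_comp (smoothM oU (smooth_radial smooth1_grad_coef) (smooth_coord j oU)).
  by apply/funext => x; rewrite radial_componentE mxE.
- move=> K cK.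
  apply: (@continuous_compact_integral_lty _ (fun x => `|sol x| `^ m)) => //.
    have -> : (fun x => `|sol x| `^ m) = (fun x : @pplane R => (fun z => u (sq z) `^ m) (pval x)).
      by apply/funext => x; rewrite gtr0_norm//; apply: u_gt0; exact: radius2_gt0.
    apply: (@smooth_pval_continuous _ (fun z => u (sq z) `^ m)).
    apply: (smooth_powR _ oU) (smooth_radial u_smooth).
    by move=> z /sq_gt0; exact: u_gt0.
- move=> K cK.
  apply: (@continuous_compact_integral_lty _ (fun x => `|@tnorm R 1 M x (grad x)| `^ m)) => //.
    have -> : (fun x => `|@tnorm R 1 M x (grad x)| `^ m) =
        (fun x : @pplane R => (fun z => (k (sq z) * v (sq z)) `^ m) (pval x)).
      apply/funext => x; rewrite (tnorm_grad v_gt0) gtr0_norm// mulr_gt0//.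
        by apply: k_gt0; exact: radius2_gt0.
      by apply: v_gt0; exact: radius2_gt0.
    apply: (@smooth_pval_continuous _ (fun z => (k (sq z) * v (sq z)) `^ m)).
    apply: (smooth_powR _ oU) (smoothM oU (smooth_radial k_smooth) (smooth_radial v_smooth)).
    by move=> z /sq_gt0 s0; rewrite mulr_gt0 ?k_gt0 ?v_gt0.
- exact: radial_weak_gradient.
Qed.

Definition flux_field (th : plane -> R) (x : M) : plane := th (pval x) *: flux x.

Lemma flux_field_on th j z : z != 0 ->
  field_on (flux_field th) j z = th z * (- F (sq z) / (2 * sq z) * z 0 j).
Proof. by move=> z0; rewrite /field_on /flux_field /flux /radius2 pparamK// !mxE. Qed.

Lemma smooth_flux_field th : smooth_in dirs (@pU R) th ->
  smooth_field (flux_field th).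
Proof.
move=> sth; apply/radial_smooth_fieldE => j.
apply: (smooth_congr oU) (smoothM oU sth (smoothM oU (smooth_radial smooth1_flux_coef) (smooth_coord j oU))).
by move=> z z0; rewrite flux_field_on.
Qed.

Lemma pd_flux j z : z != 0 ->
  pd dirs j (fun z => - F (sq z) / (2 * sq z) * z 0 j) z =
  (F (sq z) / (2 * sq z ^+ 2) - dF (sq z) / (2 * sq z)) * z 0 j ^+ 2 - F (sq z) / (2 * sq z).
Proof.
move=> z0; have s0 := sq_gt0 z0; apply: derive_val.
have h : is_derive (sq z) 1 (fun s => - F s / (2 * s))
    (F (sq z) / (2 * sq z ^+ 2) - dF (sq z) / (2 * sq z)).
  have n0 : 2 * sq z != 0 by rewrite mulf_neq0// gt_eqF.
  apply: is_derive_eq (is_derive_mul (is_derive_opp (dFE s0))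
    (@is_derive_inv _ (fun s : R => 2 * s) (sq z) _ n0 (is_derive_mulc 2 (is_derive_self (sq z))))) _.
  by field; rewrite gt_eqF.
apply: is_derive_eq (is_derive_mulV (is_derive_radial _ h) (is_derive_coord j z (dirs j))) _.
have -> : dirs j 0 j = 1 :> R by rewrite /dirs mxE !eqxx.
have -> : dot z (dirs j) = z 0 j.
  by rewrite /dot /dirs !mxE; case: (ord2P j) => -> /=; rewrite !(mulr1, mulr0, addr0, add0r).
ring.
Qed.

(** In the coordinates [s], [theta] the density is 1 and the flux is [- F d/ds], whence [- F']. The
    set [W] localises the computation to where the cutoff is constant. *)
Lemma divergence_flux (W : set plane) th (x : M) : open W -> W (pval x) -> (forall z, W z -> th z = 1) ->
  divergence (flux_field th) x = - dF (radius2 x).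
Proof.
move=> oW Wx th1; have x0 := pval_neq0 x; have s0 := radius2_gt0 x.
have e j : pd dirs j (field_on (flux_field th) j) (pval x) =
    pd dirs j (fun z => - F (sq z) / (2 * sq z) * z 0 j) (pval x).
  apply: (@pd_congr _ _ _ _ _ _ _ j _ (openI oW oU)) => // z [Wz z0].
  by rewrite flux_field_on// th1// mul1r.
rewrite radial_divergenceE sum_ord2 !e !pd_flux// -/(radius2 x).
have <- : 2 * radius2 x - pval x 0 0 ^+ 2 = pval x 0 1 ^+ 2 by rewrite /radius2 /sq; field.
by field; rewrite gt_eqF.
Qed.

Lemma divergence_eq0 (W : set plane) th (x : M) : open W -> W (pval x) -> (forall z, W z -> th z = 0) ->
  divergence (flux_field th) x = 0.
Proof.
move=> oW Wx th0; have x0 := pval_neq0 x.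
have e j : pd dirs j (field_on (flux_field th) j) (pval x) = 0.
  apply: (etrans (y := pd dirs j (cst 0) (pval x))); last exact: derive_cst.
  apply: (@pd_congr _ _ _ _ _ _ _ j _ (openI oW oU)) => // z [Wz z0].
  by rewrite flux_field_on// th0// mul0r.
by rewrite radial_divergenceE sum_ord2 !e addr0.
Qed.

Section test_function.
Variables (psi : M -> R) (H : M -> plane) (K : set M).
Hypothesis sob : @sobolev_loc R 1 M pmu m psi H.
Hypothesis cK : compact K.
Hypothesis psiK : forall x, ~ K x -> psi x = 0.

Definition flux_pairing (x : M) : R := inner x (flux x) (H x).

Lemma flux_pairingE (x : M) : flux_pairing x =
  - F (radius2 x) / k (radius2 x) ^+ 2 * (pval x 0 0 * H x 0 0 + pval x 0 1 * H x 0 1).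
Proof. by rewrite /flux_pairing inner_flux. Qed.

Lemma measurable_components j :
  @measurable_fun _ _ bplane (measurableTypeR R) setT (fun x : M => H x 0 j).
Proof.
have [_ mH _ _ _] := sob.
have := mH tt j; congr (measurable_fun _ _); apply/funext => x.
by rewrite radial_componentE.
Qed.

Lemma measurable_coord_component (i j : 'I_2) :
  @measurable_fun _ _ bplane (measurableTypeR R) setT (fun x : M => pval x 0 i * H x 0 j).
Proof.
apply: measurable_funM (measurable_components j).
exact: (measurable_pplane_comp (smooth_coord i oU)).
Qed.

Lemma measurable_flux_pairing :
  @measurable_fun _ _ bplane (measurableTypeR R) setT flux_pairing.
Proof.
have -> : flux_pairing = fun x : M =>
    (fun z => - F (sq z) / k (sq z) ^+ 2) (pval x) *
    ((fun z => z 0 0) (pval x) * H x 0 0 + (fun z => z 0 1) (pval x) * H x 0 1).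
  by apply/funext => x; rewrite flux_pairingE.
apply: measurable_funM.
  have sk : smooth1 pos (fun s => - F s / k s ^+ 2).
    apply: (smoothM oP (smoothN oP F_smooth)); apply: (smooth_inv oP) (smooth_sqr oP k_smooth).
    by move=> s s0; rewrite exprn_gt0// k_gt0.
  exact: measurable_pplane_comp (smooth_radial sk).
exact: measurable_funD (measurable_coord_component 0 0) (measurable_coord_component 1 1).
Qed.

Lemma measurable_tnorm :
  @measurable_fun _ _ bplane (measurableTypeR R) setT (fun x : M => tnorm x (H x)).
Proof.
pose d1 (x : bplane) := pval x 0 0 * H x 0 0 + pval x 0 1 * H x 0 1.
pose d2 (x : bplane) := pval x 0 0 * H x 0 1 - pval x 0 1 * H x 0 0.
pose Q (x : bplane) := rad_coef k (sq (pval x)) * (d1 x * d1 x) + ang_coef k (sq (pval x)) * (d2 x * d2 x).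
have -> : (fun x : M => tnorm x (H x)) = (fun x => Q x `^ 2^-1).
  apply/funext => x; rewrite /tnorm radial_innerE -powR12_sqrt.
    by congr (_ `^ _); rewrite /Q /d1 /d2 /dot perp_0 perp_1 /radius2; ring.
  have r0 := rad_coef_gt0 k_gt0 (radius2_gt0 x); have a0 := ang_coef_gt0 k_gt0 (radius2_gt0 x).
  by rewrite -!expr2 addr_ge0// mulr_ge0 ?sqr_ge0// ltW.
apply: (measurableT_comp (measurable_powR _)).
have m1 : measurable_fun setT d1 by exact: measurable_funD (measurable_coord_component 0 0) (measurable_coord_component 1 1).
have m2 : measurable_fun setT d2 by exact: measurable_funB (measurable_coord_component 0 1) (measurable_coord_component 1 0).
apply: measurable_funD; apply: measurable_funM; try exact: measurable_funM.
  exact: (measurable_pplane_comp (smooth_radial (smooth_rad_coef k_smooth k_gt0))).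
exact: (measurable_pplane_comp (smooth_radial (smooth_ang_coef k_smooth))).
Qed.

(** From [t <= 1 + t^m] for [t >= 0]: the pairing with the flux becomes integrable on compact sets
    as soon as [|H|^m] is. *)
Lemma flux_pairing_le (x : M) : `|flux_pairing x| <= F (radius2 x) / k (radius2 x) * (1 + `|tnorm x (H x)| `^ m).
Proof.
have s0 := radius2_gt0 x; have k0 := k_gt0 s0.
have F0 : 0 < F (radius2 x) by rewrite FE// mulr_gt0 ?powR_gt0 ?v_gt0.
have Fk0 : 0 < F (radius2 x) / k (radius2 x) ^+ 2 by rewrite divr_gt0// exprn_gt0.
rewrite /flux_pairing inner_flux normrM mulNr normrN (gtr0_norm Fk0).
have h := tnorm_ge_radial x (H x).
have t0 : 0 <= tnorm x (H x) by exact: sqrtr_ge0.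
apply: (@le_trans _ _ (F (radius2 x) / k (radius2 x) ^+ 2 * (k (radius2 x) * tnorm x (H x)))).
  by rewrite ler_pM2l.
have -> : F (radius2 x) / k (radius2 x) ^+ 2 * (k (radius2 x) * tnorm x (H x)) =
    F (radius2 x) / k (radius2 x) * tnorm x (H x) by field; rewrite gt_eqF.
rewrite ler_pM2l ?divr_gt0// ger0_norm//.
have [t1|t1] := leP 1 (tnorm x (H x)); last by rewrite (le_trans (ltW t1))// lerDl powR_ge0.
apply: le_trans (_ : tnorm x (H x) `^ m <= _); last by rewrite lerDr.
by rewrite -[leLHS]powRr1// ler_powR// ltW.
Qed.

Lemma flux_pairing_integrable (C : set (@pplane R)) : compact C ->
  pmu.-integrable (C : set bplane) (EFin \o flux_pairing).
Proof.
move=> cC; have mC := compact_measurable_pplane cC.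
have [_ _ _ LH _] := sob.
apply/integrableP; split.
  by apply/measurable_EFinP; apply: measurable_funTS; exact: measurable_flux_pairing.
have cFk : continuous (fun x : @pplane R => (fun z => F (sq z) / k (sq z)) (pval x)).
  apply: (@smooth_pval_continuous _ (fun z => F (sq z) / k (sq z))).
  exact: smooth_radial (smoothM oP F_smooth (smooth_inv oP k_gt0 k_smooth)).
have [B B0 hB] := compact_ge0_bound cC (continuous_subspaceT cFk).
have mt : @measurable_fun _ _ bplane (measurableTypeR R) C (fun x => `|@tnorm R 1 M x (H x)| `^ m).
  apply: measurable_funTS; apply: (measurableT_comp (measurable_powR m)).
  apply: measurableT_comp => //; exact: measurable_tnorm.
apply: (@le_lt_trans _ _ (\int[pmu]_(x in (C : set bplane)) (B%:E * (1 + (`|@tnorm R 1 M x (H x)| `^ m)%:E)))%E).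
  apply: ge0_le_integral => //.
  - apply/measurable_EFinP; apply: measurable_funTS; apply: measurableT_comp => //.
    exact: measurable_flux_pairing.
  - apply: measurable_funeM; apply: emeasurable_funD => //; exact/measurable_EFinP.
  - move=> x Cx; rewrite -EFinD -EFinM lee_fin; apply: le_trans (flux_pairing_le x) _.
    apply: ler_wpM2r; first by rewrite addr_ge0// powR_ge0.
    exact: le_trans (ler_norm _) (hB x Cx).
rewrite ge0_integralZl//; last 2 first.
- by apply: emeasurable_funD => //; exact/measurable_EFinP.
- by move=> x _; rewrite -EFinD lee_fin addr_ge0// powR_ge0.
rewrite lte_mul_pinfty// ge0_integralD//; last exact/measurable_EFinP.
by rewrite lte_add_pinfty//; [rewrite integral_cst// mul1e; exact: compact_pmeasure_lty|exact: LH].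
Qed.

Lemma inner_scaled (x : M) c (v1 v2 : plane) : inner x v1 (c *: v2) = c * inner x v2 v1.
Proof. by rewrite !radial_innerE !dotZ; ring. Qed.

Lemma integral_flux_pairing th (C : set (@pplane R)) : smooth_in dirs (@pU R) th -> compact C ->
  (forall x, ~ C x -> th (pval x) = 0) ->
  (\int[pmu]_x (th (pval x) * flux_pairing x)%:E =
   - \int[pmu]_x (psi x * @divergence R 1 M (flux_field th) x)%:E)%E.
Proof.
move=> sth cC thC; have [_ _ _ _ wg] := sob.
rewrite -(wg (flux_field th) (smooth_flux_field sth)); last first.
  by exists C => // x Cx; rewrite /flux_field thC// scale0r.
by apply: eq_integral => x _; rewrite inner_scaled.
Qed.

(** For [th] supported off [K], testing the weak gradient of [psi] against [th] times the flux gives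
    0, since [psi] vanishes where the divergence of that field may not. The fundamental lemma
    applies on the complement of [K]. *)
Lemma flux_pairing_ae_eq0 : {ae pmu, forall x, (~` K) x -> flux_pairing x = 0}.
Proof.
apply: ae_eq0_of_integral_bump.
- exact: measurable_flux_pairing.
- exact: flux_pairing_integrable.
- move=> th sth C cC CK thC.
  have sU : smooth_in dirs (@pU R) th by exact: smooth_sub sth.
  rewrite (integral_flux_pairing sU cC thC) (_ : (\int[_]_x _)%E = 0%E) ?oppe0//.
  apply: integral0_eq => x _; have [Kx|nK] := pselect (K x); last by rewrite psiK// mul0r.
  have cpC : compact (pval @` C).
    by apply: continuous_compact cC; apply: continuous_subspaceT; exact: pval_continuous.
  rewrite (@divergence_eq0 (~` (pval @` C) `&` @pU R)) ?mulr0//.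
  + by apply: openI oU; apply: closed_openC; apply: compact_closed cpC; exact: norm_hausdorff.
  + split; last exact: pval_neq0.
    by move=> [y Cy /pval_inj yx]; apply: (CK y) => //; rewrite yx.
  + move=> z [zC z0]; rewrite -(pparamK z0); apply: thC => Cz; apply: zC.
    by exists (pparam z) => //; exact: pparamK.
- by apply: closed_openC; apply: compact_closed cK; exact: pplane_hausdorff.
Qed.

Hypothesis psi_ge0 : forall x, 0 <= psi x.

Lemma dF_ge0 (s : R) : 0 < s -> 0 <= dF s.
Proof. by move=> s0; apply: le_trans (F_ineq s0); rewrite mulr_ge0 ?powR_ge0. Qed.

(** The flux must be cut off to become an admissible field. The cutoff equals 1 near [K]; elsewhere
    [psi] vanishes, and so does the pairing almost everywhere, hence neither integral changes. *)
Lemma integral_flux_psi : (\int[pmu]_x (flux_pairing x)%:E = \int[pmu]_x (psi x * dF (sq (pval x)))%:E)%E.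
Proof.
have [a [b [a0 b0 hK]]] := compact_shell cK.
have sc := smooth_cutoff a b.
have cC : compact [set x : @pplane R | a / 2 <= sq (pval x) <= 2 * b].
  by apply: shell_compact; rewrite divr_gt0.
have mw := measurable_flux_pairing.
transitivity (\int[pmu]_x (cutoff a b (pval x) * flux_pairing x)%:E)%E.
  apply: ae_eq_integral => //; first exact/measurable_EFinP.
    by apply/measurable_EFinP; apply: measurable_funM mw; exact: measurable_pplane_comp.
  apply: negligibleS flux_pairing_ae_eq0 => x /= h wx; apply: h => _.
  have [Kx|nK] := pselect (K x); last by rewrite wx// mulr0.
  by have /andP[h1 h2] := hK x Kx; rewrite cutoff_eq1 ?mul1r// ltW.
rewrite (integral_flux_pairing sc cC); last first.
  by move=> x nC; apply: cutoff_eq0 => //; exact/negP.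
have div_psi (x : M) : psi x * divergence (flux_field (cutoff a b)) x = - (psi x * dF (sq (pval x))).
  have [Kx|nK] := pselect (K x); last by rewrite psiK// !mul0r oppr0.
  have csq : continuous (sq : plane -> R).
    by move=> z; apply: (smooth_continuous (smooth_sq openT)).
  rewrite (@divergence_flux ((sq @^-1` [set t | a < t]) `&` (sq @^-1` [set t | t < b]))) ?mulrN//.
  - by apply: openI; apply: open_comp => [z _|]; try exact: csq; [exact: open_gt|exact: open_lt].
  - by have /andP[] := hK x Kx.
  - by move=> z [za zb]; rewrite cutoff_eq1// ltW.
under eq_integral => x _ do rewrite div_psi.
apply/eqP; rewrite eqe_oppLR; apply/eqP; rewrite -[RHS]integral_ge0N// => x _.
by rewrite lee_fin mulr_ge0// dF_ge0// sq_gt0// pval_neq0.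
Qed.

End test_function.

Lemma radial_positive_solution : @positive_solution R 1 M pmu m p q sol.
Proof.
split; first by move=> x; apply: u_gt0; exact: radius2_gt0.
exists grad; first exact: radial_sobolev_loc.
move=> psi H sob [K cK psiK] psi0.
have mpsi : @measurable_fun _ _ bplane (measurableTypeR R) setT psi by case: sob.
under eq_integral => x _ do rewrite (flux_grad v_gt0 FE).
rewrite [X in (- X + _)%E](integral_flux_psi sob cK psiK psi0).
set a := (X in (- X + _)%E); set b := (X in (_ + X)%E).
have b0 : (0 <= b)%E.
  apply: integral_ge0 => x _; rewrite mule_ge0// ?lee_fin//.
  rewrite mule_ge0 ?lee_fin ?powR_ge0//; rewrite /epow; case: ifP => // _.
  by rewrite lee_fin powR_ge0.
(* Whether or not the integrals are finite, [b <= a] suffices: if both are [+oo], the convention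
   [-oo + +oo = -oo] gives the conclusion. *)
suff ba : (b <= a)%E.
  have a0 : (0 <= a)%E by exact: le_trans b0 ba.
  by move: a0 b0 ba; case: a b => [a| |] [b| |] //=; rewrite ?lee_fin; lra.
have -> : b = (\int[pmu]_x (psi x * (u (sq (pval x)) `^ p * (k (sq (pval x)) * v (sq (pval x))) `^ q))%:E)%E.
  apply: eq_integral => x _; have s0 : 0 < sq (pval x) by rewrite sq_gt0// pval_neq0.
  have kv0 : 0 < k (sq (pval x)) * v (sq (pval x)) by rewrite mulr_gt0 ?k_gt0 ?v_gt0.
  rewrite (tnorm_grad v_gt0) /radius2 /epow (gt_eqF kv0) /= -!EFinM; congr (_%:E).
  by rewrite mulrC.
apply: ge0_le_integral => //.
- by move=> x _; rewrite lee_fin !mulr_ge0 ?powR_ge0.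
- apply/measurable_EFinP; apply: measurable_funM => //.
  pose f (s : R) := u s `^ p * (k s * v s) `^ q.
  have sf : smooth1 pos f.
    apply: (smoothM oP (smooth_powR _ oP u_gt0 u_smooth) (smooth_powR _ oP _ (smoothM oP k_smooth v_smooth))).
    by move=> s s0; rewrite mulr_gt0 ?k_gt0 ?v_gt0.
  exact: measurable_pplane_comp (smooth_radial sf).
- apply/measurable_EFinP; apply: measurable_funM => //.
  exact: measurable_pplane_comp (smooth_radial dF_smooth).
- by move=> x _; rewrite lee_fin ler_wpM2l// F_ineq// sq_gt0// pval_neq0.
Qed.

End radial_weak_inequality.

(** * Volume growth *)

Lemma is_derive_component {R : realType} (f : R -> 'rV[R]_2) (t : R) j : derivable f t 1 ->
  is_derive t 1 (fun t => f t 0 j) (derive1 f t 0 j).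
Proof.
move=> df; apply: DeriveDef; first by move/derivable_mxP : df; apply.
by rewrite derive1E derive_mx// mxE.
Qed.

Section radial_growth.
Context {R : realType}.
Local Notation plane := 'rV[R]_2.
Local Notation pos := [set x : R | 0 < x].
Local Notation bplane := (g_sigma_algebraType (@open (@pplane R))).
Local Notation pmu := (@pmeasure R).
Local Notation leb := (@lebesgue_measure R).
Variables (k P dP : R -> R).
Hypothesis k_smooth : smooth1 pos k.
Hypothesis k_gt0 : forall s, 0 < s -> 0 < k s.
Hypothesis hP : forall s : R, 0 < s -> is_derive s 1 P (dP s) /\ k s * `|dP s| <= 1.
Local Notation M := (radial_manifold k_smooth k_gt0).

(** The function [P] of [s] has a gradient of norm [k |dP| <= 1], so along a curve it increases by
    at most the length. *)
Lemma curve_length_ge (c : R -> M) : C1_curve c ->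
  ((P (radius2 (c 1)) - P (radius2 (c 0)))%:E <= curve_length c)%E.
Proof.
move=> [cc c1]; pose ga : R -> plane := pval \o c.
have dga t : derivable ga t 1 /\ {for t, continuous (derive1 ga)} by exact: (c1 tt t Logic.I).
have cga : continuous ga by move=> t; apply: differentiable_continuous; apply/derivable1_diffP; exact: (dga t).1.
have vE t : velocity c t = derive1 ga t by [].
pose sg t := sq (ga t).
have sg0 t : 0 < sg t by exact: radius2_gt0.
have csg : continuous sg.
  by move=> t; apply: (@continuous_comp _ _ _ ga sq); [exact: cga|exact: (smooth_continuous (smooth_sq openT))].
have cco (f : R -> plane) j : continuous f -> continuous (fun t => f t 0 j).
  by move=> cf t; apply: (@continuous_comp _ _ _ f (fun z : plane => z 0 j)); [exact: cf|exact: coord_continuous].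
have cga' : continuous (derive1 ga) by move=> t; exact: (dga t).2.
have crad (f : R -> R) : smooth1 pos f -> continuous (fun t => f (sg t)).
  move=> sf t; apply: continuous_comp; [exact: csg|exact: smooth_continuous sf (sg0 t)].
pose g t := tnorm (c t) (velocity c t).
have cg : continuous g.
  move=> t; rewrite (_ : g = Num.sqrt \o (fun t =>
    rad_coef k (sg t) * (dot (ga t) (derive1 ga t) * dot (ga t) (derive1 ga t)) +
    ang_coef k (sg t) * (dot (perp (ga t)) (derive1 ga t) * dot (perp (ga t)) (derive1 ga t)))).
    have cd : continuous (fun t => dot (ga t) (derive1 ga t)).
      by move=> {}t; apply: cvgD; apply: cvgM; exact: cco.
    have cp : continuous (fun t => dot (perp (ga t)) (derive1 ga t)).
      rewrite (_ : (fun t => _) = fun t => - ga t 0 1 * derive1 ga t 0 0 + ga t 0 0 * derive1 ga t 0 1).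
        by move=> {}t; apply: cvgD; apply: cvgM; try (by apply: cvgN; exact: cco); exact: cco.
      by apply/funext => {}t; rewrite /dot perp_0 perp_1.
    apply: continuous_comp; last exact: sqrt_continuous.
    apply: cvgD; apply: cvgM.
    - exact: (crad _ (smooth_rad_coef k_smooth k_gt0)).
    - by apply: cvgM; exact: cd.
    - exact: (crad _ (smooth_ang_coef k_smooth)).
    - by apply: cvgM; exact: cp.
  by apply/funext => {}t; rewrite /g /tnorm radial_innerE vE.
have -> : curve_length c = (prim g 1 - prim g 0)%:E.
  rewrite EFinB; apply: continuous_FTC2 => //.
  - exact: continuous_subspaceT.
  - have cp t : {for t, continuous (prim g)} by exact: is_derive_continuous (is_derive_prim t cg).
    by split=> [t _||]; [by have [] := is_derive_prim t cg|apply: cvg_at_right_filter; exact: cp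
      |apply: cvg_at_left_filter; exact: cp].
  - by move=> t _; rewrite derive1E; apply: derive_val; exact: is_derive_prim.
rewrite lee_fin.
have dsg (t : R) : is_derive t 1 (fun t => P (sg t)) (dP (sg t) * dot (ga t) (derive1 ga t)).
  have [h0 _] := hP (sg0 t).
  apply: (@is_derive1_comp _ P sg t _ _ h0).
  have dj j := is_derive_component j (dga t).1.
  rewrite (_ : sg = fun t => 2^-1 * (ga t 0 0 * ga t 0 0 + ga t 0 1 * ga t 0 1)); last first.
    by apply/funext => w; rewrite /sg /sq; field.
  apply: is_derive_eq (is_derive_mulc 2^-1 (is_derive_add
    (is_derive_mul (dj 0) (dj 0)) (is_derive_mul (dj 1) (dj 1)))) _.
  by rewrite /dot; field.
suff : prim g 0 - P (sg 0) <= prim g 1 - P (sg 1) by rewrite /sg /radius2; lra.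
apply: (@derive_ge0_le _ (fun t => prim g t - P (sg t)) (fun t => g t - dP (sg t) * dot (ga t) (derive1 ga t))) => //.
  by move=> t _; exact: is_derive_sub (is_derive_prim t cg) (dsg t).
move=> t _; rewrite subr_ge0; apply: le_trans (ler_norm _) _; rewrite normrM.
have [_ h] := hP (sg0 t); have := tnorm_ge_radial (c t) (velocity c t).
rewrite vE -/(g t) => h2.
apply: le_trans (ler_wpM2l (normr_ge0 _) h2) _.
rewrite mulrA [_ * k _]mulrC ler_piMl//; exact: sqrtr_ge0.
Qed.

Lemma geodesic_ball_sub (o : M) (r : R) :
  geodesic_ball o r `<=` [set x | P (radius2 x) < P (radius2 o) + r].
Proof.
move=> y /ereal_inf_lt[_ [c [C1c c0 c1] <-]] h /=.
have := le_lt_trans (curve_length_ge C1c) h.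
by rewrite c0 c1 lte_fin; lra.
Qed.

(** The disc of radius [sqrt (2 sg)] lies in its circumscribed square, of area [8 sg]; the constant
    is immaterial for the growth. *)
Lemma pmeasure_disc_le (A : set bplane) (sg : R) : 0 <= sg ->
  A `<=` [set x | sq (pval x) <= sg] -> (pmu A <= (8 * sg)%:E)%E.
Proof.
move=> sg0 hA; pose B : set bplane := [set x | sq (pval x) <= sg].
have mB : measurable B.
  rewrite -[B]setCK; apply: measurableC; apply: pmeasurable_open.
  rewrite (_ : ~` B = (fun x : @pplane R => sq (pval x)) @^-1` [set t | sg < t]).
    apply: open_comp; last exact: open_gt.
    by move=> x _; exact: (smooth_pval_continuous (smooth_sq (@open_pU R))).
  by apply/seteqP; split=> x /=; rewrite ltNge => /negP.
apply: le_trans (pmeasure_le mB hA) _.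
pose N := Num.sqrt (2 * sg).
have N0 : 0 <= N by exact: sqrtr_ge0.
have NN : N ^+ 2 = 2 * sg by rewrite sqr_sqrtr// mulr_ge0.
pose D : set (measurableTypeR R * measurableTypeR R) := square N `|` origin.
have mD : measurable D by apply: measurableU; [exact: measurable_square|exact: measurable_origin].
apply: (@le_trans _ _ (lebesgue2 D)).
  apply: le_measure; rewrite ?inE//; first exact: measurable_preimage_chart.
  move=> t Bt; have [t0|t0] := eqVneq t (0, 0); first by right.
  left; apply/squareP; have : sq (pair_vec t) <= sg.
    by move: Bt; rewrite /B /= /chart_point pparamK// pair_vec_eq0.
  rewrite /sq ler_pdivrMr// mulrC -NN => h.
  have hj j : `|pair_vec t 0 j| <= N.
    rewrite -[leRHS](ger0_norm N0) -ler_sqr ?nnegrE// !real_normK ?num_real//.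
    apply: le_trans h; case: (ord2P j) => ->; [rewrite lerDl|rewrite lerDr]; exact: sqr_ge0.
  exact: plane_norm_le.
apply: le_trans (measureU2 _ (measurable_square N) measurable_origin) _.
rewrite [X in (_ + X)%E](_ : _ = 0%E) ?adde0; last exact: lebesgue2_origin.
rewrite [X in (X <= _)%E](lebesgue2_square N0) lee_fin exprMn NN; lra.
Qed.

Lemma radial_volume_growth (o : M) (Fg : R -> R) (c r0 : R) : 0 < c ->
  (forall r, r0 <= r -> 0 <= Fg r /\
     forall s, 0 < s -> P s <= P (radius2 o) + r -> s <= c * Fg r) ->
  @volume_growth R 1 M pmu o Fg.
Proof.
move=> c0 h; exists (8 * c); first by rewrite mulr_gt0.
exists r0 => r /h[F0 hs]; rewrite -mulrA; apply: pmeasure_disc_le.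
  by rewrite mulr_ge0// ltW.
move=> x /geodesic_ball_sub /= hx; apply: hs; last exact: ltW.
by rewrite sq_gt0// pval_neq0.
Qed.

Lemma radial_nontrivial (u v : R -> R) : (forall s : R, 0 < s -> is_derive s 1 u (- v s)) ->
  (forall s, 0 < s -> 0 < v s) -> @nontrivial R 1 M pmu (@sol R k u k_smooth k_gt0).
Proof.
move=> du v0 [a [N [mN N0 hN]]].
have dec s t : 0 < s -> s < t -> u t < u s.
  move=> s0 st; rewrite -ltrN2; apply: (@derive_gt0_lt _ (fun s => - u s) v) => // w /andP[sw _].
    by apply: is_derive_eq (is_derive_opp (du w (lt_le_trans s0 sw))) _; rewrite opprK.
  exact: v0 (lt_le_trans s0 sw).
have pbox b c : 0 <= b -> b < c -> ~ (box b c b c `<=` N).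
  move=> b0 bc bN.
  have : (lebesgue2 (`]b, c[ `*` `]b, c[) <= pmu N)%E.
    rewrite pmeasureE//; apply: le_measure; rewrite ?inE.
    - by apply: measurableX; exact: measurable_itv.
    - exact: measurable_preimage_chart.
    - move=> [t1 t2] [/= h1 h2]; apply: bN; rewrite /box /= /chart_point pparamK ?pair_vec_eq0.
        by move: h1 h2; rewrite !in_itv /= vec2_0 vec2_1 => /andP[? ?] /andP[? ?].
      by move: h1; rewrite in_itv /= xpair_eqE negb_and => /andP[h _]; rewrite gt_eqF ?(le_lt_trans b0).
  rewrite N0; apply/negP; rewrite -ltNge.
  rewrite [X in (_ < X)%E](product_measure1E _ _ _ _); [|exact: measurable_itv..].
  rewrite [X in (_ < X * _)%E](lebesgue_measure_itv `]b, c[).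
  rewrite [X in (_ < _ * X)%E](lebesgue_measure_itv `]b, c[) /= lte_fin bc -EFinB -EFinM lte_fin.
  by rewrite mulr_gt0 ?subr_gt0.
have sqb (b c : R) x : 0 <= b -> box b c b c x -> b ^+ 2 < sq (pval x) < c ^+ 2.
  move=> b0 [h1 h2 h3 h4]; rewrite /sq ltr_pdivlMr// ltr_pdivrMr//.
  by apply/andP; split; nra.
(* On the boxes with corners at 1, 2 and at 3, 4 the values of [s] lie in []1, 4[] and []9, 16[]. As
   [u] decreases strictly, the value [a] is missed on the first box if [a <= u 9] and on the second
   otherwise. *)
have [a9|a9] := leP a (u 9).
  apply: (@pbox 1 2) => // [|x bx]; first by lra.
  have := sqb 1 2 x ler01 bx => /andP[h1 h2].
  apply: hN => /= e; have := dec (sq (pval x)) 9; rewrite [u (sq _)]e.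
  by move=> /(_ ltac:(lra) ltac:(lra)); lra.
apply: (@pbox 3 4) => // [|x bx]; first by lra.
have := sqb 3 4 x ltac:(lra) bx => /andP[h1 h2].
apply: hN => /= e; have := dec 9 (sq (pval x)); rewrite [u (sq _)]e.
by move=> /(_ ltac:(lra) ltac:(lra)); lra.
Qed.

End radial_growth.

(** [2^-1] is the value of [s] at the base point [(1, 0)], so the last hypothesis bounds [s] on the
    ball of radius [r]. *)
Lemma radial_solution_with_growth {R : realType} (m p q : R) (k u v F dF P dP Fg : R -> R) (c r0 : R) :
  1 < m ->
  smooth1 [set x | 0 < x] k -> smooth1 [set x | 0 < x] u ->
  smooth1 [set x | 0 < x] v -> smooth1 [set x | 0 < x] F ->
  (forall s, 0 < s -> 0 < k s) -> (forall s, 0 < s -> 0 < u s) -> (forall s, 0 < s -> 0 < v s) ->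
  (forall s : R, 0 < s -> is_derive s 1 u (- v s)) ->
  (forall s : R, 0 < s -> is_derive s 1 F (dF s)) ->
  (forall s, 0 < s -> F s = k s `^ m * v s `^ (m - 1)) ->
  (forall s, 0 < s -> u s `^ p * (k s * v s) `^ q <= dF s) ->
  (forall s : R, 0 < s -> is_derive s 1 P (dP s) /\ k s * `|dP s| <= 1) ->
  (forall B : R, exists2 s : R, 0 < s <= 1 & P s <= B) ->
  (forall B : R, exists2 s : R, 1 <= s & B <= P s) ->
  0 < c ->
  (forall r, r0 <= r -> 0 <= Fg r /\ forall s, 0 < s -> P s <= P 2^-1 + r -> s <= c * Fg r) ->
  solution_with_growth m p q Fg.
Proof.
move=> m1 sk su sv sF k0 u0 v0 du dFE FE F_ineq hP Plo Phi c0 hg.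
exists 1%N, (radial_manifold sk k0), (@pmeasure R), (@pbase R); split.
- exact: pplane_unbounded.
- exact: radial_complete hP Plo Phi.
- exact: radial_riemannian_measure.
- apply: (@radial_volume_growth _ _ _ _ sk k0 hP _ Fg c r0 c0).
  have -> : radius2 (@pbase R : radial_manifold sk k0) = 2^-1 => //.
  by rewrite /radius2 /sq vec2_0 vec2_1 expr1n expr0n addr0 mul1r.
- exists (sol u (k_gt0 := k0)); split; last exact: radial_nontrivial du v0.
  exact: (radial_positive_solution sk k0 su sv sF m1 u0 v0 du dFE FE F_ineq).
Qed.

(** * Exponential growth *)

Section power_comparison.
Context {R : realType}.
Implicit Types (x y a b : R).

Lemma powR_le x y a : 0 <= a -> 0 <= x -> x <= y -> x `^ a <= y `^ a.
Proof.
by move=> a0 x0 xy; apply: ge0_ler_powR; rewrite ?nnegrE// (le_trans x0).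
Qed.

Lemma powR_le1 x a : x `^ a <= 1 -> 0 < a -> x <= 1.
Proof.
move=> + a0; apply: contraTT; rewrite -!ltNge => x1.
have -> : 1 = 1 `^ a :> R by rewrite powR1.
by apply: gt0_ltr_powR; rewrite ?nnegrE// ltW// (lt_trans ltr01).
Qed.

Lemma powR_ge1 x a : 1 <= x -> 0 <= a -> 1 <= x `^ a.
Proof. by move=> x1 a0; rewrite -[leLHS](powRr0 x) ler_powR. Qed.

Lemma powR_succ x a : 0 < x -> x `^ a = x `^ (a - 1) * x.
Proof. by move=> x0; rewrite -[X in _ * X]powRr1 ?ltW// -powRD_gt0// subrK. Qed.

End power_comparison.

(** Here [k] is eliminated. Recovered from [F = k^m v^(m-1)], it turns [k v] into [(F v)^(1/m)] and
    the condition [k |dP| <= 1] into [F |dP|^m <= v^(m-1)]. *)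
Lemma solution_of_profile {R : realType} (m p q : R) (u v F dF P dP Fg : R -> R) (c r0 : R) :
  1 < m -> smooth1 [set x | 0 < x] u -> smooth1 [set x | 0 < x] F ->
  (forall s, 0 < s -> 0 < u s) -> (forall s, 0 < s -> 0 < v s) -> (forall s, 0 < s -> 0 < F s) ->
  (forall s : R, 0 < s -> is_derive s 1 u (- v s)) ->
  (forall s : R, 0 < s -> is_derive s 1 F (dF s)) ->
  (forall s, 0 < s -> u s `^ p * (F s * v s) `^ (q / m) <= dF s) ->
  (forall s : R, 0 < s -> is_derive s 1 P (dP s) /\ F s * `|dP s| `^ m <= v s `^ (m - 1)) ->
  (forall B : R, exists2 s : R, 0 < s <= 1 & P s <= B) ->
  (forall B : R, exists2 s : R, 1 <= s & B <= P s) ->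
  0 < c ->
  (forall r, r0 <= r -> 0 <= Fg r /\ forall s, 0 < s -> P s <= P 2^-1 + r -> s <= c * Fg r) ->
  solution_with_growth m p q Fg.
Proof.
move=> m1 su sF u0 v0 F0 du dFE F_ineq hP Plo Phi c0 hg.
have oP := @open_pos R; have m0 : 0 < m by lra.
have sv : smooth1 [set x | 0 < x] v.
  apply: (smooth_congr oP _ (smoothN oP (smooth1_derive1 su))) => s s0.
  by rewrite derive1E (@derive_val _ _ _ _ _ _ _ (du s s0)) opprK.
have mm : m^-1 * m = 1 by rewrite mulVf// gt_eqF.
pose k s := (F s / v s `^ (m - 1)) `^ m^-1.
have k0 s : 0 < s -> 0 < k s by move=> s0; rewrite powR_gt0// divr_gt0 ?powR_gt0 ?F0 ?v0.
have km s : 0 < s -> k s `^ m = F s / v s `^ (m - 1).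
  by move=> s0; rewrite -powRrM mm powRr1// ltW// divr_gt0 ?powR_gt0 ?F0 ?v0.
have vm s : 0 < s -> v s `^ m = v s `^ (m - 1) * v s.
  by move=> s0; rewrite -powR_succ// v0.
have sk : smooth1 [set x | 0 < x] k.
  apply: (smooth_powR _ oP); first by move=> s s0; rewrite divr_gt0 ?powR_gt0 ?F0 ?v0.
  apply: (smoothM oP sF (smooth_inv oP _ (smooth_powR _ oP v0 sv))) => s s0.
  by rewrite powR_gt0 ?v0.
apply: (@radial_solution_with_growth _ m p q k u v F dF P dP Fg c r0 m1 sk su sv sF k0 u0 v0 du dFE
  _ _ _ Plo Phi c0 hg) => s s0.
- by rewrite km// divfK// gt_eqF// powR_gt0 ?v0.
- have -> : (k s * v s) `^ q = (F s * v s) `^ (q / m) => //; last exact: F_ineq.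
  have kv0 : 0 < k s * v s by rewrite mulr_gt0 ?k0 ?v0.
  have -> : F s * v s = (k s * v s) `^ m.
    by rewrite powRM ?ltW ?k0 ?v0// km// vm//; field; rewrite gt_eqF// powR_gt0 ?v0.
  by rewrite -powRrM mulrCA mulfV ?mulr1// gt_eqF.
- have [h1 h2] := hP s s0; split=> //.
  have : (k s * `|dP s|) `^ m <= 1 `^ m.
    rewrite powR1 (powRM _ (ltW (k0 s s0)) (normr_ge0 _)) km// mulrAC.
    by rewrite ler_pdivrMr ?mul1r// powR_gt0 ?v0.
  have kd : 0 <= k s * `|dP s| by rewrite mulr_ge0// ltW// k0.
  by rewrite powR1 => /powR_le1; apply.
Qed.

Lemma growth_le {R : realType} (m p q : R) (F G : R -> R) r1 : (forall r, r1 <= r -> F r <= G r) ->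
  solution_with_growth m p q F -> solution_with_growth m p q G.
Proof.
move=> FG [n [M [mu [x [h1 h2 h3 [c c0 [r0 h]] h5]]]]]; exists n, M, mu, x; split=> //.
exists c => //; exists (Num.max r0 r1) => r; rewrite ge_max => /andP[r0r r1r].
by apply: le_trans (h r r0r) _; rewrite lee_fin ler_pM2l// FG.
Qed.

Section exponential_growth.
Context {R : realType}.
Variables (m p q K a0 mu : R).
Hypothesis m1 : 1 < m.
Hypothesis K0 : 0 < K.
Hypothesis a0_ge0 : 0 <= a0.
Hypothesis mu2 : mu * (m - 1) = 2^-1.
Hypothesis base : forall s, 0 < s ->
  (a0 + s `^ (- mu)) `^ p * (K * mu * s `^ (- mu)) `^ q <= K / 2 * (K * mu) `^ (m - 1) * s `^ (- 2^-1).

(** With [mu (m - 1) = 1 / 2] and this value of [A], the function [k] is exactly [K s]. The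
    arclength is [ln s / K], infinite at both ends, and [|grad u| = K mu s^(-mu)], so [base] is the
    differential inequality itself. *)
Lemma exponential_solution : solution_with_growth m p q (fun r => expR (K * r)).
Proof.
have oP := @open_pos R.
have m0 : 0 < m by exact: lt_trans ltr01 m1.
have mu0 : 0 < mu by rewrite -(@pmulr_lgt0 _ (m - 1)) ?subr_gt0 ?mu2 ?invr_gt0.
pose A := K `^ m * mu `^ (m - 1).
have A0 : 0 < A by rewrite mulr_gt0 ?powR_gt0.
pose v s := mu * s `^ (- mu - 1).
have v0 s : 0 < s -> 0 < v s by move=> s0; rewrite mulr_gt0 ?powR_gt0.
have Fv s : 0 < s -> A * s `^ 2^-1 * v s = (K * mu * s `^ (- mu)) `^ m.
  move=> s0; rewrite /A /v !powRM ?mulr_ge0 ?powR_ge0 ?ltW// -powRrM.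
  rewrite (powR_succ m mu0).
  have -> : s `^ (- mu * m) = s `^ 2^-1 * s `^ (- mu - 1).
    rewrite -powRD_gt0//; congr (_ `^ _); have : mu * m = mu * (m - 1) + mu by ring.
    by rewrite mu2; lra.
  ring.
apply: (@solution_of_profile _ m p q (fun s => a0 + s `^ (- mu)) v (fun s => A * s `^ 2^-1)
   (fun s => A / 2 * s `^ (- 2^-1)) (fun s => K^-1 * ln s) (fun s => K^-1 / s) _ 1 0) => //.
- exact: (smoothD oP (smooth_cst _ a0 oP) (@smooth1_powR R _)).
- exact: (smoothM oP (smooth_cst _ A oP) (@smooth1_powR R _)).
- by move=> s s0; rewrite ltr_wpDl// powR_gt0.
- by move=> s s0; rewrite mulr_gt0 ?powR_gt0.
- move=> s s0; apply: is_derive_eq (is_derive_add (is_derive_const a0 s)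
    (is_derive_pow (- mu) s0 (is_derive_self s))) _.
  by rewrite /v; ring.
- move=> s s0; apply: is_derive_eq (is_derive_mulc A (is_derive_pow 2^-1 s0 (is_derive_self s))) _.
  have -> : 2^-1 - 1 = - 2^-1 :> R by lra.
  by field.
- move=> s s0; rewrite Fv// -powRrM mulrCA mulfV ?mulr1; last by rewrite gt_eqF.
  apply: le_trans (base s0) _; rewrite ler_pM2r ?powR_gt0// /A.
  rewrite (powR_succ m K0).
  by rewrite (powRM _ (ltW K0) (ltW mu0)) le_eqVlt; apply/orP; left; apply/eqP; field.
- move=> s s0; split.
    apply: is_derive_eq (is_derive_mulc K^-1 (is_derive_log s0 (is_derive_self s))) _.
    by rewrite mul1r.
  rewrite gtr0_norm ?divr_gt0 ?invr_gt0//.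
  have h1 : 0 <= K * mu * s `^ (- mu) by rewrite !mulr_ge0 ?powR_ge0// ltW.
  have h2 : 0 <= K^-1 / s by rewrite divr_ge0 ?invr_ge0// ltW.
  have e : v s = K * mu * s `^ (- mu) * (K^-1 / s).
    rewrite /v powRD_gt0// -[s^-1](powR_inv1 (ltW s0)); field.
    by rewrite gt_eqF.
  have hh : A * s `^ 2^-1 * (K^-1 / s) `^ m * v s = v s `^ m.
    by rewrite mulrAC (Fv s s0) [in RHS]e (powRM _ h1 h2).
  by rewrite -(ler_pM2r (v0 s s0)) hh (powR_succ m (v0 s s0)).
- move=> B; exists (expR (- `|K * B|)).
    by rewrite expR_gt0 -[leRHS]expR0 ler_expR oppr_le0 normr_ge0.
  rewrite expRK ler_pdivrMl//; exact: lerNnormlW.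
- move=> B; exists (expR `|K * B|).
    by rewrite -[leLHS]expR0 ler_expR.
  rewrite expRK ler_pdivlMl//; exact: ler_norm.
- move=> r r0; split=> [|s s0]; first exact: expR_ge0.
  rewrite mul1r -ler_pdivlMl ?invr_gt0// invrK mulrDr mulrA mulfV ?gt_eqF// mul1r => h.
  rewrite -[leLHS](@lnK _ s) ?posrE// ler_expR (le_trans h)// gerDr.
  by apply: ln_le0; rewrite invf_le1//; lra.
Qed.

End exponential_growth.

Lemma critical_negative_power {R : realType} (m p q lam : R) : 1 < m -> q = m - 1 -> p < 0 ->
  0 < lam -> solution_with_growth m p q (fun r => expR (lam * r)).
Proof.
(* Chosen so that [a0^p = lam / 2], the factor [K / 2] of [base]. As [p < 0], adding the positive
   term [s^(-mu)] to [a0] only decreases the power. *)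
move=> m1 qE p0 l0; pose a0 := (lam / 2) `^ p^-1.
have a0_gt0 : 0 < a0 by rewrite powR_gt0// divr_gt0.
pose mu := (2 * (m - 1))^-1.
have mu0 : 0 < mu by rewrite invr_gt0; lra.
have mu2 : mu * (m - 1) = 2^-1 by rewrite /mu invfM -mulrA mulVf ?mulr1// gt_eqF//; lra.
apply: (exponential_solution m1 l0 (ltW a0_gt0) mu2) => s s0.
have s1 := powR_ge0 s (- mu); have lm : 0 <= lam * mu by rewrite mulr_ge0// ltW.
rewrite qE (powRM _ lm s1) -[(s `^ _) `^ (m - 1)]powRrM mulNr mu2.
rewrite mulrA ler_pM2r ?powR_gt0// ler_pM2r ?powR_gt0 ?mulr_gt0//.
have l2 : 0 < lam / 2 by rewrite divr_gt0.
have -> : lam / 2 = a0 `^ p by rewrite -powRrM mulVf ?(lt_eqF p0)// powRr1// ltW.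
have h : a0 <= a0 + s `^ (- mu) by rewrite lerDl powR_ge0.
have h0 : 0 < a0 + s `^ (- mu) by rewrite (lt_le_trans a0_gt0).
rewrite -[p]opprK [leLHS]powRN [leRHS]powRN lef_pV2 ?posrE ?powR_gt0//.
by apply: powR_le => //; rewrite ?oppr_ge0 ltW.
Qed.

Lemma critical_sum {R : realType} (m p q : R) : 1 < m -> p = m - 1 - q -> q <= m - 1 ->
  exists2 iota : R, 0 < iota & solution_with_growth m p q (fun r => expR (iota * r)).
Proof.
move=> m1 pE qm; pose mu := (2 * (m - 1))^-1.
have mu0 : 0 < mu by rewrite invr_gt0; lra.
(* Both sides of [base] are multiples of [s^(-1/2)], because [p + q = m - 1]. The constants compare
   when [K >= 2] and [K mu >= 1]. *)
pose K := 2 + mu^-1.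
have K0 : 0 < K by rewrite addr_gt0// invr_gt0.
have mu2 : mu * (m - 1) = 2^-1 by rewrite /mu invfM -mulrA mulVf ?mulr1// gt_eqF//; lra.
exists K => //; apply: (exponential_solution m1 K0 (lexx 0) mu2) => s s0; rewrite add0r.
have s1 := powR_ge0 s (- mu); have Km0 : 0 <= K * mu by rewrite mulr_ge0// ltW.
rewrite (powRM _ Km0 s1) mulrCA -[_ `^ p]powRrM -[(s `^ _) `^ q]powRrM -powRD_gt0//.
have -> : - mu * p + - mu * q = - 2^-1.
  by move: mu2; rewrite pE; lra.
rewrite ler_pM2r ?powR_gt0//.
have Km : 1 <= K * mu by rewrite mulrDl mulVf ?gt_eqF// lerDr mulr_ge0// ltW.
apply: (@le_trans _ _ ((K * mu) `^ (m - 1))); first exact: ler_powR.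
by rewrite ler_peMl ?powR_ge0// ler_pdivlMr// mul1r lerDl invr_ge0 ltW.
Qed.

(** Scaling [F] by [A] multiplies the source by [A^(q/m)] and [F'] by [A]. For [q < m] this choice
    of [A] absorbs a constant [B] lost in the estimates. *)
Lemma scaling_constant {R : realType} (r B : R) : r < 1 -> 0 < B ->
  exists2 A : R, 0 < A & A `^ r * B = A.
Proof.
move=> r1 B0; have r0 : 1 - r != 0 by rewrite subr_eq0 gt_eqF.
exists (B `^ (1 - r)^-1); first by rewrite powR_gt0.
rewrite -powRrM -[X in _ * X](powRr1 (ltW B0)) -powRD_gt0//; congr (_ `^ _).
by field.
Qed.

(** Since [F = k^m v^(m-1)], the first inequality says that [kap] bounds [k] from above, and
    [kap |d| <= 1] implies the condition of [solution_of_profile]. *)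
Lemma arclength_bound {R : realType} (m F v kap d : R) : 0 < m -> 0 <= kap -> 0 <= v ->
  F <= v `^ (m - 1) * kap `^ m -> kap * `|d| <= 1 -> F * `|d| `^ m <= v `^ (m - 1).
Proof.
move=> m0 k0 v0 hF hd.
apply: (@le_trans _ _ (v `^ (m - 1) * kap `^ m * `|d| `^ m)).
  by apply: ler_wpM2r => //; exact: powR_ge0.
rewrite -mulrA -powRM// ler_piMr ?powR_ge0//.
have -> : 1 = 1 `^ m :> R by rewrite powR1.
by apply: powR_le => //; [exact: ltW|exact: mulr_ge0].
Qed.

(** The base on the left is [y^a + 1], at most [2 (1 + y)^a]. The lemma controls the powers of [u]
    near [s = 0], where [u] blows up. *)
Lemma powR_sum_bound {R : realType} (y a D : R) : 0 < y -> 0 <= a -> 0 <= D ->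
  (1 + y `^ (- a)) `^ D * y `^ (a * D) <= 2 `^ D * (1 + y) `^ (a * D).
Proof.
move=> y0 a0 D0; have [h1 h2] := (powR_ge0 y a, powR_ge0 (1 + y) a).
have h3 : 0 <= 1 + y `^ (- a) by rewrite addr_ge0// powR_ge0.
have -> : (1 + y `^ (- a)) `^ D * y `^ (a * D) = ((1 + y `^ (- a)) * y `^ a) `^ D.
  by rewrite (powRM _ h3 h1) powRrM.
have -> : 2 `^ D * (1 + y) `^ (a * D) = (2 * (1 + y) `^ a) `^ D.
  by rewrite (powRM _ (ler0n _ 2) h2) powRrM.
apply: powR_le => //; first exact: mulr_ge0.
rewrite mulrDl mul1r -powRD_gt0// addNr powRr0 mulr_natl mulr2n.
apply: lerD; first by apply: powR_le => //; [exact: ltW|lra].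
by apply: powR_ge1 => //; lra.
Qed.

(** * The profile for (F), in the variable [x = ln (1 + s)] *)

Section subcritical.
Context {R : realType}.
Variables (m p q mu g A : R).
Hypothesis m1 : 1 < m.
Hypothesis pD : p < m - 1 - q.
Hypothesis qm : q < m - 1.
Hypothesis mu0 : 0 < mu.
Hypothesis mum : mu * (m - 1) <= 1 / 2.
Hypothesis muD : mu * (m - 1 - q) <= 1 / 2.
Hypothesis g0 : 0 < g.
Hypothesis gm : g * m <= 1 / 4.
Hypothesis gq : g * (m - q) <= 1 / 2.
Hypothesis A0 : 0 < A.
Hypothesis AE : A `^ (q / m) * (4 * 2 `^ (m - 1 - q) * mu `^ (q / m)) = A.

Let m0 : 0 < m. Proof. exact: lt_trans ltr01 m1. Qed.
Let g1 : g <= 1.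
Proof.
have : g * 1 <= g * m by rewrite ler_pM2l// ltW.
by move: gm; lra.
Qed.

Let x (s : R) := ln (1 + s).
Let al : R := 1 - mu * (m - 1).
Let u s := 1 + x s `^ (- mu).
Let v s := mu * x s `^ (- mu - 1) / (1 + s).
Let F s := A * ((1 + s) * (x s `^ al * (1 + x s) `^ (- (g * m)))).
Let dF s := A * (x s `^ (al - 1) * (1 + x s) `^ (- (g * m) - 1) *
  (x s * (1 + x s) + al * (1 + x s) - g * m * x s)).

Let x0 (s : R) : 0 < s -> 0 < x s. Proof. by move=> s0; rewrite ln_gt0//; lra. Qed.
Let S0 (s : R) : 0 < s -> 0 < 1 + s. Proof. by move=> s0; lra. Qed.
Let X0 (s : R) : 0 < s -> 0 < 1 + x s. Proof. by move=> /x0; lra. Qed.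

Let dx (s : R) : 0 < s -> is_derive s 1 x (1 + s)^-1.
Proof.
move=> s0; apply: is_derive_eq (is_derive_log (S0 s0) (is_derive_add (is_derive_const 1 s) (is_derive_self s))) _.
by rewrite add0r mul1r.
Qed.

Let v0 (s : R) : 0 < s -> 0 < v s.
Proof. by move=> s0; rewrite /v divr_gt0 ?mulr_gt0 ?powR_gt0 ?x0 ?S0. Qed.

Let F0 (s : R) : 0 < s -> 0 < F s.
Proof. by move=> s0; rewrite /F !mulr_gt0 ?powR_gt0 ?X0 ?x0 ?S0. Qed.

Let du (s : R) : 0 < s -> is_derive s 1 u (- v s).
Proof.
move=> s0; apply: is_derive_eq (is_derive_add (is_derive_const 1 s) (is_derive_pow (- mu) (x0 s0) (dx s0))) _.
by rewrite /v add0r; ring.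
Qed.

Let dFE (s : R) : 0 < s -> is_derive s 1 F (dF s).
Proof.
move=> s0; have xs := x0 s0; have Xs := X0 s0; have Ss := S0 s0.
apply: is_derive_eq (is_derive_mulc A (is_derive_mul (is_derive_add (is_derive_const 1 s) (is_derive_self s))
  (is_derive_mul (is_derive_pow al xs (dx s0))
    (@is_derive_pow _ (- (g * m)) (fun y => 1 + x y) s _ Xs (is_derive_add (is_derive_const 1 s) (dx s0)))))) _.
rewrite /dF (powR_succ al xs) (powR_succ (- (g * m)) Xs).
by field; rewrite gt_eqF.
Qed.

Let FvE (s : R) : 0 < s -> (F s * v s) `^ (q / m) =
  A `^ (q / m) * mu `^ (q / m) * (x s `^ (- mu * q) * (1 + x s) `^ (- (g * q))).
Proof.
move=> s0; have xs := x0 s0; have Xs := X0 s0; have Ss := S0 s0.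
have -> : F s * v s = A * mu * (x s `^ (- (mu * m)) * (1 + x s) `^ (- (g * m))).
  rewrite /F /v; have -> : x s `^ (- (mu * m)) = x s `^ al * x s `^ (- mu - 1).
    by rewrite -powRD_gt0//; congr (_ `^ _); rewrite /al; ring.
  by field; rewrite gt_eqF.
have nn := powR_ge0.
rewrite powRM ?mulr_ge0 ?powR_ge0 ?(ltW A0) ?(ltW mu0)//.
rewrite (powRM _ (ltW A0) (ltW mu0)) (powRM _ (nn _ _ _) (nn _ _ _)) -!powRrM.
by congr (_ * (_ `^ _ * _ `^ _)); field; rewrite gt_eqF.
Qed.

(** As [u >= 1], the power [p] may be raised to [D = m - 1 - q]. The powers of [x] then match
    exactly, those of [1 + x] compare by [muD] and [gq], and [AE] accounts for the constants. *)
Let F_ineq (s : R) : 0 < s -> u s `^ p * (F s * v s) `^ (q / m) <= dF s.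
Proof.
move=> s0; have xs := x0 s0; have Xs := X0 s0; have Ss := S0 s0.
rewrite FvE//; set D := m - 1 - q.
have D0 : 0 <= D by rewrite /D subr_ge0 ltW.
have u1 : 1 <= u s by rewrite lerDl powR_ge0.
have h1 : u s `^ p <= u s `^ D by rewrite ler_powR// ltW.
have h2 : u s `^ D * x s `^ (mu * D) <= 2 `^ D * (1 + x s) `^ (mu * D).
  exact: powR_sum_bound xs (ltW mu0) D0.
have h3 : (1 + x s) `^ (mu * D - g * q) <= (1 + x s) `^ (1 - g * m).
  apply: ler_powR; first by rewrite lerDl ltW.
  by rewrite /D; clear AE; move: muD gq; lra.
apply: (@le_trans _ _ (A / 4 * (x s `^ (- (mu * (m - 1))) * (1 + x s) `^ (1 - g * m)))); last first.
  have -> : (1 + x s) `^ (1 - g * m) = (1 + x s) `^ (- (g * m) - 1) * (1 + x s) ^+ 2.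
    by rewrite -powR_mulrn ?(ltW Xs)// -powRD_gt0//; congr (_ `^ _); ring.
  have -> : - (mu * (m - 1)) = al - 1 by rewrite /al; ring.
  rewrite /dF -mulrA ler_pM2l// mulrCA -[leRHS]mulrA ler_pM2l ?powR_gt0// mulrCA ler_pM2l ?powR_gt0//.
  (* Since [al >= 1 / 2] and [g m <= 1 / 4], the last factor of [dF] is at least a quarter of the
     square of [1 + x]. *)
  by clear AE; rewrite /al; move: mum gm; set y := mu * _; set w := g * m; nra.
have -> : A / 4 = A `^ (q / m) * mu `^ (q / m) * 2 `^ D.
  by rewrite -[in LHS]AE -/D; field.
have -> : x s `^ (- mu * q) = x s `^ (mu * D) * x s `^ (- (mu * (m - 1))).
  by rewrite -powRD_gt0//; congr (_ `^ _); rewrite /D; ring.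
have AM : 0 <= A `^ (q / m) * mu `^ (q / m) by rewrite mulr_ge0 ?powR_ge0.
rewrite mulrCA -[leRHS]mulrA; apply: ler_wpM2l => //.
apply: (@le_trans _ _ (u s `^ D * x s `^ (mu * D) * (x s `^ (- (mu * (m - 1))) * (1 + x s) `^ (- (g * q))))).
  rewrite -!mulrA; apply: ler_wpM2r => //; by rewrite !mulr_ge0 ?powR_ge0.
apply: (@le_trans _ _ (2 `^ D * (1 + x s) `^ (mu * D) * (x s `^ (- (mu * (m - 1))) * (1 + x s) `^ (- (g * q))))).
  by apply: ler_wpM2r; rewrite ?mulr_ge0 ?powR_ge0.
rewrite -mulrA; apply: ler_wpM2l; first exact: powR_ge0.
rewrite mulrCA; apply: ler_wpM2l; first exact: powR_ge0.
by rewrite -powRD_gt0.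
Qed.

Let E := (A / mu `^ (m - 1)) `^ m^-1.
Let E0 : 0 < E. Proof. by rewrite powR_gt0// divr_gt0 ?powR_gt0. Qed.
(** By [FE] below, [kap] is the function [k] of the metric. In the variable [x], the arclength
    element is [(1 + x)^g / (E x)], whose primitive behaves like [x^g] at infinity and like [ln x]
    at 0; [P] is a simple function with derivative at most that of the arclength. *)
Let P s := (2 * E)^-1 * ((1 + x s) `^ g + ln (x s)).
Let dP s := (2 * E)^-1 * ((g * (1 + x s) `^ (g - 1) + (x s)^-1) / (1 + s)).
Let kap s := E * ((1 + s) * (x s * (1 + x s) `^ (- g))).

Let FE (s : R) : 0 < s -> F s = v s `^ (m - 1) * kap s `^ m.
Proof.
move=> s0; have xs := x0 s0; have Xs := X0 s0; have Ss := S0 s0.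
have Em : E `^ m = A / mu `^ (m - 1).
  rewrite -powRrM mulVf ?gt_eqF// powRr1// divr_ge0 ?powR_ge0//; exact: ltW.
have nx := powR_ge0 (x s) (- mu - 1); have nX := powR_ge0 (1 + x s) (- g).
have -> : kap s `^ m = A / mu `^ (m - 1) * ((1 + s) `^ m * (x s `^ m * (1 + x s) `^ (- (g * m)))).
  rewrite /kap (powRM _ (ltW E0)) ?Em; last by rewrite !mulr_ge0// ltW.
  rewrite (powRM _ (ltW Ss)); last by rewrite !mulr_ge0// ltW.
  by rewrite (powRM _ (ltW xs) nX) -powRrM mulNr.
have -> : v s `^ (m - 1) = mu `^ (m - 1) * (x s `^ ((- mu - 1) * (m - 1)) * (1 + s) `^ (1 - m)).
  rewrite /v -mulrA (powRM _ (ltW mu0)); last by rewrite mulr_ge0// invr_ge0 ltW.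
  rewrite (powRM _ nx) ?invr_ge0 ?(ltW Ss)// -powRrM -[(1 + s)^-1]powR_inv1 ?(ltW Ss)// -powRrM.
  by congr (_ * (_ * _ `^ _)); ring.
have -> : F s = A * ((1 + s) `^ (m + (1 - m)) * (x s `^ (m + (- mu - 1) * (m - 1)) * (1 + x s) `^ (- (g * m)))).
  have -> : m + (1 - m) = 1 by ring.
  by rewrite /F powRr1 ?(ltW Ss)//; congr (_ * (_ * (_ `^ _ * _))); rewrite /al; ring.
rewrite (powRD_gt0 m (1 - m) Ss) (powRD_gt0 m _ xs).
by field; rewrite gt_eqF// powR_gt0.
Qed.

Let hP (s : R) : 0 < s -> is_derive s 1 P (dP s) /\ F s * `|dP s| `^ m <= v s `^ (m - 1).
Proof.
move=> s0; have xs := x0 s0; have Xs := X0 s0; have Ss := S0 s0.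
split.
  apply: is_derive_eq (is_derive_mulc (2 * E)^-1 (is_derive_add
    (@is_derive_pow _ g (fun y => 1 + x y) s _ Xs (is_derive_add (is_derive_const 1 s) (dx s0)))
    (is_derive_log xs (dx s0)))) _.
  by rewrite /dP add0r; congr (_ * _); rewrite mulrDl [_^-1 / _]mulrC.
have k0 : 0 <= kap s by rewrite /kap !mulr_ge0 ?powR_ge0// ltW.
apply: (arclength_bound m0 k0 (ltW (v0 s0))); first by rewrite FE.
have d0 : 0 <= dP s.
  apply: mulr_ge0; first by rewrite invr_ge0 mulr_ge0// ltW.
  apply: divr_ge0; last exact: ltW.
  by rewrite addr_ge0 ?invr_ge0 ?(ltW xs)// mulr_ge0 ?powR_ge0// ltW.
rewrite ger0_norm//.
have -> : kap s * dP s = (g * (x s / (1 + x s)) + (1 + x s) `^ (- g)) / 2.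
  have -> : x s / (1 + x s) = x s * ((1 + x s) `^ (- g) * (1 + x s) `^ (g - 1)).
    by rewrite -powRD_gt0// addrA addNr add0r powR_inv1// ltW.
  by rewrite /kap /dP; field; rewrite !gt_eqF.
rewrite ler_pdivrMr// mul1r.
have h1 : x s / (1 + x s) <= 1 by rewrite ler_pdivrMr// mul1r lerDr.
have h2 : (1 + x s) `^ (- g) <= 1.
  by rewrite -[leRHS](powRr0 (1 + x s)) ler_powR ?lerDl ?(ltW xs)// oppr_le0 ltW.
have h3 : g * (x s / (1 + x s)) <= 1.
  have h0 : 0 <= x s / (1 + x s) by apply: divr_ge0; exact: ltW.
  by rewrite mulr_ile1// ltW.
by rewrite -[2]/(1 + 1) lerD.
Qed.

Let Plo B : exists2 s : R, 0 < s <= 1 & P s <= B.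
Proof.
(* For [s <= 1] the term [(1 + x)^g] is at most 2, which is the 2 subtracted here, and
   [ln x <= ln s]. *)
exists (expR (- `|2 * E * B - 2|)).
  by rewrite expR_gt0 -[leRHS]expR0 ler_expR oppr_le0 normr_ge0.
set s := expR _; have s0 : 0 < s by exact: expR_gt0.
have s1 : s <= 1 by rewrite -[leRHS]expR0 ler_expR oppr_le0 normr_ge0.
have xs := x0 s0.
have xle : x s <= s by rewrite /x -[leRHS]expRK ler_ln ?posrE ?expR_gt0 ?S0 ?expR_ge1Dx.
rewrite /P ler_pdivrMl ?mulr_gt0//.
have h1 : (1 + x s) `^ g <= 2.
  apply: (@le_trans _ _ (1 + x s)); last by lra.
  by apply: ler1_powR => //; lra.
have h2 : ln (x s) <= ln s by rewrite ler_ln ?posrE.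
have h3 : ln s = - `|2 * E * B - 2| by rewrite /s expRK.
apply: le_trans (lerD h1 h2) _; rewrite h3 -lerBrDl.
exact: lerNnormlW (lexx _).
Qed.

Let Phi B : exists2 s : R, 1 <= s & B <= P s.
Proof.
have e1 : 1 <= expR `|2 * E * B| by rewrite -[leLHS]expR0 ler_expR.
exists (expR (expR `|2 * E * B|)).
  by rewrite -[leLHS]expR0 ler_expR ltW// expR_gt0.
set s := expR _; have s0 : 0 < s by exact: expR_gt0.
have h1 : expR `|2 * E * B| <= x s.
  by rewrite -[leLHS]expRK -/s /x ler_ln ?posrE ?S0// lerDr.
rewrite /P ler_pdivlMl ?mulr_gt0//.
have h2 : `|2 * E * B| <= ln (x s) by rewrite -[leLHS]expRK ler_ln ?posrE ?expR_gt0 ?x0.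
apply: le_trans (ler_norm _) (le_trans h2 _).
by rewrite lerDr powR_ge0.
Qed.

Lemma subcritical_solution lam : 0 < lam ->
  solution_with_growth m p q (fun r => expR (lam * r `^ g^-1 * ln r)).
Proof.
move=> l0; have oP := @open_pos R.
have S1 : smooth1 [set x | 0 < x] (fun s : R => 1 + s).
  exact: (smoothD oP (smooth_cst _ 1 oP) (smooth_sub (@subsetT _ _) (@smooth1_id R))).
have sx : smooth1 [set x | 0 < x] x by exact: (smooth_ln oP S0 S1).
have sX : smooth1 [set x | 0 < x] (fun s => 1 + x s) by exact: (smoothD oP (smooth_cst _ 1 oP) sx).
have su : smooth1 [set x | 0 < x] u.
  exact: (smoothD oP (smooth_cst _ 1 oP) (smooth_powR _ oP x0 sx)).
have sF : smooth1 [set x | 0 < x] F.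
  exact: (smoothM oP (smooth_cst _ A oP) (smoothM oP S1 (smoothM oP (smooth_powR _ oP x0 sx)
    (smooth_powR _ oP X0 sX)))).
have u0 (s : R) : 0 < s -> 0 < u s by move=> s0; rewrite ltr_pwDl// powR_ge0.
pose c1 := 2 * E * P 2^-1; pose C := (2 * E + 1) `^ g^-1.
have C0 : 0 < C by rewrite powR_gt0// ltr_wpDl// mulr_ge0// ltW.
(* On the ball of radius [r], [x] is at most [C r^(1/g)]. The second threshold gives
   [C <= lam ln r], so the factor [ln r] absorbs [C] and [lam] can be arbitrary; the first makes [r]
   dominate the value of [P] at the base point. *)
apply: (@solution_of_profile _ m p q u v F dF P dP _ 1 (Num.max (1 + `|c1|) (expR (C / lam)))) => //.
move=> r; rewrite ge_max => /andP[r1 r2]; split; first exact: expR_ge0.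
move=> s s0 hs; have xs := x0 s0; have Xs := X0 s0.
have r0 : 0 < r by apply: lt_le_trans r1; rewrite ltr_pwDl.
have r11 : 1 <= r by apply: le_trans r1; rewrite lerDl.
have E2 : 0 < 2 * E by rewrite mulr_gt0.
have xr : x s <= C * r `^ g^-1.
  rewrite /C -powRM ?(ltW r0)//; last by rewrite addr_ge0// ltW.
  have h0 : 1 <= (2 * E + 1) * r by rewrite -[leLHS]mulr1 ler_pM// lerDr ltW.
  have [x1|x1] := leP 1 (x s); last first.
    by apply: le_trans (ltW x1) _; rewrite powR_ge1// invr_ge0 ltW.
  have -> : x s = (x s `^ g) `^ g^-1 by rewrite -powRrM mulfV ?gt_eqF// powRr1// ltW.
  apply: powR_le; rewrite ?invr_ge0 ?powR_ge0 ?(ltW g0)//.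
  move: hs; rewrite /P ler_pdivrMl// mulrDr -/(P 2^-1) -/c1 => hs.
  have h1 : x s `^ g <= (1 + x s) `^ g by apply: powR_le; rewrite ?(ltW g0) ?(ltW xs)// lerDr.
  have h2 : 0 <= ln (x s) by exact: ln_ge0.
  have h3 := ler_norm c1.
  by rewrite mulrDl mul1r; lra.
rewrite mul1r -[s](@lnK _ s) ?posrE// ler_expR.
apply: (@le_trans _ _ (x s)); first by rewrite ler_ln ?posrE ?S0// lerDr.
apply: le_trans xr _; rewrite mulrAC; apply: ler_wpM2r; first exact: powR_ge0.
rewrite mulrC -ler_pdivrMr// -[leLHS]expRK ler_ln ?posrE ?expR_gt0//.
Qed.

End subcritical.

Lemma subcritical_growth {R : realType} (m p q lam : R) : 1 < m -> p < m - 1 - q -> q < m - 1 ->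
  0 < lam -> exists iota : R, [/\ 0 < iota, 2 * (m - 1 - q) + 1 < iota &
    solution_with_growth m p q (fun r => expR (lam * r `^ iota * ln r))].
Proof.
move=> m1 pD qm l0.
(* The inverses of [mu] and [g], taken as sums large enough for all the bounds on [mu] and [g] at
   once; [i2] is the exponent [iota] and also exceeds [2 (m - 1 - q) + 1]. *)
pose i1 := 2 * (m - 1) + 2 * (m - 1 - q); pose i2 := 4 * m + 2 * (m - q) + 2.
have i10 : 0 < i1 by rewrite /i1; lra.
have i20 : 0 < i2 by rewrite /i2; lra.
have le_inv (i b c : R) : 0 < i -> c * b <= i -> 0 < c -> i^-1 * b <= 1 / c.
  by move=> i0 h c0; rewrite ler_pdivlMr// -mulrA ler_pdivrMl// mulr1 mulrC.
have qm1 : q / m < 1 by rewrite ltr_pdivrMr; lra.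
have B0 : 0 < 4 * 2 `^ (m - 1 - q) * i1^-1 `^ (q / m) :> R by rewrite !mulr_gt0// powR_gt0// invr_gt0.
have [A A0 AE] := scaling_constant qm1 B0.
exists i2; split=> //; first by rewrite /i2; lra.
rewrite -[i2]invrK; apply: (@subcritical_solution _ m p q i1^-1 i2^-1 A) => //.
- by rewrite invr_gt0.
- by apply: le_inv => //; rewrite /i1; lra.
- by apply: le_inv => //; rewrite /i1; lra.
- by rewrite invr_gt0.
- by apply: le_inv => //; rewrite /i2; lra.
- by apply: le_inv => //; rewrite /i2; lra.
Qed.

(** * Polynomial growth with logarithmic corrections *)

Section logarithms.
Context {R : realType}.
Implicit Types (x y a b : R).

Lemma log1_le y : 0 < y -> 1 + ln y <= y.
Proof. by move=> y0; rewrite -[leRHS](@lnK _ y) ?posrE// expR_ge1Dx. Qed.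

Lemma log1_le_powR a y : 0 < a -> 1 <= y -> 1 + ln y <= (1 + a^-1) * y `^ a.
Proof.
move=> a0 y1; have y0 : 0 < y by rewrite (lt_le_trans ltr01).
have h : 1 + a * ln y <= y `^ a by rewrite -ln_powR log1_le// powR_gt0.
have ya : 1 <= y `^ a by rewrite powR_ge1// ltW.
have -> : ln y = a^-1 * (a * ln y) by rewrite mulrA mulVf ?mul1r// gt_eqF.
rewrite mulrDl mul1r lerD// ler_pM2l ?invr_gt0//.
by apply: le_trans h; rewrite lerDr.
Qed.

(** [log1_le_powR] with the exponent [a / (b + 1)], raised to the power [b + 1]; using [b + 1]
    rather than [b] avoids dividing by 0 when [b = 0]. *)
Lemma log_powR_le a b : 0 < a -> 0 <= b ->
  exists2 C, 0 < C & forall y, 1 <= y -> (1 + ln y) `^ b <= C * y `^ a.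
Proof.
move=> a0 b0; have b1 : 0 < b + 1 by rewrite ltr_wpDl.
pose a' := a / (b + 1); have a'0 : 0 < a' by rewrite divr_gt0.
have C0 : 0 < 1 + a'^-1 by rewrite addr_gt0// invr_gt0.
exists ((1 + a'^-1) `^ (b + 1)); first by rewrite powR_gt0.
move=> y y1; have l1 : 1 <= 1 + ln y by rewrite lerDl ln_ge0.
apply: (@le_trans _ _ ((1 + ln y) `^ (b + 1))); first by rewrite ler_powR// lerDl.
have -> : y `^ a = (y `^ a') `^ (b + 1) by rewrite -powRrM /a' divfK// gt_eqF.
rewrite -powRM ?powR_ge0 ?(ltW C0)//.
apply: powR_le; [exact: ltW|exact: le_trans l1|exact: log1_le_powR].
Qed.

Lemma powR_expR x a : 0 < x -> x `^ a = expR (a * ln x).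
Proof. by move=> x0; rewrite /powR gt_eqF. Qed.

(** For [r >= 0] the upper bound on [f] is used and for [r < 0] the lower one; the sum of the two
    constants treats both signs of [q] together. *)
Lemma powR_sandwich (r k C : R) : 0 < k -> 0 < C ->
  exists2 B, 0 < B & forall f h : R, 0 < h -> k * h <= f -> f <= C * h -> f `^ r <= B * h `^ r.
Proof.
move=> k0 C0; exists (k `^ r + C `^ r); first by rewrite addr_gt0// powR_gt0.
move=> f h h0 kf fC; have f0 : 0 < f by apply: lt_le_trans kf; rewrite mulr_gt0.
rewrite mulrDl -!powRM ?(ltW k0) ?(ltW C0) ?(ltW h0)//.
have [r0|r0] := leP 0 r.
  by apply: ler_wpDl; [exact: powR_ge0|apply: powR_le => //; exact: ltW].
apply: ler_wpDr; first exact: powR_ge0.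
rewrite -[r]opprK ![_ `^ (- - r)]powRN lef_pV2 ?posrE ?powR_gt0 ?mulr_gt0//.
by apply: powR_le; rewrite ?oppr_ge0 ?(ltW r0)// ltW// mulr_gt0.
Qed.

Lemma monomial_powR (x y z a b a' b' e p r : R) : 0 < x -> 0 < y -> 0 < z ->
  (x `^ a * y `^ b) `^ p * (x `^ a' * (y `^ b' * z `^ e)) `^ r =
  x `^ (a * p + a' * r) * (y `^ (b * p + b' * r) * z `^ (e * r)).
Proof.
move=> x0 y0 z0; rewrite !powRM ?mulr_ge0 ?powR_ge0// -!powRrM !powRD_gt0//.
by ring.
Qed.

End logarithms.

(** Stated on logarithms: with [a], [b], [y], [z] the logarithms of [s], [1 + s], [logS s],
    [logT s], the identity between monomials becomes a linear one between exponents. *)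
Lemma monomial_identity {R : realType} (m th et c d j a b y z : R) : m != 0 ->
  (expR b `^ (- th - 1) * expR y `^ (- et) *
    (expR b / expR a * (expR z `^ (- d - 1) * expR y `^ (- j)))) `^ (m - 1) *
  (expR a * (expR z * (expR b `^ (- ((1 - th * (m - 1)) / m)) *
     expR y `^ ((c + (et + j) * (m - 1)) / m)))) `^ m =
  expR a / expR b * (expR z `^ (1 - d * (m - 1)) * expR y `^ c).
Proof.
move=> n0; have pE (t r : R) : expR t `^ r = expR (r * t).
  by rewrite powR_expR ?expR_gt0// expRK.
rewrite !pE -!expRN -!expRD !pE -!expRD; congr expR.
by field.
Qed.

(** * The logarithmic profile for (A), (B) and (C) *)

Section log_profile.
Context {R : realType}.
Implicit Types (s : R).

(* [log_v] and [log_dF] are the derivatives of [- log_u] and [log_F].  Near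
   [s = 0] the factor [2 - logT s `^ (- d)] stays between 1 and 2 while its
   derivative is of order [logT s `^ (- d - 1) / s]; this is what makes the
   meridians long there. *)
Definition logS s : R := 1 + ln (1 + s).
Definition logT s : R := 1 + ln (1 + s^-1).

Lemma S_gt1 s : 0 < s -> 1 < 1 + s. Proof. by rewrite ltrDl. Qed.
Lemma S_gt0 s : 0 < s -> 0 < 1 + s. Proof. by move=> s0; rewrite addr_gt0. Qed.
Lemma T_gt0 s : 0 < s -> 0 < 1 + s^-1. Proof. by move=> s0; rewrite addr_gt0// invr_gt0. Qed.
Lemma logS_ge1 s : 0 < s -> 1 <= logS s. Proof. by move=> s0; rewrite lerDl ln_ge0// lerDl ltW. Qed.
Lemma logT_ge1 s : 0 < s -> 1 <= logT s.
Proof. by move=> s0; rewrite lerDl ln_ge0// lerDl invr_ge0 ltW. Qed.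
Lemma logS_gt0 s : 0 < s -> 0 < logS s. Proof. by move=> /logS_ge1; exact: lt_le_trans. Qed.
Lemma logT_gt0 s : 0 < s -> 0 < logT s. Proof. by move=> /logT_ge1; exact: lt_le_trans. Qed.
Lemma T_E s : 0 < s -> 1 + s^-1 = (1 + s) / s.
Proof. by move=> s0; field; rewrite gt_eqF. Qed.

Lemma is_derive_S s : is_derive s 1 (fun s : R => 1 + s) 1.
Proof.
by apply: is_derive_eq (is_derive_add (is_derive_const 1 s) (is_derive_self s)) _; rewrite add0r.
Qed.

Lemma is_derive_logS s : 0 < s -> is_derive s 1 logS (1 + s)^-1.
Proof.
move=> s0; apply: is_derive_eq (is_derive_add (is_derive_const 1 s)
  (is_derive_log (S_gt0 s0) (is_derive_S s))) _.
by rewrite add0r mul1r.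
Qed.

Lemma is_derive_logT s : 0 < s -> is_derive s 1 logT (- (s * (1 + s))^-1).
Proof.
move=> s0; have n0 : s != 0 by rewrite gt_eqF.
apply: is_derive_eq (is_derive_add (is_derive_const 1 s)
  (@is_derive_log _ (fun y => 1 + y^-1) s _ (T_gt0 s0) (is_derive_add (is_derive_const 1 s)
    (@is_derive_inv _ id s _ n0 (is_derive_self s))))) _.
by rewrite !add0r T_E//; field; rewrite n0 gt_eqF// S_gt0.
Qed.

Lemma smooth1_S : smooth1 [set x | 0 < x] (fun s : R => 1 + s).
Proof.
have oP := @open_pos R.
exact: (smoothD oP (smooth_cst _ 1 oP) (smooth_sub (@subsetT _ _) (@smooth1_id R))).
Qed.

Lemma smooth1_inv : smooth1 [set x | 0 < x] (fun s : R => s^-1).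
Proof.
have oP := @open_pos R.
exact: (smooth_inv oP (fun s h => h) (smooth_sub (@subsetT _ _) (@smooth1_id R))).
Qed.

Lemma smooth1_logS : smooth1 [set x | 0 < x] logS.
Proof.
have oP := @open_pos R.
exact: (smoothD oP (smooth_cst _ 1 oP) (smooth_ln oP S_gt0 smooth1_S)).
Qed.

Lemma smooth1_logT : smooth1 [set x | 0 < x] logT.
Proof.
have oP := @open_pos R.
exact: (smoothD oP (smooth_cst _ 1 oP) (smooth_ln oP T_gt0 (smoothD oP (smooth_cst _ 1 oP) smooth1_inv))).
Qed.

Variables (m th et c d j j0 j1 : R).
Hypothesis m1 : 1 < m.
Hypothesis et0 : 0 <= et.
Hypothesis c0 : 0 < c.
Hypothesis d0 : 0 < d.
Hypothesis dm : d * (m - 1) < 1.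
Hypothesis jr : 0 <= j <= 1.
Hypothesis j00 : 0 < j0.
Hypothesis j10 : 0 < j1.
(** [j] is 0 when [th > 0] and 1 when [th = 0]: in the second case [u] decays only through its
    logarithmic factor, and [v] carries one more inverse power of [logS]. *)
Hypothesis hj : forall y, 1 <= y -> j0 * y `^ (- j) <= th + et / y <= j1 * y `^ (- j).

Let om : R := 1 - d * (m - 1).
Let m0 : 0 < m. Proof. exact: lt_trans ltr01 m1. Qed.

Definition log_u s : R := (1 + s) `^ (- th) * logS s `^ (- et) * (2 - logT s `^ (- d)).
Definition log_W s : R := (th + et / logS s) * (2 - logT s `^ (- d)) + d * logT s `^ (- d - 1) / s.
Definition log_v s : R := (1 + s) `^ (- th - 1) * logS s `^ (- et) * log_W s.
Definition log_F s : R := s / (1 + s) * (logT s `^ om * logS s `^ c).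
Definition log_dF s : R := logT s `^ (om - 1) * logS s `^ (c - 1) / (1 + s) ^+ 2 *
  (logS s * (logT s - om) + c * s * logT s).

Lemma logT_powN s : 0 < s -> 0 <= logT s `^ (- d) <= 1.
Proof.
move=> s0; rewrite powR_ge0 /= -[leRHS](powRr0 (logT s)) ler_powR ?logT_ge1//.
by rewrite oppr_le0 ltW.
Qed.

Lemma log_u_bounds s : 0 < s ->
  (1 + s) `^ (- th) * logS s `^ (- et) <= log_u s <= 2 * ((1 + s) `^ (- th) * logS s `^ (- et)).
Proof.
move=> s0; have /andP[h1 h2] := logT_powN s0.
have Ss := S_gt0 s0; have Ls := logS_gt0 s0.
have h : 0 < (1 + s) `^ (- th) * logS s `^ (- et) by rewrite mulr_gt0// powR_gt0.
rewrite /log_u; apply/andP; split; first by rewrite ler_pMr//; lra.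
by rewrite [leRHS]mulrC ler_pM2l//; lra.
Qed.

Lemma is_derive_log_u s : 0 < s -> is_derive s 1 log_u (- log_v s).
Proof.
move=> s0; have Ss := S_gt0 s0; have Ls := logS_gt0 s0; have ls := logT_gt0 s0.
apply: is_derive_eq (is_derive_mul (is_derive_mul
   (@is_derive_pow _ (- th) (fun s => 1 + s) s _ Ss (is_derive_S s))
   (is_derive_pow (- et) Ls (is_derive_logS s0)))
  (is_derive_sub (is_derive_const 2 s) (is_derive_pow (- d) ls (is_derive_logT s0)))) _.
rewrite /log_v /log_W (powR_succ (- th) Ss) (powR_succ (- et) Ls).
by field; rewrite !gt_eqF.
Qed.

Lemma is_derive_log_F s : 0 < s -> is_derive s 1 log_F (log_dF s).
Proof.
move=> s0; have Ss := S_gt0 s0; have Ls := logS_gt0 s0; have ls := logT_gt0 s0.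
have nS : 1 + s != 0 by rewrite gt_eqF.
apply: is_derive_eq (is_derive_mul (is_derive_mul (is_derive_self s)
     (@is_derive_inv _ (fun s => 1 + s) s _ nS (is_derive_S s)))
   (is_derive_mul (is_derive_pow om ls (is_derive_logT s0)) (is_derive_pow c Ls (is_derive_logS s0)))) _.
rewrite /log_dF (powR_succ om ls) (powR_succ c Ls).
by field; rewrite !gt_eqF.
Qed.

(** A single monomial comparable to [log_W] at both ends: [logS^(-j)] dominates in [log_W] at
    infinity and [logT^(-d-1) / s] at 0. *)
Let w1 s : R := (1 + s^-1) * (logT s `^ (- d - 1) * logS s `^ (- j)).

Lemma log_W_bounds : exists k C : R, [/\ 0 < k, 0 < C &
  forall s, 0 < s -> k * w1 s <= log_W s <= C * w1 s].
Proof.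
(* [C0] bounds [logT^(d+1)] by a multiple of [1 + 1 / s]. This lets the first summand of [log_W],
   which carries no power of [logT], be estimated by [w1]. *)
have [C0 C00 hC] := @log_powR_le R 1 (d + 1) ltr01 (ltW (addr_gt0 d0 ltr01)).
have /andP[j_ge0 j_le1] := jr.
exists (Num.min j0 d), (2 * j1 * C0 + d); split.
- by rewrite lt_min j00.
- by rewrite addr_gt0// !mulr_gt0.
move=> s s0; have Ss := S_gt0 s0; have Ls := logS_gt0 s0; have ls := logT_gt0 s0.
have Ts := T_gt0 s0; have L1 := logS_ge1 s0; have si : 0 < s^-1 by rewrite invr_gt0.
have /andP[h1 h2] := logT_powN s0; have /andP[h3 h4] := hj L1.
set X := logS s `^ (- j); set Y := logT s `^ (- d - 1).
have X0 : 0 < X by rewrite powR_gt0.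
have Y0 : 0 < Y by rewrite powR_gt0.
have X1 : X <= 1.
  by rewrite -[leRHS](powRr0 (logS s)) ler_powR// oppr_le0.
have Y1 : Y <= 1.
  by rewrite -[leRHS](powRr0 (logT s)) ler_powR ?logT_ge1//; move: d0; lra.
have w1E : w1 s = Y * X + s^-1 * (Y * X) by rewrite /w1 mulrDl mul1r.
have aY : d * Y / s = d * (s^-1 * Y) by ring.
rewrite /log_W -/Y aY; apply/andP; split.
  have e1 : Num.min j0 d * (Y * X) <= th + et / logS s.
    apply: le_trans h3; apply: ler_pM; rewrite ?le_min ?(ltW j00) ?(ltW d0) ?mulr_ge0 ?(ltW X0) ?(ltW Y0)//.
      by rewrite ge_min lexx.
    by rewrite ler_piMl// ltW.
  have e2 : Num.min j0 d * (s^-1 * (Y * X)) <= d * (s^-1 * Y).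
    apply: ler_pM; rewrite ?le_min ?(ltW j00) ?(ltW d0) ?mulr_ge0 ?(ltW X0) ?(ltW Y0) ?(ltW si)//.
      by rewrite ge_min lexx orbT.
    by rewrite ler_pM2l// ler_piMr// ltW.
  rewrite w1E mulrDr lerD//; apply: le_trans e1 _.
  by rewrite ler_peMr//; [rewrite (le_trans _ h3)// mulr_ge0// ltW|lra].
rewrite [leRHS]mulrDl; apply: lerD.
  have e1 : 1 <= C0 * ((1 + s^-1) * Y).
    have T1 : 1 <= 1 + s^-1 by rewrite lerDl ltW.
    have := hC _ T1; rewrite powRr1 ?(ltW Ts)// -/(logT s) => hT.
    apply: (@le_trans _ _ (logT s `^ (d + 1) * Y)); last by rewrite mulrA ler_pM2r.
    by rewrite -powRD_gt0// (_ : _ + _ = 0) ?powRr0//; ring.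
  apply: (@le_trans _ _ (2 * (j1 * X))).
    rewrite mulrC; apply: ler_pM => //; first lra.
      by rewrite (le_trans _ h3)// mulr_ge0// ltW.
    lra.
  have -> : 2 * j1 * C0 * w1 s = 2 * (j1 * X) * (C0 * ((1 + s^-1) * Y)) by rewrite /w1 -/X -/Y; ring.
  by rewrite ler_peMr// !mulr_ge0// ltW.
rewrite ler_pM2l// /w1 -/X -/Y.
have -> : (1 + s^-1) * (Y * X) = s^-1 * Y * ((1 + s) * X) by rewrite T_E//; ring.
rewrite ler_peMr ?mulr_ge0 ?(ltW si) ?(ltW Y0)//.
have -> : X = (logS s `^ j)^-1 by rewrite /X powRN.
rewrite ler_pdivlMr ?powR_gt0// mul1r.
by apply: le_trans (ler1_powR L1 j_le1) _; rewrite log1_le.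
Qed.

Lemma log_v_gt0 s : 0 < s -> 0 < log_v s.
Proof.
move=> s0; have [k [C [k0 C0 h]]] := log_W_bounds; have /andP[h1 _] := h s s0.
rewrite /log_v mulr_gt0 ?(lt_le_trans _ h1)// ?mulr_gt0 ?powR_gt0 ?T_gt0 ?logT_gt0 ?logS_gt0//.
by rewrite addr_gt0.
Qed.

Lemma log_F_gt0 s : 0 < s -> 0 < log_F s.
Proof.
move=> s0; have ls := logT_gt0 s0; have Ls := logS_gt0 s0; have Ss := S_gt0 s0.
by rewrite /log_F mulr_gt0 ?divr_gt0// mulr_gt0 ?powR_gt0.
Qed.

Let hFv s : R := (1 + s) `^ (- th - 1) * (logS s `^ (c - et - j) * logT s `^ (- (d * m))).

Lemma log_Fv_bounds : exists k C : R, [/\ 0 < k, 0 < C &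
  forall s, 0 < s -> k * hFv s <= log_F s * log_v s <= C * hFv s].
Proof.
have [k [C [k0 C0 h]]] := log_W_bounds; exists k, C; split=> // s s0.
have Ss := S_gt0 s0; have Ls := logS_gt0 s0; have ls := logT_gt0 s0.
pose G := log_F s * ((1 + s) `^ (- th - 1) * logS s `^ (- et)).
have G0 : 0 < G by apply: mulr_gt0; [exact: log_F_gt0|apply: mulr_gt0; exact: powR_gt0].
have -> : log_F s * log_v s = G * log_W s by rewrite /log_v /G mulrA.
have e : hFv s = G * w1 s.
  rewrite /hFv /G /log_F /w1 T_E//.
  have -> : logT s `^ (- (d * m)) = logT s `^ om * logT s `^ (- d - 1).
    by rewrite -powRD_gt0//; congr (_ `^ _); rewrite /om; ring.
  rewrite !powRD_gt0//.
  by field; rewrite !gt_eqF.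
rewrite e ![_ * (G * _)]mulrCA !ler_pM2l//.
exact: h.
Qed.

(** As [logT >= 1] and [om > 0], [logT - om >= (1 - om) logT]. With the term [c s logT], this bounds
    the last factor of [log_dF] below by a multiple of [(1 + s) logT]. *)
Lemma log_dF_ge : exists2 k : R, 0 < k &
  forall s, 0 < s -> k * (logT s `^ om * logS s `^ (c - 1) / (1 + s)) <= log_dF s.
Proof.
have om1 : 0 < 1 - om by rewrite /om subKr mulr_gt0// subr_gt0.
have om0 : 0 < om by rewrite /om subr_gt0.
exists (Num.min (1 - om) c); first by rewrite lt_min om1.
move=> s s0; have Ss := S_gt0 s0; have Ls := logS_gt0 s0; have ls := logT_gt0 s0.
have L1 := logS_ge1 s0; have l1 := logT_ge1 s0.
rewrite /log_dF (powR_succ om ls).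
pose G := logT s `^ (om - 1) * logS s `^ (c - 1) / (1 + s) ^+ 2.
have G0 : 0 < G by rewrite divr_gt0 ?mulr_gt0 ?powR_gt0 ?exprn_gt0.
set K := Num.min _ _; rewrite -/G.
have -> : K * (logT s `^ (om - 1) * logT s * logS s `^ (c - 1) / (1 + s)) = G * (K * logT s * (1 + s)).
  by rewrite /G; field; rewrite gt_eqF.
rewrite ler_pM2l// mulrDr mulr1; apply: lerD.
  apply: (@le_trans _ _ (logT s - om)).
    have h : K <= 1 - om by rewrite ge_min lexx.
    apply: le_trans (ler_wpM2r (ltW ls) h) _.
    by rewrite mulrBl mul1r lerD2l lerN2 ler_peMr// ltW.
  by rewrite ler_peMl// subr_ge0 (le_trans _ l1)// /om lerBlDr lerDl mulr_ge0 ?subr_ge0 ?ltW.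
by rewrite mulrAC ler_pM2r// ler_pM2r// ge_min lexx orbT.
Qed.

(** Up to constants both sides are monomials in [1 + s], [logS] and [logT]. All three are at least
    1, so it is enough to compare exponents, which is what the three hypotheses do. *)
Lemma log_source (p q : R) : 1 <= th * p + (th + 1) * (q / m) ->
  (c - et - j) * (q / m) - et * p <= c - 1 -> d * (m - 1 - q) <= 1 ->
  exists2 B : R, 0 < B & forall s, 0 < s ->
    ((1 + s) `^ (- th) * logS s `^ (- et)) `^ p * (log_F s * log_v s) `^ (q / m) <= B * log_dF s.
Proof.
move=> hS hL hT; have [k [C [k0 C0 h]]] := log_Fv_bounds.
have [B B0 hB] := powR_sandwich (q / m) k0 C0; have [k' k'0 hk'] := log_dF_ge.
exists (B / k'); first exact: divr_gt0.
move=> s s0; have Ss := S_gt0 s0; have Ls := logS_gt0 s0; have ls := logT_gt0 s0.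
have /andP[h1 h2] := h s s0.
have F0 : 0 < hFv s by apply: mulr_gt0; [|apply: mulr_gt0]; apply: powR_gt0.
have e : ((1 + s) `^ (- th) * logS s `^ (- et)) `^ p * hFv s `^ (q / m) =
    (1 + s) `^ (- (th * p + (th + 1) * (q / m))) * (logS s `^ ((c - et - j) * (q / m) - et * p) *
     logT s `^ (- (d * q))).
  rewrite /hFv monomial_powR//.
  have -> : - th * p + (- th - 1) * (q / m) = - (th * p + (th + 1) * (q / m)) by ring.
  have -> : - et * p + (c - et - j) * (q / m) = (c - et - j) * (q / m) - et * p by ring.
  by have -> : - (d * m) * (q / m) = - (d * q) by field; rewrite gt_eqF.
apply: le_trans (ler_wpM2l (powR_ge0 _ _) (hB _ _ F0 h1 h2)) _.
rewrite mulrCA e -[leRHS]mulrA ler_pM2l//.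
rewrite ler_pdivlMl//; apply: le_trans (hk' s s0); rewrite ler_pM2l//.
rewrite [leRHS]mulrC; apply: ler_pM; rewrite ?powR_ge0 ?mulr_ge0 ?powR_ge0//.
  by rewrite -(powR_inv1 (ltW Ss)) ler_powR ?lerN2// ltW// S_gt1.
rewrite [leRHS]mulrC; apply: ler_pM; rewrite ?powR_ge0// ler_powR ?logT_ge1 ?logS_ge1//.
by rewrite /om; move: hT; lra.
Qed.

Lemma smooth1_log_u : smooth1 [set x | 0 < x] log_u.
Proof.
have oP := @open_pos R.
exact: (smoothM oP (smoothM oP (smooth_powR _ oP S_gt0 smooth1_S) (smooth_powR _ oP logS_gt0 smooth1_logS))
  (smoothB oP (smooth_cst _ 2 oP) (smooth_powR _ oP logT_gt0 smooth1_logT))).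
Qed.

Lemma smooth1_log_F : smooth1 [set x | 0 < x] log_F.
Proof.
have oP := @open_pos R.
exact: (smoothM oP (smoothM oP (smooth_sub (@subsetT _ _) (@smooth1_id R)) (smooth_inv oP S_gt0 smooth1_S))
  (smoothM oP (smooth_powR _ oP logT_gt0 smooth1_logT) (smooth_powR _ oP logS_gt0 smooth1_logS))).
Qed.

Hypothesis thm : 0 < 1 - th * (m - 1).
Let al : R := (1 - th * (m - 1)) / m.
Let be : R := (c + (et + j) * (m - 1)) / m.

Let al0 : 0 < al. Proof. by rewrite divr_gt0. Qed.
Let be0 : 0 <= be.
Proof.
have /andP[j_ge0 _] := jr.
apply: divr_ge0; last exact: ltW.
apply: addr_ge0; first exact: ltW.
by apply: mulr_ge0; [exact: addr_ge0|rewrite subr_ge0 ltW].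
Qed.

(* Up to a constant factor [P0] is a lower bound for the arclength of the
   meridians; its two terms are responsible for the ends [s = +oo] and
   [s = 0].  The product of [|dP0 s|] with [core s] is bounded. *)
Let P0 s : R := (1 + s) `^ al * logS s `^ (- be) - ln (logT s).
Let dP0 s : R := (1 + s) `^ (al - 1) * logS s `^ (- be) * (al - be / logS s) + (s * (1 + s) * logT s)^-1.
Let core s : R := s * (logT s * ((1 + s) `^ (- al) * logS s `^ be)).

Let is_derive_P0 s : 0 < s -> is_derive s 1 P0 (dP0 s).
Proof.
move=> s0; have Ss := S_gt0 s0; have Ls := logS_gt0 s0; have ls := logT_gt0 s0.
apply: is_derive_eq (is_derive_sub (is_derive_mul
   (@is_derive_pow _ al (fun s => 1 + s) s _ Ss (is_derive_S s))
   (is_derive_pow (- be) Ls (is_derive_logS s0)))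
  (is_derive_log ls (is_derive_logT s0))) _.
rewrite /dP0 (powR_succ al Ss) (powR_succ (- be) Ls).
by field; rewrite !gt_eqF.
Qed.

(** Since [v] is comparable to the monomial in the first factor, [core] is comparable to
    [k = (F / v^(m-1))^(1/m)]. *)
Let core_identity s : 0 < s ->
  ((1 + s) `^ (- th - 1) * logS s `^ (- et) * w1 s) `^ (m - 1) * core s `^ m = log_F s.
Proof.
move=> s0; have Ss := S_gt0 s0; have Ls := logS_gt0 s0; have ls := logT_gt0 s0.
have n0 : m != 0 by rewrite gt_eqF.
have := @monomial_identity _ m th et c d j (ln s) (ln (1 + s)) (ln (logS s)) (ln (logT s)) n0.
by rewrite !lnK ?posrE// -T_E.
Qed.

Let kE : exists2 kk : R, 0 < kk & forall s, 0 < s ->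
  kk * ((1 + s) `^ (- th - 1) * logS s `^ (- et) * w1 s) <= log_v s.
Proof.
have [k [C [k0 _ h]]] := log_W_bounds; exists k => // s s0.
have /andP[hs _] := h s s0; rewrite mulrCA -/(log_v s) /log_v.
by apply: ler_wpM2l hs; rewrite mulr_ge0// powR_ge0.
Qed.

Lemma log_arclength (e1 A : R) : 0 < e1 -> 0 < A -> exists2 Q : R, 0 < Q & forall s, 0 < s ->
  is_derive s 1 (fun s => Q^-1 * P0 s) (Q^-1 * dP0 s) /\
  A * log_F s * `|Q^-1 * dP0 s| `^ m <= (e1 * log_v s) `^ (m - 1).
Proof.
move=> e10 A0; have [kk kk0 hk] := kE.
pose E : R := (A / (e1 * kk) `^ (m - 1)) `^ m^-1.
have ek0 : 0 < e1 * kk by rewrite mulr_gt0.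
have E0 : 0 < E by rewrite powR_gt0// divr_gt0// powR_gt0.
have Em : E `^ m = A / (e1 * kk) `^ (m - 1).
  by rewrite -powRrM mulVf ?gt_eqF// powRr1// divr_ge0 ?powR_ge0// ltW.
have [C2 C20 hC2] := @log_powR_le R 1 be ltr01 be0.
pose Q := E * (al + be + C2).
have Q0 : 0 < Q by rewrite mulr_gt0// ltr_wpDl// addr_ge0// ltW.
exists Q => // s s0; split; first exact: is_derive_mulc (is_derive_P0 s0).
have Ss := S_gt0 s0; have Ls := logS_gt0 s0; have ls := logT_gt0 s0.
have v0 := log_v_gt0 s0.
pose g := (1 + s) `^ (- th - 1) * logS s `^ (- et) * w1 s.
have g0 : 0 <= g by rewrite !mulr_ge0 ?powR_ge0// addr_ge0// invr_ge0 ltW.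
have co : 0 <= core s by rewrite !mulr_ge0 ?powR_ge0// ltW.
apply: (@arclength_bound _ m _ _ (E * core s)) => //.
- by rewrite mulr_ge0// ltW.
- by rewrite mulr_ge0// ltW.
- rewrite (powRM _ (ltW E0) co) Em -(core_identity s0) -/g.
  have -> : A * (g `^ (m - 1) * core s `^ m) = (e1 * kk * g) `^ (m - 1) * (A / (e1 * kk) `^ (m - 1) * core s `^ m).
    rewrite (powRM _ (ltW ek0) g0); move: (powR_gt0 (m - 1) ek0).
    by set X := _ `^ (m - 1); set Y := g `^ _; set Z := core s `^ _ => X0; field; rewrite gt_eqF.
  apply: ler_wpM2r; first by rewrite mulr_ge0 ?powR_ge0// divr_ge0 ?powR_ge0// ltW.
  apply: powR_le; [by rewrite subr_ge0 ltW|by rewrite mulr_ge0// ltW|].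
  by rewrite -mulrA ler_pM2l// hk.
have hd : core s * `|dP0 s| <= al + be + C2.
  have t0 : 0 <= (s * (1 + s) * logT s)^-1 by rewrite invr_ge0 !mulr_ge0// ltW.
  have n0 : 0 <= (1 + s) `^ (al - 1) * logS s `^ (- be) by rewrite mulr_ge0 ?powR_ge0.
  have a1 : `|al - be / logS s| <= al + be.
    apply: le_trans (ler_normB _ _) _; rewrite (ger0_norm (ltW al0)) lerD2l ger0_norm.
      by rewrite ler_pdivrMr// ler_peMr// logS_ge1.
    by rewrite divr_ge0// ltW.
  apply: (@le_trans _ _ (core s * ((1 + s) `^ (al - 1) * logS s `^ (- be) * (al + be) + (s * (1 + s) * logT s)^-1))).
    apply: ler_wpM2l => //; rewrite /dP0; apply: le_trans (ler_normD _ _) _.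
    by rewrite (ger0_norm t0) normrM (ger0_norm n0) lerD2r ler_wpM2l.
  (* The two terms are bounded separately: [logT] by [1 + 1 / s] in the first, and the power of
     [logS] by a multiple of [1 + s] in the second. *)
  have -> : core s * ((1 + s) `^ (al - 1) * logS s `^ (- be) * (al + be) + (s * (1 + s) * logT s)^-1) =
      (al + be) * (logT s / (1 + s^-1)) + (1 + s) `^ (- al) / (1 + s) * logS s `^ be.
    have e1S : (1 + s) `^ (- al) * (1 + s) `^ (al - 1) = (1 + s)^-1.
      by rewrite -powRD_gt0// addrA addNr add0r powR_inv1// ltW.
    have e2L : logS s `^ be * logS s `^ (- be) = 1 by rewrite -powRD_gt0// subrr powRr0.
    rewrite mulrDr; congr (_ + _).
      rewrite /core; transitivity (s * logT s * ((1 + s) `^ (- al) * (1 + s) `^ (al - 1)) *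
        (logS s `^ be * logS s `^ (- be)) * (al + be)); first by ring.
      by rewrite e1S e2L T_E//; field; rewrite !gt_eqF.
    by rewrite /core; field; rewrite !gt_eqF.
  apply: lerD.
    rewrite ler_piMr ?addr_ge0 ?(ltW al0)// ler_pdivrMr ?T_gt0// mul1r log1_le// T_gt0//.
  have -> : (1 + s) `^ (- al) / (1 + s) * logS s `^ be = (1 + s) `^ (- al) * (logS s `^ be / (1 + s)) by ring.
  have a2 : (1 + s) `^ (- al) <= 1.
    by rewrite -[leRHS](powRr0 (1 + s)) ler_powR ?oppr_le0 ?(ltW al0)// ltW// S_gt1.
  have a3 : logS s `^ be / (1 + s) <= C2.
    by rewrite ler_pdivrMr//; have := hC2 _ (ltW (S_gt1 s0)); rewrite powRr1// ltW.
  rewrite -[leRHS]mul1r; apply: ler_pM => //; first exact: powR_ge0.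
  by rewrite divr_ge0 ?powR_ge0// ltW.
rewrite normrM gtr0_norm ?invr_gt0// mulrCA ler_pdivrMl// mulr1 /Q -mulrA.
by rewrite ler_pM2l.
Qed.

Let P0_small B : exists2 s : R, 0 < s <= 1 & P0 s <= B.
Proof.
(* The length at the puncture diverges only like [ln (logT s)], an iterated logarithm of [1 / s];
   hence the iterated exponential in the witness, which makes [logT s >= expR N]. *)
pose N := `|2 `^ al - B|.
have e1 : expR (- expR N) <= 1 by rewrite -[leRHS]expR0 ler_expR oppr_le0 expR_ge0.
exists (expR (- expR N)); first by rewrite expR_gt0.
set s := expR _; have s0 : 0 < s by exact: expR_gt0.
have Ss := S_gt0 s0; have ls := logT_gt0 s0.
have h1 : (1 + s) `^ al * logS s `^ (- be) <= 2 `^ al.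
  rewrite -[leRHS]mulr1; apply: ler_pM; rewrite ?powR_ge0//.
    by apply: powR_le; [exact: ltW|exact: ltW|rewrite -[2]/(1 + 1) lerD2l].
  by rewrite -[leRHS](powRr0 (logS s)) ler_powR ?logS_ge1// oppr_le0.
have h2 : N <= ln (logT s).
  rewrite -[leLHS]expRK ler_ln ?posrE ?expR_gt0//.
  apply: (@le_trans _ _ (ln (s^-1))); first by rewrite -expRN opprK expRK.
  apply: (@le_trans _ _ (ln (1 + s^-1))); last by rewrite /logT lerDr.
  by rewrite ler_ln ?posrE ?T_gt0 ?invr_gt0// lerDr.
apply: le_trans (lerB h1 h2) _.
by rewrite lerBlDr -lerBlDl; exact: ler_norm.
Qed.

Let logT_le s : 1 <= s -> ln (logT s) <= 1.
Proof.
move=> s1; have s0 : 0 < s by exact: lt_le_trans s1.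
have h1 : 1 + s^-1 <= 2 by rewrite -[2]/(1 + 1) lerD2l invf_le1.
have h2 : logT s <= 2 by apply: le_trans (log1_le (T_gt0 s0)) h1.
by have := log1_le (logT_gt0 s0); lra.
Qed.

Let root_bound : exists2 C, 0 < C & forall s, 0 < s ->
  (1 + s) `^ (al / 2) <= C * ((1 + s) `^ al * logS s `^ (- be)).
Proof.
have a2 : 0 < al / 2 by rewrite divr_gt0.
have [C C0 hC] := @log_powR_le R (al / 2) be a2 be0; exists C => // s s0.
have Ss := S_gt0 s0; have Ls := logS_gt0 s0.
have -> : (1 + s) `^ al = (1 + s) `^ (al / 2) * (1 + s) `^ (al / 2).
  by rewrite -powRD_gt0//; congr (_ `^ _); field.
rewrite -mulrA mulrCA ler_peMr ?powR_ge0// powRN mulrA ler_pdivlMr ?powR_gt0// mul1r.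
exact: hC (ltW (S_gt1 s0)).
Qed.

Let P0_large B : exists2 s : R, 1 <= s & B <= P0 s.
Proof.
have [C C0 hC] := root_bound; have a2 : 0 < 2 / al by rewrite divr_gt0.
pose y := C * (`|B| + 1) + 1.
have y1 : 1 <= y by rewrite lerDr mulr_ge0 ?(ltW C0)// addr_ge0.
have s1 : 1 <= y `^ (2 / al) by rewrite powR_ge1// ltW.
exists (y `^ (2 / al)) => //; set s := y `^ _; have s0 : 0 < s by exact: lt_le_trans s1.
have h : C * (`|B| + 1) <= C * ((1 + s) `^ al * logS s `^ (- be)).
  apply: le_trans (hC s s0); apply: (@le_trans _ _ (s `^ (al / 2))).
    rewrite /s -powRrM (_ : 2 / al * (al / 2) = 1); last by field; rewrite gt_eqF.
    by rewrite powRr1; [rewrite lerDl|exact: le_trans y1].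
  by apply: powR_le; [rewrite divr_ge0// ltW|exact: ltW|rewrite lerDr].
rewrite /P0; have := logT_le s1; have := ler_norm B.
by move: h; rewrite ler_pM2l//; lra.
Qed.

(** The relation [(1 + s)^al logS^(-be) <= (Q + 1) r] is inverted in two passes: [root_bound] first
    gives the rough bound [logS <= C4 ln r], which is then inserted back to get [(1 + s)^al] of
    order at most [r (ln r)^be]. *)
Lemma log_solution (p q a0 e1 A : R) : 0 <= a0 -> 0 < e1 -> 0 < A ->
  (forall s, 0 < s -> (a0 + e1 * log_u s) `^ p * (A * log_F s * (e1 * log_v s)) `^ (q / m) <= A * log_dF s) ->
  solution_with_growth m p q (fun r => r `^ al^-1 * ln r `^ (be / al)).
Proof.
move=> a00 e10 A0 H; have [Q Q0 hQ] := log_arclength e10 A0.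
have oP := @open_pos R; have [C3 C30 hC3] := root_bound.
pose c1 := Q * (Q^-1 * P0 2^-1).
pose C4 := 1 + 2 / al * (`|ln (C3 * (Q + 1))| + 1).
have al2 : 0 < 2 / al by rewrite divr_gt0.
have C40 : 0 < C4 by rewrite ltr_pwDl// mulr_ge0 ?(ltW al2)// addr_ge0.
have Q10 : 0 < Q + 1 by rewrite addr_gt0.
pose C5 := 1 + ((Q + 1) * C4 `^ be) `^ al^-1.
have C50 : 0 < C5 by rewrite ltr_pwDl// powR_ge0.
apply: (@solution_of_profile _ m p q (fun s => a0 + e1 * log_u s) (fun s => e1 * log_v s)
  (fun s => A * log_F s) (fun s => A * log_dF s) (fun s => Q^-1 * P0 s) (fun s => Q^-1 * dP0 s) _
  C5 (Num.max (2 + `|c1|) (expR 1))).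
- exact: m1.
- exact: (smoothD oP (smooth_cst _ a0 oP) (smoothM oP (smooth_cst _ e1 oP) smooth1_log_u)).
- exact: (smoothM oP (smooth_cst _ A oP) smooth1_log_F).
- move=> s s0; have /andP[h _] := log_u_bounds s0.
  rewrite ltr_wpDl// mulr_gt0//; apply: lt_le_trans h.
  by apply: mulr_gt0; apply: powR_gt0; [exact: S_gt0|exact: logS_gt0].
- by move=> s s0; rewrite mulr_gt0// log_v_gt0.
- by move=> s s0; rewrite mulr_gt0// log_F_gt0.
- move=> s s0; apply: is_derive_eq (is_derive_add (is_derive_const a0 s) (is_derive_mulc e1 (is_derive_log_u s0))) _.
  by rewrite add0r mulrN.
- by move=> s s0; exact: is_derive_mulc (is_derive_log_F s0).
- exact: H.
- exact: hQ.
- move=> B; have [s s01 h] := P0_small (Q * B); exists s => //.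
  by rewrite ler_pdivrMl.
- move=> B; have [s s1 h] := P0_large (Q * B); exists s => //.
  by rewrite ler_pdivlMl.
- exact: C50.
move=> r; rewrite ge_max => /andP[r1 r2]; split; first by rewrite mulr_ge0 ?powR_ge0.
move=> s s0; rewrite ler_pdivrMl// mulrDr -/c1 => hs.
have r0 : 0 < r by apply: lt_le_trans r2; exact: expR_gt0.
have r11 : 1 <= r by apply: le_trans r1; rewrite -[2]/(1 + 1) -addrA lerDl addr_ge0.
have lr : 1 <= ln r by rewrite -[leLHS]expRK ler_ln ?posrE ?expR_gt0.
have ia : 0 <= al^-1 by rewrite invr_ge0 ltW.
have g1 : 1 <= r `^ al^-1 * ln r `^ (be / al).
  have ba : 0 <= be / al by rewrite divr_ge0// ltW.
  by rewrite -[leLHS]mulr1; apply: ler_pM => //; apply: powR_ge1.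
(* For [s < 1] the term [ln (logT s)] is not bounded, but there [s] is below the growth function
   anyway. *)
have [s1|s1] := leP 1 s; last first.
  apply: le_trans (ltW s1) _; apply: (le_trans g1).
  by apply: ler_peMl; [exact: le_trans ler01 g1|rewrite lerDl powR_ge0].
have Ss := S_gt0 s0; have Ls := logS_gt0 s0.
set G := (1 + s) `^ al * logS s `^ (- be).
have hG : G <= (Q + 1) * r.
  have := logT_le s1; have := ler_norm c1; move: hs; rewrite /P0 -/G => h3 h4 h5.
  by rewrite mulrDl mul1r; lra.
have hS : ln (1 + s) <= 2 / al * ln (C3 * (Q + 1) * r).
  have h : (1 + s) `^ (al / 2) <= C3 * (Q + 1) * r.
    by apply: le_trans (hC3 s s0) _; rewrite -mulrA ler_pM2l.
  have aE : 2 / al * (al / 2) = 1 by field; rewrite gt_eqF.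
  have -> : ln (1 + s) = 2 / al * ln ((1 + s) `^ (al / 2)) by rewrite ln_powR mulrA aE mul1r.
  rewrite ler_pM2l// ler_ln ?posrE ?powR_gt0//.
  by rewrite !mulr_gt0.
have hL : logS s <= C4 * ln r.
  have C3Q : 0 < C3 * (Q + 1) by rewrite mulr_gt0.
  rewrite /logS /C4 mulrDl mul1r; apply: lerD => //; apply: le_trans hS _.
  rewrite -[leRHS]mulrA ler_pM2l// lnM ?posrE// mulrDl mul1r lerD2r.
  apply: le_trans (ler_norm _) _.
  by rewrite ler_peMr.
have hSa : (1 + s) `^ al <= (Q + 1) * C4 `^ be * (r * ln r `^ be).
  have -> : (1 + s) `^ al = G * logS s `^ be.
    by rewrite /G -mulrA -powRD_gt0// addNr powRr0 mulr1.
  have -> : (Q + 1) * C4 `^ be * (r * ln r `^ be) = (Q + 1) * r * (C4 * ln r) `^ be.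
    rewrite powRM ?(ltW C40) ?(le_trans ler01 lr)//; ring.
  apply: ler_pM => //; first by rewrite mulr_ge0 ?powR_ge0.
    exact: powR_ge0.
  by apply: powR_le => //; exact: ltW.
apply: (@le_trans _ _ (1 + s)); first by rewrite lerDr.
have -> : 1 + s = ((1 + s) `^ al) `^ al^-1 by rewrite -powRrM mulfV ?gt_eqF// powRr1// ltW.
apply: le_trans (powR_le ia (powR_ge0 _ _) hSa) _.
rewrite powRM ?mulr_ge0 ?powR_ge0 ?(ltW r0) ?(ltW Q10)// [(r * _) `^ _]powRM ?powR_ge0 ?(ltW r0)//.
rewrite -[(ln r `^ be) `^ _]powRrM; apply: ler_wpM2r; first by rewrite mulr_ge0 ?powR_ge0.
by rewrite lerDr.
Qed.

End log_profile.

(** * Choice of the exponents for (A), (B) and (C) *)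

Section log_growth.
Context {R : realType}.
Implicit Types (m p q eps : R).

Lemma growth_log_exponent m p q a b b' : b <= b' ->
  solution_with_growth m p q (fun r : R => r `^ a * ln r `^ b) ->
  solution_with_growth m p q (fun r => r `^ a * ln r `^ b').
Proof.
move=> bb; apply: (@growth_le _ m p q _ _ (expR 1)) => r r1.
have r0 : 0 < r by apply: lt_le_trans r1; exact: expR_gt0.
apply: ler_wpM2l; first exact: powR_ge0.
by rewrite ler_powR// -[leLHS]expRK ler_ln ?posrE ?expR_gt0.
Qed.

(* The value of [d] makes both [d (m - 1) < 1] and [d (m - 1 - q) <= 1] hold. *)
Lemma log_log_exponent m q : 1 < m -> exists d, [/\ 0 < d, d * (m - 1) < 1 & d * (m - 1 - q) <= 1].
Proof.
move=> m1; have D0 : 0 < m + `|q| by rewrite ltr_wpDr// (lt_trans ltr01).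
have q1 := ler_normr q q; rewrite lexx /= in q1.
have q2 := ler_normr (- q) q; rewrite lexx orbT in q2.
exists (m + `|q|)^-1; split; first by rewrite invr_gt0.
- by rewrite mulrC ltr_pdivrMr// mul1r; move: (normr_ge0 q); lra.
- by rewrite mulrC ler_pdivrMr// mul1r; move: (ler_norm (- q)); rewrite normrN; lra.
Qed.

(* The case [p' = p] gives (A); replacing [u] by [1 + u] makes the factor
   [u `^ p] harmless when [p < 0], so that [p' = 0] gives (C). *)
Lemma supercritical_growth m p p' q eps a0 K : 1 < m -> 0 < eps -> 0 <= p' ->
  m - 1 - p' < q -> q < m -> 0 <= a0 -> 0 < K ->
  (forall x y : R, 0 < y -> y <= x -> x <= 2 * y -> (a0 + x) `^ p <= K * y `^ p') ->
  solution_with_growth m p q (fun r =>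
    r `^ ((m * p' + q) / (p' + q - m + 1)) * ln r `^ ((m - 1) / (p' + q - m + 1) + eps)).
Proof.
move=> m1 eps0 p0 q1 q2 a00 K0 hK.
have m0 : 0 < m by apply: lt_trans m1.
have D0 : 0 < m * p' + q.
  have : 0 <= (m - 1) * p' by rewrite mulr_ge0// subr_ge0 ltW.
  by rewrite mulrBl; move: q1; lra.
have N0 : 0 < p' + q - m + 1 by move: q1; lra.
have mq : 0 < m - q by rewrite subr_gt0.
(* The loss in the power of the logarithm is exactly [c], hence [c <= eps]; the other bound keeps
   [et] nonnegative. *)
pose c := Num.min eps (m / (m - q)).
have c0 : 0 < c by rewrite lt_min eps0 divr_gt0.
have ce : c <= eps by rewrite ge_min lexx.
have cm : c * (m - q) <= m by rewrite -ler_pdivlMr// ge_min lexx orbT.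
(* These values turn the conditions [hS] and [hL] on the powers of [1 + s] and of [logS] into
   equalities. *)
pose th := (m - q) / (m * p' + q); pose et := (m - c * (m - q)) / (m * p' + q).
have th0 : 0 < th by rewrite divr_gt0.
have et0 : 0 <= et by rewrite divr_ge0 ?subr_ge0// ltW.
have [d [d0 dm dq]] := log_log_exponent q m1.
have nD : m * p' + q != 0 by rewrite gt_eqF.
have nN : p' + q - m + 1 != 0 by rewrite gt_eqF.
have nm : m != 0 by rewrite gt_eqF.
have hj (y : R) : 1 <= y -> th * y `^ (- 0) <= th + et / y <= (th + et) * y `^ (- 0).
  move=> y1; have y0 : 0 < y by apply: lt_le_trans y1.
  rewrite oppr0 powRr0 !mulr1 lerDl divr_ge0 ?(ltW y0)//= lerD2l.
  by rewrite ler_pdivrMr// ler_peMr.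
have j1 : 0 < th + et by rewrite ltr_pwDl.
have jr : 0 <= (0 : R) <= 1 by rewrite lexx ler01.
have thE : 1 - th * (m - 1) = m * (p' + q - m + 1) / (m * p' + q) by rewrite /th; field.
have thm : 0 < 1 - th * (m - 1) by rewrite thE divr_gt0// mulr_gt0.
have hS : 1 <= th * p' + (th + 1) * (q / m).
  by have -> : th * p' + (th + 1) * (q / m) = 1 by rewrite /th; field; rewrite nD nm.
have hL : (c - et - 0) * (q / m) - et * p' <= c - 1.
  by have -> : (c - et - 0) * (q / m) - et * p' = c - 1 by rewrite /et; field; rewrite nD nm.
have [B B0 hB] := log_source m1 c0 d0 dm jr th0 j1 hj hS hL dq.
have qm : q / m < 1 by rewrite ltr_pdivrMr// mul1r.
have [A A0 hA] := scaling_constant qm (mulr_gt0 K0 B0).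
have := @log_solution _ m th et c d 0 th (th + et) m1 et0 c0 d0 jr th0 j1 hj thm p q a0 1 A a00 ltr01 A0.
have -> : (c + (et + 0) * (m - 1)) / m / ((1 - th * (m - 1)) / m) = (m - 1) / (p' + q - m + 1) + c.
  by rewrite thE /et; field; rewrite nD nN nm.
have -> : ((1 - th * (m - 1)) / m)^-1 = (m * p' + q) / (p' + q - m + 1).
  by rewrite thE; field; rewrite nD nN nm.
move=> h; apply: growth_log_exponent (h _); first by rewrite lerD2l.
move=> s s0; rewrite !mul1r.
have /andP[u1 u2] := @log_u_bounds _ th et d d0 s s0.
have y0 : 0 < (1 + s) `^ (- th) * logS s `^ (- et).
  by apply: mulr_gt0; apply: powR_gt0; [exact: S_gt0|exact: logS_gt0].
have F0 := log_F_gt0 m c d s0.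
have v0 := log_v_gt0 d0 jr th0 j1 hj s0.
rewrite -mulrA (powRM _ (ltW A0) (ltW (mulr_gt0 F0 v0))) -[X in _ <= X * _]hA.
rewrite mulrCA -[leRHS]mulrA ler_pM2l ?powR_gt0// -[leRHS]mulrA.
apply: (@le_trans _ _ (K * (((1 + s) `^ (- th) * logS s `^ (- et)) `^ p' * (log_F m c d s * log_v th et d s) `^ (q / m)))).
  by rewrite [leRHS]mulrA; apply: ler_wpM2r; [exact: powR_ge0|exact: hK].
by rewrite ler_pM2l//; exact: hB.
Qed.

Lemma growth_nonneg_power m p q eps : 1 < m -> 0 < eps -> 0 <= p -> m - 1 - p < q -> q < m ->
  solution_with_growth m p q (fun r =>
    r `^ ((m * p + q) / (p + q - m + 1)) * ln r `^ ((m - 1) / (p + q - m + 1) + eps)).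
Proof.
move=> m1 eps0 p0 q1 q2.
apply: (@supercritical_growth m p p q eps 0 (2 `^ p)); rewrite ?powR_gt0// => x y y0 yx xy.
rewrite add0r -powRM ?(ltW y0)//.
by apply: powR_le => //; exact: le_trans (ltW y0) yx.
Qed.

Lemma growth_neg_power m p q eps : 1 < m -> 0 < eps -> p < 0 -> m - 1 < q -> q < m ->
  solution_with_growth m p q (fun r =>
    r `^ (q / (q - m + 1)) * ln r `^ ((m - 1) / (q - m + 1) + eps)).
Proof.
move=> m1 eps0 p0 q1 q2.
have := @supercritical_growth m p 0 q eps 1 1 m1 eps0 (lexx 0) _ q2 ler01 ltr01.
rewrite subr0 mulr0 !add0r; apply=> // x y y0 yx _.
rewrite powRr0 mul1r -[leRHS](powRr0 (1 + x)) ler_powR ?(ltW p0)//.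
by rewrite lerDl (le_trans (ltW y0)).
Qed.

(** For [q >= m] scaling [F] up no longer absorbs constants. Instead the decaying part of [u] is
    multiplied by a small [e], which multiplies the source by at most [e] times a constant and
    leaves [F'] unchanged; adding 1 to it keeps [u] between 1 and 3, whatever the sign of [p]. The
    decay is purely logarithmic: [th = 0] and [j = 1]. *)
Lemma growth_large_exponent m p q eps : 1 < m -> 0 < eps -> m <= q ->
  solution_with_growth m p q (fun r => r `^ m * ln r `^ (m - 1 + eps)).
Proof.
move=> m1 eps0 q1.
have m0 : 0 < m by apply: lt_trans m1.
have nm : m != 0 by rewrite gt_eqF.
(* With [th = 0], [et = c] and [j = 1] the power of the logarithm is [m c + m - 1], hence
   [c = eps / m]. *)
pose c := eps / m; have c0 : 0 < c by rewrite divr_gt0.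
have [d [d0 dm dq]] := log_log_exponent q m1.
have hj (y : R) : 1 <= y -> c * y `^ (- 1) <= 0 + c / y <= c * y `^ (- 1).
  by move=> y1; rewrite add0r powR_inv1 ?lexx// (le_trans ler01).
have jr : 0 <= (1 : R) <= 1 by rewrite lexx ler01.
have thm : 0 < 1 - 0 * (m - 1) by rewrite mul0r subr0.
have qm : 1 <= q / m by rewrite ler_pdivlMr// mul1r.
have hS : 1 <= 0 * 0 + (0 + 1) * (q / m) by rewrite mul0r !add0r mul1r.
have hL : (c - c - 1) * (q / m) - c * 0 <= c - 1.
  by rewrite subrr mulr0 subr0 sub0r mulN1r; move: qm c0; lra.
have [B B0 hB] := log_source m1 c0 d0 dm jr c0 c0 hj hS hL dq.
(* Makes [e] times the constant [3^|p| B] at most 1; the added 1 ensures [e <= 1], so that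
   [e^(q/m) <= e]. *)
pose e := (3 `^ `|p| * B + 1)^-1.
have K0 : 0 < 3 `^ `|p| * B by rewrite mulr_gt0// powR_gt0.
have K1 : 0 < 3 `^ `|p| * B + 1 by rewrite addr_gt0.
have e0 : 0 < e by rewrite invr_gt0.
have e1 : e <= 1 by rewrite invf_le1// lerDr ltW.
have := @log_solution _ m 0 c c d 1 c c m1 (ltW c0) c0 d0 jr c0 c0 hj thm p q 1 e 1 ler01 e0 ltr01.
have -> : (c + (c + 1) * (m - 1)) / m / ((1 - 0 * (m - 1)) / m) = m - 1 + eps.
  by rewrite mul0r subr0 /c; field.
have -> : ((1 - 0 * (m - 1)) / m)^-1 = m by rewrite mul0r subr0 mul1r invrK.
apply=> s s0; rewrite !mul1r.
have /andP[u1 u2] := @log_u_bounds _ 0 c d d0 s s0.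
have u0 : 0 < log_u 0 c d s.
  by apply: lt_le_trans u1; apply: mulr_gt0; apply: powR_gt0; [exact: S_gt0|exact: logS_gt0].
have u3 : log_u 0 c d s <= 2.
  apply: le_trans u2 _; rewrite oppr0 powRr0 mul1r ler_piMr//.
  by rewrite -[leRHS](powRr0 (logS s)) ler_powR ?logS_ge1// oppr_le0 ltW.
have F0 := log_F_gt0 m c d s0.
have v0 := log_v_gt0 d0 jr c0 c0 hj s0.
rewrite (mulrCA (log_F m c d s)) (powRM _ (ltW e0) (ltW (mulr_gt0 F0 v0))).
have U1 : 1 <= 1 + e * log_u 0 c d s by rewrite lerDl mulr_ge0 ?ltW.
have U3 : 1 + e * log_u 0 c d s <= 3.
  have : e * log_u 0 c d s <= 1 * 2 by apply: ler_pM => //; exact: ltW.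
  by rewrite mul1r; lra.
have Up : (1 + e * log_u 0 c d s) `^ p <= 3 `^ `|p|.
  apply: (@le_trans _ _ ((1 + e * log_u 0 c d s) `^ `|p|)); first by rewrite ler_powR// ler_norm.
  by apply: powR_le => //; exact: le_trans ler01 U1.
have ep : e `^ (q / m) <= e.
  by rewrite -[leRHS](powRr1 (ltW e0)); apply: ger_powR; rewrite ?e0.
have := hB s s0; rewrite powRr0 mul1r => hs.
apply: (@le_trans _ _ (3 `^ `|p| * (e * (B * log_dF m c d s)))).
  by apply: ler_pM => //; rewrite ?mulr_ge0 ?powR_ge0//; apply: ler_pM; rewrite ?powR_ge0.
have dF0 : 0 <= log_dF m c d s.
  by rewrite -(pmulr_rge0 _ B0); apply: le_trans hs; exact: powR_ge0.
have -> : 3 `^ `|p| * (e * (B * log_dF m c d s)) = e * (3 `^ `|p| * B) * log_dF m c d s by ring.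
by rewrite ler_piMl// ler_pdivrMl// mulr1 lerDl.
Qed.

End log_growth.

Theorem theorem1p6 (R : realType) (m p q eps : R) (hm : 1 < m) (heps : 0 < eps) :
  (* A *)
  (0 <= p -> m - 1 - p < q -> q < m ->
    solution_with_growth m p q (fun r =>
      r `^ ((m * p + q) / (p + q - m + 1)) *
      ln r `^ ((m - 1) / (p + q - m + 1) + eps))) /\
  (* B *)
  (m <= q ->
    solution_with_growth m p q (fun r => r `^ m * ln r `^ (m - 1 + eps))) /\
  (* C *)
  (p < 0 -> m - 1 < q -> q < m ->
    solution_with_growth m p q (fun r =>
      r `^ (q / (q - m + 1)) * ln r `^ ((m - 1) / (q - m + 1) + eps))) /\
  (* D *)
  (q = m - 1 -> p < m - 1 - q -> forall lam : R, 0 < lam ->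
    solution_with_growth m p q (fun r => expR (lam * r))) /\
  (* E *)
  (p = m - 1 - q -> q <= m - 1 -> exists2 iota : R, 0 < iota &
    solution_with_growth m p q (fun r => expR (iota * r))) /\
  (* F *)
  (p < m - 1 - q -> q < m - 1 -> forall lam : R, 0 < lam ->
    exists iota : R, [/\ 0 < iota, 2 * (m - 1 - q) + 1 < iota &
      solution_with_growth m p q (fun r => expR (lam * r `^ iota * ln r))]).
Proof.
split; [|split; [|split; [|split; [|split]]]].
- exact: growth_nonneg_power.
- exact: growth_large_exponent.
- exact: growth_neg_power.
- move=> qE; rewrite qE subrr => p0 lam lam0.
  exact: critical_negative_power.
- exact: critical_sum.
- move=> pq qm lam lam0; exact: subcritical_growth.
Qed.
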